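(* Let $\mathcal X$ and $\Theta$ be open subsets of $\mathbb R^d$ and $\mathbb R^r$ respectively, and let $\mathbb Q=\mathbb P_{\theta_*}$ with $\theta_*=\mathrm{argmin}_{\theta\in\Theta}\mathrm{DKSD}_{K,m}(\mathbb Q\|\mathbb P_\theta)^2$. Let $K$ be a bounded kernel with bounded derivatives up to order $2$. Let $\hat\theta_n\in\mathrm{argmin}_{\theta\in\Theta}\widehat{\mathrm{DKSD}}_{K,m}(\{X_i\}_{i=1}^n\|\mathbb P_\theta)^2$ and suppose that $\hat\theta_n\to\theta_*$ in probability and that there exists a compact neighbourhood $\mathcal N\subset\Theta$ of $\theta_*$ such that $\theta\mapsto\widehat{\mathrm{DKSD}}_{K,m}(\{X_i\}_{i=1}^n\|\mathbb P_\theta)^2$ is twice continuously differentiable for $\theta\in\mathcal N$ and, for $\mathbb Q$-a.e. $x\in\mathcal X$ (and $\theta\in\mathcal N$), 1. $\|m^\top(x)\nabla\log p_\theta(x)\|+\|\nabla_\theta(m(x)^\top\nabla\log p_\theta(x))\|\le f_1(x)$, 2. $\|m(x)\|+\|\nabla_xm(x)\|+\|\nabla_\theta m(x)\|+\|\nabla_\theta\nabla_xm(x)\|\le f_2(x)$, 3. $\|\nabla_\theta\nabla_\theta(m(x)^\top\nabla\log p_\theta(x))\|+\|\nabla_\theta\nabla_\theta\nabla_\theta(m(x)^\top\nabla\log p_\theta(x))\|\le g_1(x)$, 4. $\|\nabla_\theta\nabla_\theta m(x)\|+\|\nabla_\theta\nabla_\theta\nabla_xm(x)\|+\|\nabla_\theta\nabla_\theta\nabla_\theta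 m(x)\|+\|\nabla_\theta\nabla_\theta\nabla_\theta\nabla_xm(x)\|\le g_2(x)$, where $f_1,f_2\in L^2(\mathbb Q)$ and $g_1,g_2\in L^1(\mathbb Q)$ are continuous. Suppose also that the information tensor $g_{\mathrm{DKSD}}$ is invertible at $\theta_*$. Then $$\sqrt n\,(\hat\theta_n-\theta_* )\xrightarrow{d}\mathcal N\big(0,\ g_{\mathrm{DKSD}}^{-1}(\theta_* )\,\Sigma_{\mathrm{DKSD}}\,g_{\mathrm{DKSD}}^{-1}(\theta_* )\big),$$ where $$\Sigma_{\mathrm{DKSD}}=\int_{\mathcal X}\Big(\int_{\mathcal X}\nabla_\theta k^0_{\theta_*}(x,y)\,d\mathbb Q(y)\Big)\otimes\Big(\int_{\mathcal X}\nabla_\theta k^0_{\theta_*}(x,z)\,d\mathbb Q(z)\Big)d\mathbb Q(x).$$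
   Context: $\{\mathbb P_\theta:\theta\in\Theta\}$ is a family of probability measures on $\mathcal X$ with positive densities $p_\theta$. $X_1,X_2,\dots$ are i.i.d. from the probability measure $\mathbb Q$. $m:\mathcal X\to\mathbb R^{d\times d}$ is a diffusion matrix which may also depend on $\theta$ (then written $m_\theta$). $K:\mathcal X\times\mathcal X\to\mathbb R^{d\times d}$ is the matrix-valued reproducing kernel of an RKHS of functions $\mathcal X\to\mathbb R^d$. The Stein kernel is $k^0_\theta(x,y)=\frac1{p_\theta(x)p_\theta(y)}\nabla_y\cdot\nabla_x\cdot\big(p_\theta(x)m(x)K(x,y)m(y)^\top p_\theta(y)\big)$, where $(\nabla\cdot A)_i=\sum_j\partial_jA_{ji}$ for matrix fields. The squared diffusion kernel Stein discrepancy is $\mathrm{DKSD}_{K,m}(\mathbb Q\|\mathbb P_\theta)^2=\iint k_\theta^0\,d\mathbb Q\otimes d\mathbb Q$, and its U-statistic approximation is $\widehat{\mathrm{DKSD}}_{K,m}(\{X_i\}_{i=1}^n\|\mathbb P_\theta)^2=\frac1{n(n-1)}\sum_{i\ne j}k_\theta^0(X_i,X_j)$. The information tensor is $g_{\mathrm{DKSD}}(\theta)_{ij}=-\tfrac12\partial_{\alpha^i}\partial_{\theta^j}\mathrm{DKSD}_{K,m}(\mathbb P_\alpha\|\mathbb P_\theta)^2|_{\alpha=\theta}$, with components $\iint\big(\nabla_x\partial_{\theta^j}\log p_\theta(x)\big)^\top m_\theta(x)K(x,y)m_\theta^\top(y)\nabla_y\partial_{\theta^i}\log p_\theta(y)\,d\mathbb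 P_\theta(x)d\mathbb P_\theta(y)$.
   Formalization: Two assumptions added: DKSD(P_θ‖P_θ)²=0 for θ near θ_* (the Stein-class property, without which the claim is false), and DKSD(P_α‖P_θ)² is finite and jointly C² in (α,θ) near (θ_*,θ_* ), so that the mixed derivative defining g_DKSD is meaningful. *)

(* Defs.v *)
From HB Require Import structures.
From mathcomp Require Import all_boot all_order all_algebra.
From mathcomp Require Import all_classical all_reals all_analysis.

Set Implicit Arguments.
Unset Strict Implicit.
Unset Printing Implicit Defensive.

Import Order.TTheory GRing.Theory Num.Theory.
Import numFieldNormedType.Exports.

Local Open Scope classical_set_scope.
Local Open Scope ring_scope.

(* Conventions: points of R^d (arguments of functions, parameters, values of
   random vectors) are rows 'rV[R]_d, the values of vector fields (gradients,
   elements of the RKHS) are columns 'cV[R]_d. *)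

(* The Borel sigma-algebra on matrices, hence on R^d = 'rV[R]_d. *)
HB.instance Definition _ (R : realType) (m n : nat) :=
  @isMeasurable.Build (sigma_display (@open 'M[R]_(m, n))) 'M[R]_(m, n)
    <<s (@open 'M[R]_(m, n)) >>
    (@sigma_algebra0 _ setT (@open 'M[R]_(m, n)))
    (@sigma_algebraC 'M[R]_(m, n) (@open 'M[R]_(m, n)))
    (@sigma_algebra_bigcup _ setT (@open 'M[R]_(m, n))).

(* Lebesgue measure of Borel subsets of R^n, as an iterated integral
   (Tonelli): lambda_(n+1)(A) = \int lambda_n {v | (x, v) \in A} dx. *)
Fixpoint lebesgue_rV (R : realType) (n : nat) : set 'rV[R]_n -> \bar R :=
  match n with
  | 0 => fun A => \d_(0 : 'rV[R]_0) A
  | n'.+1 => fun A => (\int[@lebesgue_measure R]_x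
      @lebesgue_rV R n' [set v | A (row_mx (const_mx x : 'rV[R]_1) v)])%E
  end.

Section Calculus.
Context (R : realType).

Definition ebasis (n : nat) (i : 'I_n) : 'rV[R]_n := delta_mx 0 i.

Definition prod_basis (m n : nat) (i : 'I_m + 'I_n) : 'rV[R]_m * 'rV[R]_n :=
  match i with
  | inl j => (ebasis j, 0)
  | inr j => (0, ebasis j)
  end.

Section Order.
Context (V W : normedModType R) (I : finType) (e : I -> V).

(* || \nabla^k f (t) ||, the sum of the norms of all the k-th order partial
   derivatives along the directions e; all norms on k-tensors are
   equivalent. *)
Fixpoint dnorm (k : nat) (f : V -> W) (t : V) : R :=
  match k with
  | 0 => `|f t|
  | k'.+1 => \sum_(i : I) dnorm k' (fun s => 'D_(e i) f s) t
  end.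

(* The derivatives are two-sided, also at the boundary points of A. *)
Fixpoint ndiff (k : nat) (A : set V) (f : V -> W) : Prop :=
  match k with
  | 0 => True
  | k'.+1 => (forall t, A t -> differentiable f t) /\
             (forall i, ndiff k' A (fun s => 'D_(e i) f s))
  end.

Fixpoint cndiff (k : nat) (A : set V) (f : V -> W) : Prop :=
  match k with
  | 0 => {within A, continuous f}
  | k'.+1 => (forall t, A t -> differentiable f t) /\
             (forall i, cndiff k' A (fun s => 'D_(e i) f s))
  end.

End Order.

Definition grad (d : nat) (f : 'rV[R]_d -> R) (x : 'rV[R]_d) : 'cV[R]_d :=
  \col_i 'D_(ebasis i) f x.

Definition div_vec (d : nat) (v : 'rV[R]_d -> 'cV[R]_d) (x : 'rV[R]_d) : R :=
  \sum_i 'D_(ebasis i) (fun z => v z i 0) x.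

Definition div_mx (d : nat) (A : 'rV[R]_d -> 'M[R]_d) (x : 'rV[R]_d) :
    'cV[R]_d :=
  \col_i \sum_j 'D_(ebasis j) (fun z => A z j i) x.

End Calculus.

(* K is, on X, the reproducing kernel of a Hilbert space H of functions
   X -> R^d. The elements of H are represented by their evaluations ev h,
   of which only the values on X matter: <h, K(., y) c> = h(y) . c. *)
Definition reproducing_kernel (R : realType) (d : nat) (X : set 'rV[R]_d)
    (K : 'rV[R]_d -> 'rV[R]_d -> 'M[R]_d) : Prop :=
  exists (H : completeNormedModType R) (ip : H -> H -> R)
         (ev : H -> 'rV[R]_d -> 'cV[R]_d),
    [/\ (forall g h, ip g h = ip h g),
        (forall a f g h, ip (a *: f + g) h = a * ip f h + ip g h) &
        (forall h, ip h h = `|h| ^+ 2)] /\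
    [/\ (forall a g h x, X x -> ev (a *: g + h) x = a *: ev g x + ev h x),
        (forall g h, (forall x, X x -> ev g x = ev h x) -> g = h) &
        (forall y c, X y -> exists k : H,
           (forall x, X x -> ev k x = K x y *m c) /\
           (forall h, ip h k = ((ev h y)^T *m c) 0 0))].

Section Stein.
Context (R : realType) (d : nat).
Implicit Types (q : 'rV[R]_d -> R) (m : 'rV[R]_d -> 'M[R]_d)
  (K : 'rV[R]_d -> 'rV[R]_d -> 'M[R]_d) (k : 'rV[R]_d -> 'rV[R]_d -> R).

Definition stein_kernel q m K (x y : 'rV[R]_d) : R :=
  (q x * q y)^-1 *
  div_vec (fun y' =>
    div_mx (fun x' => (q x' * q y') *: (m x' *m K x' y' *m (m y')^T)) x) y.

(* The squared discrepancy with Stein kernel k; as an extended real it is +oo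
   when the negative part of k is integrable and the positive part is not. *)
Definition dksd2 (X : set 'rV[R]_d) k (Q : probability 'rV[R]_d R) : \bar R :=
  (\int[(Q \x Q)]_(z in X `*` X) (k z.1 z.2)%:E)%E.

(* The U-statistic of the sample x 0, ..., x n.-1. *)
Definition dksd2_ustat k (n : nat) (x : nat -> 'rV[R]_d) : R :=
  (n * n.-1)%:R^-1 *
  \sum_(i < n) \sum_(j < n | j != i) k (x i) (x j).

Definition diff_score q m (x : 'rV[R]_d) : 'cV[R]_d :=
  (m x)^T *m grad (fun z => ln (q z)) x.

End Stein.

Definition argmin (T : Type) (disp : Order.disp_t) (S : porderType disp)
    (A : set T) (f : T -> S) : set T :=
  [set t | A t /\ forall s, A s -> (f t <= f s)%O].

(* g_ij = - 1/2 \partial_{alpha^i} \partial_{theta^j} F(alpha, theta)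
   at alpha = theta = t *)
Definition info_tensor (R : realType) (r : nat)
    (F : 'rV[R]_r -> 'rV[R]_r -> R) (t : 'rV[R]_r) : 'M[R]_r :=
  \matrix_(i, j) (- 2^-1 *
    'D_(ebasis R i) (fun a => 'D_(ebasis R j) (fun s => F a s) t) t).

Definition sigma_dksd (R : realType) (d r : nat) (X : set 'rV[R]_d)
    (k : 'rV[R]_r -> 'rV[R]_d -> 'rV[R]_d -> R)
    (Q : probability 'rV[R]_d R) (t : 'rV[R]_r) : 'M[R]_r :=
  \matrix_(i, j) \int[Q]_(x in X)
    ((\int[Q]_(y in X) 'D_(ebasis R i) (fun s => k s x y) t) *
     (\int[Q]_(z in X) 'D_(ebasis R j) (fun s => k s x z) t)).

Section Probability.
Context (R : realType).

(* Positive density on X with respect to Lebesgue measure; in particular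
   P X = 1. *)
Definition has_pos_density (d : nat) (X : set 'rV[R]_d)
    (P : probability 'rV[R]_d R) (q : 'rV[R]_d -> R) : Prop :=
  [/\ (forall x, X x -> 0 < q x),
      measurable_fun X q &
      (forall A, measurable A ->
         P A = (\int[@lebesgue_rV R d]_(x in A `&` X) (q x)%:E)%E)].

Section Sequences.
Context (dT : measure_display) (T : measurableType dT) (Pr : probability T R).

Definition iid (d' : measure_display) (S : measurableType d')
    (Q : probability S R) (X : nat -> {RV Pr >-> S}) : Prop :=
  (forall i A, measurable A -> Pr (X i @^-1` A) = Q A) /\
  (forall n (A : nat -> set S), (forall i, measurable (A i)) ->
     Pr (\bigcap_(i < n) (X i @^-1` A i)) =
       (\prod_(0 <= i < n) Pr (X i @^-1` A i))%E).

Definition cvg_in_probability (V : normedModType R) (Y : nat -> T -> V)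
    (l : V) : Prop :=
  forall eps : R, 0 < eps ->
    Pr [set w | eps <= `|Y n w - l|] @[n --> \oo] --> 0%E.

Definition cvg_in_distribution (r : nat) (Z : nat -> T -> 'rV[R]_r)
    (nu : probability 'rV[R]_r R) : Prop :=
  forall f : 'rV[R]_r -> R, continuous f -> (exists B : R, forall x, `|f x| <= B) ->
    \int[Pr]_w f (Z n w) @[n --> \oo] --> \int[nu]_x f x.

End Sequences.

(* N(mu, v) on the line. The case distinction is needed: normal_prob is the
   uniform law on [0, 1] for standard deviation 0. *)
Definition normal1 (mu v : R) : set R -> \bar R :=
  if v == 0 then \d_mu else normal_prob mu (Num.sqrt v).

(* nu = N(mu, V), V possibly singular: every linear form u |-> u . t has law
   N(mu . t, t . V t) under nu. *)
Definition is_normal (r : nat) (mu : 'rV[R]_r) (V : 'M[R]_r)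
    (nu : probability 'rV[R]_r R) : Prop :=
  [/\ V^T = V,
      (forall t : 'rV[R]_r, 0 <= (t *m V *m t^T) 0 0) &
      (forall (t : 'rV[R]_r) (A : set R), measurable A ->
         nu [set u : 'rV[R]_r | A ((u *m t^T) 0 0)] =
         normal1 ((mu *m t^T) 0 0) ((t *m V *m t^T) 0 0) A)].

End Probability.

(* Main.v *)
Require Import Defs.
From HB Require Import structures.
From mathcomp Require Import all_boot all_order all_algebra.
From mathcomp Require Import all_classical all_reals all_analysis.
From mathcomp Require Import measurable_realfun.
From mathcomp Require Import ring lra zify.

Set Implicit Arguments.
Unset Strict Implicit.
Unset Printing Implicit Defensive.

Import Order.TTheory GRing.Theory Num.Theory.
Import numFieldNormedType.Exports.

Local Open Scope classical_set_scope.
Local Open Scope ring_scope.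

(* Proof idea. Carrying out the divergences turns the Stein kernel into a finite
   sum k_t(x, y) = \sum_(a, b) KK_ab(x, y) psi_a(t, x) psi_b(t, y), where the
   KK_ab are the (bounded) derivatives of K of order at most one in each
   variable and the psi_a are the entries of m_t and of p_t^-1 div(p_t m_t).
   If f and g dominate the derivatives in t of the psi_a of orders at most 1
   and of orders 2 and 3, the Taylor expansion of k_t at ts has its remainder
   dominated by f(x) g(y) + g(x) f(y); as a U-statistic has no diagonal terms,
   f in L^2 and g in L^1 suffice.

   The matrices KK are limits of Gram matrices of difference quotients of K, so
   k_t is positive definite and F(a, t) = DKSD(P_a || P_t)^2 >= 0 near
   (ts, ts). As F vanishes on the diagonal, so does its gradient in t,
   and differentiating the latter along the diagonal identifies the Hessian in t
   of F with 2 g.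

   The gradient of the empirical criterion vanishes at the estimator. By the
   Hoeffding decomposition that gradient at ts is 2/n times a sum of iid
   centred vectors of covariance Sigma up to o_P(n^-1/2), and the law of large
   numbers for U-statistics turns the second derivatives into 2 g. The central
   limit theorem is proved through E cos(x + t . S_n), and passes to bounded
   continuous functions by tightness and Fejer approximation. *)

(** * Expectations *)

(** The analytic hypotheses hold only for almost every x in X. The features are therefore multiplied
    by the indicator of a measurable set X0 of full measure on which all of them hold; discrepancies
    from Q, Sigma and, almost surely, the criterion near ts are unchanged, and the rest works with a
    kernel on an arbitrary measurable space. No derivative is taken under an integral sign. The
    expansion of k_t is integrated with its remainder, and difference quotients identify the
    coefficients with derivatives that are assumed to exist. The rate sqrt n is not assumed either.
    Consistency makes the error of the random Hessian small, and its product with the normalised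
    estimator is absorbed in the left-hand side. That a positive definite kernel has a nonnegative
    double integral I is drawn from finite Gram sums: if I < 0 and the diagonal is at most B, some n
    points have a Gram sum of at most n (n - 1) I + n (B + 1), negative for large n. The normal law
    comes from a rank-one decomposition of V; its transform comes from C(n h) = C(h)^n and C(h) =
    exp(- h / 2) + O(h^2). *)

Notation L1 P f := (integrable P setT (EFin \o f)).

Lemma measurable_preimage d d' (T : measurableType d) (S : measurableType d')
    (f : T -> S) (A : set S) :
  measurable_fun setT f -> measurable A -> measurable (f @^-1` A).
Proof. by move=> mf mA; have := mf measurableT A mA; rewrite setTI. Qed.

Section Expectation.
Context d (T : measurableType d) (R : realType) (P : probability T R).
Implicit Types f g : T -> R.

Lemma L1_measurable f : L1 P f -> measurable_fun setT f.
Proof. by move=> /integrableP[/measurable_EFinP]. Qed.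

Lemma L1_le f g : measurable_fun setT f -> (forall x, `|f x| <= g x) ->
  L1 P g -> L1 P f.
Proof.
move=> mf fg; apply: le_integrable => //; first exact/measurable_EFinP.
move=> x _ /=; rewrite lee_fin (le_trans (fg x))//; exact: ler_norm.
Qed.

Lemma L1_cst (c : R) : L1 P (fun=> c).
Proof. exact: finite_measure_integrable_cst. Qed.

Lemma L1_bounded f (B : R) : measurable_fun setT f ->
  (forall x, `|f x| <= B) -> L1 P f.
Proof. by move=> mf fB; apply: (L1_le mf fB); exact: L1_cst. Qed.

Lemma L1D f g : L1 P f -> L1 P g -> L1 P (fun x => f x + g x).
Proof. by move=> lf lg; have := integrableD measurableT lf lg. Qed.

Lemma L1B f g : L1 P f -> L1 P g -> L1 P (fun x => f x - g x).
Proof. by move=> lf lg; have := integrableB measurableT lf lg. Qed.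

Lemma L1Z (c : R) f : L1 P f -> L1 P (fun x => c * f x).
Proof. by move=> lf; have := integrableZl measurableT c lf. Qed.

Lemma L1_norm f : L1 P f -> L1 P (fun x => `|f x|).
Proof. by move=> lf; have := integrable_norm lf. Qed.

Lemma L1_sum (I : Type) (s : seq I) (Q : pred I) (F : I -> T -> R) :
  (forall i, Q i -> L1 P (F i)) -> L1 P (fun x => \sum_(i <- s | Q i) F i x).
Proof.
move=> FL; elim: s => [|i s IH].
  under eq_fun do rewrite big_nil; exact: L1_cst.
under eq_fun do rewrite big_cons.
by case Qi: (Q i) => //; apply: L1D => //; exact: FL.
Qed.

Lemma L1_sq f : measurable_fun setT f -> L1 P (fun x => f x ^+ 2) -> L1 P f.
Proof.
move=> mf f2; apply: (@L1_le _ (fun x => 1 + f x ^+ 2)) => //.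
  move=> x; rewrite -(real_normK (num_real (f x))); have := normr_ge0 (f x); nra.
by apply: L1D => //; exact: L1_cst.
Qed.

Lemma L1_sqM f g : measurable_fun setT f -> measurable_fun setT g ->
  L1 P (fun x => f x ^+ 2) -> L1 P (fun x => g x ^+ 2) ->
  L1 P (fun x => f x * g x).
Proof.
move=> mf mg f2 g2; apply: (@L1_le _ (fun x => f x ^+ 2 + g x ^+ 2)).
- exact: measurable_funM.
- move=> x; rewrite normrM -[f x ^+ 2](real_normK (num_real (f x))).
  rewrite -[g x ^+ 2](real_normK (num_real (g x))).
  by have := normr_ge0 (f x); have := normr_ge0 (g x); nra.
- exact: L1D.
Qed.

Lemma ED f g : L1 P f -> L1 P g ->
  \int[P]_x (f x + g x) = \int[P]_x f x + \int[P]_x g x.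
Proof. exact: RintegralD. Qed.

Lemma EB f g : L1 P f -> L1 P g ->
  \int[P]_x (f x - g x) = \int[P]_x f x - \int[P]_x g x.
Proof. exact: RintegralB. Qed.

Lemma EZ (c : R) f : L1 P f -> \int[P]_x (c * f x) = c * \int[P]_x f x.
Proof. exact: RintegralZl. Qed.

Lemma E_cst (c : R) : \int[P]_x c = c.
Proof. by rewrite Rintegral_cst// (_ : fine (P [set: T]) = 1) ?mulr1// (probability_setT P). Qed.

Lemma E_sum (I : Type) (s : seq I) (Q : pred I) (F : I -> T -> R) :
  (forall i, Q i -> L1 P (F i)) ->
  \int[P]_x (\sum_(i <- s | Q i) F i x) = \sum_(i <- s | Q i) \int[P]_x F i x.
Proof.
move=> FL; elim: s => [|i s IH].
  under eq_Rintegral do rewrite big_nil.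
  by rewrite E_cst big_nil.
under eq_Rintegral do rewrite big_cons.
rewrite big_cons; case: ifP => Qi//.
by rewrite ED ?IH//; [exact: FL|exact: L1_sum].
Qed.

Lemma E_le f g : L1 P f -> L1 P g -> (forall x, f x <= g x) ->
  \int[P]_x f x <= \int[P]_x g x.
Proof. by move=> lf lg fg; apply: le_Rintegral => // x _. Qed.

Lemma E_norm f : L1 P f -> `|\int[P]_x f x| <= \int[P]_x `|f x|.
Proof. exact: le_normr_Rintegral. Qed.

Lemma E_norm_le f g : L1 P f -> L1 P g -> (forall x, `|f x| <= g x) ->
  `|\int[P]_x f x| <= \int[P]_x g x.
Proof.
by move=> lf lg fg; apply: (le_trans (E_norm lf)); apply: E_le => //; exact: L1_norm.
Qed.

Lemma E_bounded f (B : R) : measurable_fun setT f -> (forall x, `|f x| <= B) ->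
  `|\int[P]_x f x| <= B.
Proof.
move=> mf fB; rewrite -[leRHS]E_cst; apply: E_norm_le => //.
  exact: L1_bounded fB.
exact: L1_cst.
Qed.

Lemma fineK_E f : L1 P f -> (\int[P]_x (f x)%:E)%E = (\int[P]_x f x)%:E.
Proof. by move=> lf; rewrite /Rintegral fineK//; exact: integrable_fin_num. Qed.

Lemma L1_dominated_limit (f_ : nat -> T -> R) f g :
  (forall n, measurable_fun setT (f_ n)) -> measurable_fun setT f -> L1 P g ->
  (forall x, f_ n x @[n --> \oo] --> f x) -> (forall n x, `|f_ n x| <= g x) ->
  L1 P f.
Proof.
move=> mf_ mf lg cf fg; apply: (L1_le mf _ lg) => x.
have cn : `|f_ n x| @[n --> \oo] --> `|f x| by apply: cvg_norm; exact: cf.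
by rewrite -(cvg_lim _ cn)//; apply: limr_le; [exact: cvgP cn|exact: nearW].
Qed.

Lemma E_dominated_cvg (f_ : nat -> T -> R) f g :
  (forall n, measurable_fun setT (f_ n)) -> measurable_fun setT f -> L1 P g ->
  (forall x, f_ n x @[n --> \oo] --> f x) -> (forall n x, `|f_ n x| <= g x) ->
  \int[P]_x f_ n x @[n --> \oo] --> \int[P]_x f x.
Proof.
move=> mf_ mf lg cf fg.
have lf := L1_dominated_limit mf_ mf lg cf fg.
apply: fine_cvg.
rewrite fineK ?integrable_fin_num//.
apply: (@dominated_cvg _ _ _ P setT measurableT _ (EFin \o f) (EFin \o g)) => //.
- by move=> n; exact/measurable_EFinP.
- by move=> x _; apply: cvg_EFin; [exact: nearW|exact: cf].
- by move=> n x _; rewrite lee_fin.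
Qed.

Lemma markov_norm f (e : R) : 0 < e -> L1 P f ->
  (P [set x | (e <= `|f x|)%R] <= ((\int[P]_x `|f x|) / e)%:E)%E.
Proof.
move=> e0 l1; have mf := L1_measurable l1.
have mA : measurable [set x | e <= `|f x|].
  have : measurable_fun setT (fun x => `|f x|) by apply: measurableT_comp.
  by move=> /(_ measurableT _ (measurable_itv `[e, +oo[)); rewrite setTI set_itvE.
rewrite EFinM -lee_pdivrMr ?invr_gt0// invrK muleC -fineK_E; last exact: L1_norm.
rewrite -{1}[P _]mul1e -integral_cst// -ge0_integralZl//=; last first.
  by rewrite lee_fin ltW.
apply: (@le_trans _ _ (\int[P]_(x in [set x | (e <= `|f x|)%R]) (`|f x|)%:E)%E).
  apply: ge0_le_integral => //.
  - by move=> x _; rewrite lee_fin mulr1 ltW.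
  - by apply: measurable_funTS; apply/measurable_EFinP; exact: measurableT_comp.
  - by move=> x /= ex; rewrite lee_fin mulr1.
apply: ge0_subset_integral => //.
by apply/measurable_EFinP; exact: measurableT_comp.
Qed.

Lemma markov_sq f (e : R) : 0 < e -> L1 P (fun x => f x ^+ 2) ->
  (P [set x | (e <= `|f x|)%R] <= ((\int[P]_x (f x ^+ 2)) / e ^+ 2)%:E)%E.
Proof.
move=> e0 l2; have := markov_norm (exprn_gt0 2 e0) l2.
rewrite (_ : [set x | _] = [set x | (e <= `|f x|)%R]); last first.
  apply/seteqP; by split=> x /=; rewrite normrX ler_pXn2r ?nnegrE ?normr_ge0 ?(ltW e0).
rewrite [X in (X / _)%:E](_ : _ = \int[P]_x (f x ^+ 2))//.
by apply: eq_Rintegral => x _; rewrite ger0_norm ?sqr_ge0.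
Qed.

Lemma E_indic A : measurable A -> \int[P]_x \1_A x = fine (P A).
Proof. by move=> mA; rewrite /Rintegral integral_indic// setIT. Qed.

End Expectation.

Section Pushforward.
Context d d' (T : measurableType d) (S : measurableType d') (R : realType).
Context (P : probability T R) (Q : probability S R) (X : T -> S).
Hypothesis mX : measurable_fun setT X.
Hypothesis XQ : forall A, measurable A -> P (X @^-1` A) = Q A.

Lemma L1_law f : L1 Q f -> L1 P (f \o X).
Proof.
move=> lf; have mf := L1_measurable lf.
apply/integrableP; split; first by apply/measurable_EFinP; exact: measurableT_comp.
have := integrableP _ _ _ lf; case=> _.
rewrite (_ : \int[Q]_x _ = \int[pushforward P X]_x `|(EFin \o f) x|)%E.
  rewrite ge0_integral_pushforward//.
  by apply: measurableT_comp => //; exact/measurable_EFinP.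
apply: eq_measure_integral => A mA _; exact/esym/XQ.
Qed.

Lemma L1_law_inv f : measurable_fun setT f -> L1 P (f \o X) -> L1 Q f.
Proof.
move=> mf lf; apply/integrableP; split; first exact/measurable_EFinP.
rewrite (_ : \int[Q]_x _ = \int[pushforward P X]_x `|(EFin \o f) x|)%E.
  rewrite ge0_integral_pushforward//; last first.
    by apply: measurableT_comp => //; exact/measurable_EFinP.
  by have [] := integrableP _ _ _ lf.
apply: eq_measure_integral => A mA _; exact/esym/XQ.
Qed.

Lemma E_law f : L1 Q f -> \int[P]_x f (X x) = \int[Q]_y f y.
Proof.
move=> lf; have mf := L1_measurable lf; rewrite /Rintegral.
rewrite (_ : \int[Q]_x (f x)%:E = \int[pushforward P X]_x (EFin \o f) x)%E.
  rewrite integral_pushforward//; first exact/measurable_EFinP.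
  exact: L1_law.
by apply: eq_measure_integral => A mA _; exact/esym/XQ.
Qed.

End Pushforward.

Section Product.
Context d d' (T : measurableType d) (S : measurableType d') (R : realType).
Context (P : probability T R) (Q : probability S R).
Implicit Types f : T * S -> R.

(** Integrability is asked of every section, not of almost every one, so that the inner integrals
    are real numbers everywhere and the iterated integral needs no extended reals. *)
Lemma E_fubini f : L1 (P \x Q)%E f -> (forall x, L1 Q (fun y => f (x, y))) ->
  L1 P (fun x => \int[Q]_y f (x, y)) /\
  \int[(P \x Q)%E]_z f z = \int[P]_x \int[Q]_y f (x, y).
Proof.
move=> lf lfx; have := integrable_fubini_F lf; have := integral12_prod_meas1 lf.
have e : fubini_F Q (EFin \o f) = EFin \o (fun x => \int[Q]_y f (x, y)).
  by apply/funext => x; rewrite /fubini_F/= fineK_E.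
by rewrite e => h1 h2; split => //; rewrite /Rintegral -h1.
Qed.

Lemma L1_prodM (g : T -> R) (h : S -> R) : L1 P g -> L1 Q h ->
  L1 (P \x Q)%E (fun z => g z.1 * h z.2).
Proof.
move=> lg lh; have mg := L1_measurable lg; have mh := L1_measurable lh.
have mgh : measurable_fun setT (fun z : T * S => g z.1 * h z.2).
  apply: measurable_funM.
    exact: (measurableT_comp mg measurable_fst).
  exact: (measurableT_comp mh measurable_snd).
apply/integrable12ltyP; first exact/measurable_EFinP.
under eq_integral => x _.
  rewrite (eq_integral (fun y => (`|g x|%:E * `|h y|%:E)%E)); last first.
    by move=> y _; rewrite /= normrM.
  rewrite integralZl//; last exact: L1_norm.
  rewrite fineK_E ?L1_norm//.
  over.
rewrite integralZr//; last exact: L1_norm.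
by rewrite fineK_E ?L1_norm// -EFinM ltry.
Qed.

End Product.

(** * Independence of one observation from all the others *)

Section Independence.
Context d d' (T : measurableType d) (S : measurableType d') (R : realType).
Context (Pr : probability T R) (Q : probability S R).
Variable X : nat -> {RV Pr >-> S}.
Hypothesis iidX : iid Q X.

Lemma iid_law i A : measurable A -> Pr (X i @^-1` A) = Q A.
Proof. by have [+ _] := iidX; apply. Qed.

(** The condition [A j = setT] leaves the j-th observation unconstrained. Such events are stable
    under intersection, as a Dynkin argument requires. *)
Definition cylinder (j : nat) (B : set T) := exists n (A : nat -> set S),
  [/\ forall i, measurable (A i), A j = setT & B = \bigcap_(i < n) (X i @^-1` A i)].

Lemma measurable_cylinder j B : cylinder j B -> measurable B.
Proof.
move=> [n [A [mA _ ->]]]; apply: bigcap_measurableType => i _.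
exact: measurable_funPTI.
Qed.

Lemma cylinder_pad n N (A : nat -> set S) : (n <= N)%N ->
  \bigcap_(i < n) (X i @^-1` A i) =
  \bigcap_(i < N) (X i @^-1` (if (i < n)%N then A i else setT)).
Proof.
move=> nN; apply/seteqP; split=> w h i /= iN.
  by case: ifP => // /h.
by have := h i (leq_trans iN nN); rewrite iN.
Qed.

Lemma cylinderI j : setI_closed (cylinder j).
Proof.
move=> _ _ [n1 [A1 [mA1 A1j ->]]] [n2 [A2 [mA2 A2j ->]]].
exists (maxn n1 n2), (fun i => (if (i < n1)%N then A1 i else setT) `&`
                               (if (i < n2)%N then A2 i else setT)); split.
- by move=> i; apply: measurableI; case: ifP.
- by rewrite A1j A2j; do 2 case: ifP => _; rewrite setIT.
- rewrite (cylinder_pad A1 (leq_maxl n1 n2)) (cylinder_pad A2 (leq_maxr n1 n2)).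
  by rewrite -bigcapI.
Qed.

Lemma cylinder_preimage j i A : i != j -> measurable A ->
  cylinder j (X i @^-1` A).
Proof.
move=> ij mA; exists i.+1, (fun k => if k == i then A else setT); split.
- by move=> k; case: ifP.
- by rewrite eq_sym (negbTE ij).
- apply/seteqP; split=> w /= h; last by have := h i (ltnSn i); rewrite /= eqxx.
  by move=> k _; case: eqP => // ->.
Qed.

(** The constraint on X_j fills the free slot of the cylinder once this has been padded to more than
    j factors; the product formula then splits off the factor of index j. *)
Lemma iid_cylinder j B C : cylinder j B -> measurable C ->
  Pr (B `&` X j @^-1` C) = (Pr B * Q C)%E.
Proof.
move=> [n [A [mA Aj ->]]] mC; have [_ iidP] := iidX.
pose N := maxn n j.+1.
pose A1 i := if (i < n)%N then A i else setT.
pose A2 i := if i == j then C else A1 i.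
have mA1 i : measurable (A1 i) by rewrite /A1; case: ifP.
have mA2 i : measurable (A2 i) by rewrite /A2; case: ifP.
have A1j : A1 j = setT by rewrite /A1 Aj; case: ifP.
rewrite (cylinder_pad A (leq_maxl n j.+1)) -/A1 -/N.
rewrite (_ : _ `&` _ = \bigcap_(i < N) (X i @^-1` A2 i)); last first.
  apply/seteqP; split=> w /=.
    move=> [h hj] i /= iN; rewrite /A2; case: eqP => [->//|_]; exact: h.
  move=> h; split; last first.
    by have := h j (leq_maxr n j.+1); rewrite /A2 eqxx.
  move=> i /= iN; have := h i iN; rewrite /A2; case: eqP => [->|//].
  by move=> _; rewrite -/(A1 j) A1j.
rewrite !iidP// !big_mkord.
have jN : (j < N)%N by exact: leq_maxr.
rewrite (bigD1 (Ordinal jN))//= [in RHS](bigD1 (Ordinal jN))//=.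
rewrite -/(A1 j) A1j preimage_setT probability_setT mul1e muleC; congr (_ * _)%E.
  by apply: eq_bigr => i ij; rewrite /A2 ifN.
by rewrite /A2 eqxx iid_law.
Qed.

(** The sigma-algebra of all the observations but the j-th, put on the sample space itself, so that
    the pair (w, X_j w) takes its values in a product of measurable spaces and has independent
    components. *)
Definition others (j : nat) := g_sigma_algebraType (cylinder j).

Lemma measurable_others j (B : set T) :
  (measurable : set (set (others j))) B -> measurable B.
Proof.
apply: smallest_sub; first exact: sigma_algebra_measurable.
by move=> A; exact: measurable_cylinder.
Qed.

Lemma measurable_fun_others j i : i != j ->
  measurable_fun setT (X i : others j -> S).
Proof.
move=> ij _ A mA; rewrite setTI; apply: sub_sigma_algebra.
exact: cylinder_preimage.
Qed.

Lemma measurable_to_others j : measurable_fun setT (id : T -> others j).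
Proof. by move=> _ B mB; rewrite setTI; exact: measurable_others mB. Qed.

(** Pi-lambda argument: for fixed C, the events B with the product formula form a Dynkin class which
    contains the cylinders. *)
Lemma iid_others j (B : set T) C : (measurable : set (set (others j))) B ->
  measurable C -> Pr (B `&` X j @^-1` C) = (Pr B * Q C)%E.
Proof.
move=> mB mC.
have mXC : measurable (X j @^-1` C) by exact: measurable_funPTI.
apply: (@dynkin_induction _ (others j) (cylinder j)
  (fun B => Pr (B `&` X j @^-1` C) = (Pr B * Q C)%E)) => //.
- exact: cylinderI.
- by rewrite setTI probability_setT mul1e iid_law.
- by move=> A cA; rewrite iid_cylinder.
- move=> A /measurable_others mA IH.
  rewrite setIC -setDE measureD//; last by rewrite -ge0_fin_numE// fin_num_measure.
  transitivity (Q C - Pr A * Q C)%E.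
    by congr (_ - _)%E; [exact: iid_law|rewrite -IH setIC].
  rewrite probability_setC// muleBl ?mul1e//.
  by rewrite fin_num_measure.
- move=> F mF tF IH.
  have mF' n : measurable (F n : set T) by exact: (measurable_others (mF n)).
  rewrite setI_bigcupl measure_bigcup//; last 2 first.
    by move=> n _; exact: measurableI.
    by apply: trivIset_setIr.
  rewrite measure_bigcup//.
  have fQ : Q C = (fine (Q C))%:E by rewrite fineK// fin_num_measure.
  rewrite [in RHS]fQ muleC -nneseriesZl//.
  by apply: eq_eseriesr => n _; rewrite muleC -fQ; exact: IH.
Qed.

Definition Pr_others j : probability (others j) R :=
  distribution Pr (mfun_Sub (mem_set (@measurable_to_others j))).

(** The pair (w, X_j w) has a product law on [others j * S], so X_j can be integrated out first with
    every other observation frozen. This replaces conditional expectations, both in the recursion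
    for characteristic functions and in the orthogonality of degenerate kernels. *)
Lemma E_others j (f : others j * S -> R) : measurable_fun setT f ->
  L1 Pr (fun w => f (w, X j w)) -> (forall w, L1 Q (fun y => f (w, y))) ->
  L1 Pr (fun w => \int[Q]_y f (w, y)) /\
  \int[Pr]_w f (w, X j w) = \int[Pr]_w \int[Q]_y f (w, y).
Proof.
move=> mf lX lfw.
pose phi w : others j * S := (w, X j w).
have mphi : measurable_fun setT phi.
  apply: measurable_fun_pair; first exact: measurable_to_others.
  exact: measurable_funPT.
have phiE A : measurable A -> Pr (phi @^-1` A) = (Pr_others j \x Q)%E A.
  move=> mA; rewrite (@product_measure_unique _ _ _ _ _ _ _
    (distribution Pr (mfun_Sub (mem_set mphi))))//.
  move=> B C mB mC; exact: iid_others.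
have lf : L1 (Pr_others j \x Q)%E f by exact: (L1_law_inv mphi phiE mf).
have [lF EF] := E_fubini lf lfw.
have idE (A : set (others j)) : measurable A -> Pr (id @^-1` A) = Pr_others j A.
  by [].
split; first exact: (L1_law (@measurable_to_others j) idE lF).
have -> : \int[Pr]_w f (w, X j w) = \int[(Pr_others j \x Q)%E]_z f z.
  exact: (E_law mphi phiE lf).
rewrite EF; symmetry; exact: (E_law (@measurable_to_others j) idE lF).
Qed.

Lemma E_pair i j (h : S * S -> R) : i != j -> L1 (Q \x Q)%E h ->
  L1 Pr (fun w => h (X i w, X j w)) /\
  \int[Pr]_w h (X i w, X j w) = \int[(Q \x Q)%E]_z h z.
Proof.
move=> ij lh; pose phi w := (X i w, X j w).
have mphi : measurable_fun setT phi.
  by apply: measurable_fun_pair; exact: measurable_funPT.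
have phiE A : measurable A -> Pr (phi @^-1` A) = (Q \x Q)%E A.
  move=> mA; rewrite (@product_measure_unique _ _ _ _ _ _ _
    (distribution Pr (mfun_Sub (mem_set mphi))))//.
  move=> B C mB mC; have := iid_cylinder (cylinder_preimage ij mB) mC.
  by rewrite iid_law// => <-.
by split; [exact: (L1_law mphi phiE lh)|exact: (E_law mphi phiE lh)].
Qed.

End Independence.

(** * Characteristic functions of normalized sums *)

Section TrigBounds.
Context (R : realType).
Implicit Types u : R.

(** Mean value theorem between 0 and u. A bound of the derivative yields the next bound of the
    function, so that the successive Taylor remainders of sin and cos are estimated in turn, all
    with constant 1. *)
Lemma abs_le_mvt (f df : R -> R) (g : R -> R) u :
  (forall x : R, is_derive x (1 : R) f (df x)) -> f 0 = 0 ->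
  (forall x, `|x| <= `|u| -> `|df x| <= g u) -> `|f u| <= g u * `|u|.
Proof.
move=> dfE f0 dfg.
have cf (i : interval R) : {within [set` i], continuous f}.
  by apply: derivable_within_continuous => x _; have [] := dfE x.
have [u0|u0|u0] := ltgtP u 0; last by rewrite u0 f0 !normr0 mulr0.
- have [c cu] := @MVT R f df u 0 u0 (fun x _ => dfE x) (cf _).
  rewrite f0 !sub0r => /eqP; rewrite eqr_oppLR mulrN opprK => /eqP ->.
  rewrite normrM ler_wpM2r//; apply: dfg.
  move: cu; rewrite in_itv/= => /andP[h1 h2].
  by rewrite !ltr0_norm// lerN2 ltW.
- have [c cu] := @MVT R f df 0 u u0 (fun x _ => dfE x) (cf _).
  rewrite f0 !subr0 => ->.
  rewrite normrM ler_wpM2r//; apply: dfg.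
  move: cu; rewrite in_itv/= => /andP[h1 h2].
  by rewrite !gtr0_norm// ltW.
Qed.

Lemma abs_sin_le u : `|sin u| <= `|u|.
Proof.
rewrite -[leRHS]mul1r; apply: (@abs_le_mvt sin cos (fun=> 1)) => //.
  exact: sin0.
by move=> x _; rewrite ler_norml cos_geN1 cos_le1.
Qed.

Lemma abs_cosB1_le u : `|cos u - 1| <= u ^+ 2.
Proof.
rewrite -(real_normK (num_real u)) expr2.
apply: (@abs_le_mvt (fun x => cos x - 1) (fun x => - sin x) (fun x => `|x|)).
- by move=> x; apply: is_derive_eq; rewrite subr0.
- by rewrite cos0 subrr.
- by move=> x xu; rewrite normrN (le_trans (abs_sin_le x)).
Qed.

Lemma abs_sinB_le u : `|sin u - u| <= `|u| ^+ 3.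
Proof.
rewrite exprSr.
apply: (@abs_le_mvt (fun x => sin x - x) (fun x => cos x - 1) (fun x => `|x| ^+ 2)).
- by rewrite sin0 subrr.
- move=> x xu; apply: (le_trans (abs_cosB1_le x)).
  by rewrite -(real_normK (num_real x)) ler_pXn2r ?nnegrE.
Qed.

Lemma abs_cosBq_le u : `|cos u - 1 + u ^+ 2 / 2| <= `|u| ^+ 4.
Proof.
rewrite [leRHS]exprSr.
apply: (@abs_le_mvt (fun x => cos x - 1 + x ^+ 2 / 2) (fun x => - (sin x - x)) (fun x => `|x| ^+ 3)).
- move=> x; apply: is_derive_eq; rewrite /GRing.scale/=; lra.
- by rewrite cos0 subrr expr0n/= mul0r addr0.
- move=> x xu; rewrite normrN; apply: (le_trans (abs_sinB_le x)).
  by rewrite ler_pXn2r ?nnegrE.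
Qed.

(** The cubic bound gives the pointwise limit in the central limit theorem, but xi has only two
    moments; the quadratic bound gives the integrable majorant. *)
Lemma abs_sinB_sq u : `|sin u - u| <= 2 * u ^+ 2.
Proof.
rewrite -(real_normK (num_real u)).
have [u1|u1] := leP `|u| 1.
  apply: (le_trans (abs_sinB_le u)); have := normr_ge0 u; nra.
apply: (@le_trans _ _ (`|u| + `|u|)); last nra.
by apply: (le_trans (ler_normB _ _)); rewrite lerD2r abs_sin_le.
Qed.

End TrigBounds.

Section SequenceLimits.
Context (R : realType).
Implicit Types f g : nat -> R.

Lemma cvg0_le f g : (forall n, `|f n| <= g n) -> g n @[n --> \oo] --> (0 : R) ->
  f n @[n --> \oo] --> (0 : R).
Proof.
move=> fg g0; apply/norm_cvg0P; apply: (squeeze_cvgr _ (cvg_cst 0) g0).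
by apply: nearW => n /=; rewrite normr_ge0 fg.
Qed.

Lemma cvg_invn : (n%:R^-1 : R) @[n --> \oo] --> (0 : R).
Proof.
apply/gtr0_cvgV0; last exact: cvgr_idn.
by near=> n; rewrite ltr0n; near: n; exact: nbhs_infty_gt.
Unshelve. all: by end_near. Qed.

Lemma cvg_inv_sqrtn : (Num.sqrt n%:R)^-1 @[n --> \oo] --> (0 : R).
Proof.
have := cvg_comp _ _ cvg_invn (@sqrt_continuous R 0).
rewrite sqrtr0; apply: cvg_trans; apply: near_eq_cvg; apply: nearW => n /=.
by rewrite sqrtrV.
Qed.

Lemma inv_sqrtn_sqr n : (Num.sqrt n%:R)^-1 ^+ 2 = (n%:R^-1 : R).
Proof. by rewrite exprVn sqr_sqrtr. Qed.

Lemma expRN_quadratic (t : R) : 0 <= t -> `|expR (- t) - 1 + t| <= t ^+ 2.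
Proof.
move=> t0; have h1 : 1 - t <= expR (- t) by exact: expR_ge1Dx.
have h2 : expR (- t) * (1 + t) <= 1.
  by rewrite -[leRHS](expRxMexpNx_1 (- t)) opprK ler_wpM2l ?expR_ge0// expR_ge1Dx.
rewrite ger0_norm; last lra.
have h3 : 0 < 1 + t by lra.
suff : expR (- t) <= 1 - t + t ^+ 2 by lra.
rewrite -(ler_pM2r h3); apply: (le_trans h2).
have := mulr_ge0 t0 (mulr_ge0 t0 t0); lra.
Qed.

End SequenceLimits.

Section Clt.
Context d d' (T : measurableType d) (S : measurableType d') (R : realType).
Context (Pr : probability T R) (Q : probability S R).
Variable X : nat -> {RV Pr >-> S}.
Hypothesis iidX : iid Q X.
Variable xi : S -> R.
Hypothesis mxi : measurable_fun setT xi.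

(** Addition formula for cos, with X_k integrated out first. The two terms on the right are the cost
    of replacing E cos(c xi) by the gaussian factor and of dropping E sin(c xi); the expectations
    that they multiply are at most 1 in absolute value. *)
Lemma E_cos_sum_step (c x : R) k :
  `|\int[Pr]_w cos (x + \sum_(i < k.+1) c * xi (X i w)) -
    expR (- (c ^+ 2 * \int[Q]_y (xi y ^+ 2) / 2)) *
    \int[Pr]_w cos (x + \sum_(i < k) c * xi (X i w))| <=
  `|\int[Q]_y cos (c * xi y) - expR (- (c ^+ 2 * \int[Q]_y (xi y ^+ 2) / 2))| +
  `|\int[Q]_y sin (c * xi y)|.
Proof.
pose s w := x + \sum_(i < k) c * xi (X i w).
have cos1 (z : R) : `|cos z| <= 1 by rewrite ler_norml cos_geN1 cos_le1.
have sin1 (z : R) : `|sin z| <= 1 by rewrite ler_norml sin_geN1 sin_le1.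
have mcos dd (U : measurableType dd) (f : U -> R) : measurable_fun setT f -> measurable_fun setT (cos \o f).
  by move=> mf; apply: measurableT_comp => //; apply: continuous_measurable_fun; exact: continuous_cos.
have msin dd (U : measurableType dd) (f : U -> R) : measurable_fun setT f -> measurable_fun setT (sin \o f).
  by move=> mf; apply: measurableT_comp => //; apply: continuous_measurable_fun; exact: continuous_sin.
have mcxi : measurable_fun setT (fun y => c * xi y) by exact: measurable_funM.
have mso : measurable_fun setT (s : others X k -> R).
  apply: measurable_funD => //; apply: measurable_sum => i.
  apply: measurable_funM => //; apply: measurableT_comp => //.
  by apply: measurable_fun_others; rewrite ltn_eqF.
have ms : measurable_fun setT s.
  have := measurableT_comp mso (@measurable_to_others _ _ _ _ _ _ X k); exact.
pose f (z : others X k * S) := cos (s z.1 + c * xi z.2).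
have mf : measurable_fun setT f.
  apply: mcos; apply: measurable_funD.
    exact: (measurableT_comp mso measurable_fst).
  exact: (measurableT_comp mcxi measurable_snd).
have mfX : measurable_fun setT (fun w => f (w, X k w)).
  apply: mcos; apply: measurable_funD => //.
  exact: (measurableT_comp mcxi (measurable_funPT (X k))).
have [l1 E1] : L1 Pr (fun w => \int[Q]_y f (w, y)) /\
  \int[Pr]_w f (w, X k w) = \int[Pr]_w \int[Q]_y f (w, y).
  apply: (E_others iidX) => //.
    by apply: (@L1_bounded _ _ _ _ _ 1) => // w; exact: cos1.
  move=> w; apply: (@L1_bounded _ _ _ _ _ 1) => [|y]; last exact: cos1.
  by apply: (mcos _ _ (fun y => s w + c * xi y)); apply: measurable_funD.
have Lc : L1 Q (fun y => cos (c * xi y)) by apply: (@L1_bounded _ _ _ _ _ 1) => //; exact: mcos.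
have Ls : L1 Q (fun y => sin (c * xi y)) by apply: (@L1_bounded _ _ _ _ _ 1) => //; exact: msin.
have Lcs : L1 Pr (fun w => cos (s w)) by apply: (@L1_bounded _ _ _ _ _ 1) => //; exact: mcos.
have Lss : L1 Pr (fun w => sin (s w)) by apply: (@L1_bounded _ _ _ _ _ 1) => //; exact: msin.
have EQ w : \int[Q]_y f (w, y) =
    (\int[Q]_y cos (c * xi y)) * cos (s w) - (\int[Q]_y sin (c * xi y)) * sin (s w).
  rewrite [X in _ = X - _]mulrC [X in _ = _ - X]mulrC.
  rewrite -!EZ// -EB//; [|exact: L1Z|exact: L1Z].
  by apply: eq_Rintegral => y _; rewrite /f/= cosD.
have -> : \int[Pr]_w cos (x + \sum_(i < k.+1) c * xi (X i w)) =
    (\int[Q]_y cos (c * xi y)) * (\int[Pr]_w cos (s w)) -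
    (\int[Q]_y sin (c * xi y)) * (\int[Pr]_w sin (s w)).
  rewrite -!EZ// -EB//; [|exact: L1Z|exact: L1Z].
  under [RHS]eq_Rintegral do rewrite -EQ.
  rewrite -E1; apply: eq_Rintegral => w _.
  by rewrite big_ord_recr/= addrA.
rewrite -/s; set C := \int[Q]_y _; set rho := expR _; set D := \int[Q]_y _.
rewrite [X in `|X|](_ : _ = (C - rho) * \int[Pr]_w cos (s w) - D * \int[Pr]_w sin (s w)); last by ring.
apply: (le_trans (ler_normB _ _)); rewrite !normrM; apply: lerD.
  by apply: ler_piMr => //; apply: E_bounded => //; exact: mcos.
by apply: ler_piMr => //; apply: E_bounded => //; exact: msin.
Qed.

(** The one-step errors merely add up, because the gaussian factor [rho] is at most 1. *)
Lemma E_cos_sum_bound (c x : R) n :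
  `|\int[Pr]_w cos (x + \sum_(i < n) c * xi (X i w)) -
    expR (- (c ^+ 2 * \int[Q]_y (xi y ^+ 2) / 2)) ^+ n * cos x| <=
  n%:R * (`|\int[Q]_y cos (c * xi y) -
            expR (- (c ^+ 2 * \int[Q]_y (xi y ^+ 2) / 2))| +
          `|\int[Q]_y sin (c * xi y)|).
Proof.
have v0 : 0 <= \int[Q]_y (xi y ^+ 2) by apply: Rintegral_ge0 => y _; exact: sqr_ge0.
set rho := expR _.
have rho0 : 0 <= rho by exact: expR_ge0.
have rho1 : rho <= 1.
  by rewrite -expR0 ler_expR oppr_le0 divr_ge0// mulr_ge0// sqr_ge0.
elim: n => [|n IH].
  under eq_Rintegral do rewrite big_ord0 addr0.
  by rewrite E_cst mul0r expr0 mul1r subrr normr0.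
have := E_cos_sum_step c x n; rewrite -/rho.
set a := \int[Pr]_w _; set b := \int[Pr]_w _ in IH *; set e := _ + _ in IH *.
move=> H; rewrite [X in `|X|](_ : _ = (a - rho * b) + rho * (b - rho ^+ n * cos x)); last first.
  by rewrite exprS; ring.
apply: (le_trans (ler_normD _ _)); rewrite -natr1 mulrDl mul1r addrC lerD// normrM ger0_norm//.
by apply: (le_trans (ler_wpM2l rho0 IH)); rewrite ler_piMl// mulr_ge0// /e addr_ge0.
Qed.

Hypothesis xi2 : L1 Q (fun y => xi y ^+ 2).
Hypothesis xi0 : \int[Q]_y xi y = 0.

Lemma clt_cos (x : R) :
  \int[Pr]_w cos (x + \sum_(i < n) (Num.sqrt n%:R)^-1 * xi (X i w)) @[n --> \oo]
  --> expR (- (\int[Q]_y (xi y ^+ 2) / 2)) * cos x.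
Proof.
set v := \int[Q]_y _; pose c (n : nat) : R := (Num.sqrt n%:R)^-1.
have v0 : 0 <= v by apply: Rintegral_ge0 => y _; exact: sqr_ge0.
have c2 n : c n ^+ 2 = n%:R^-1 by exact: inv_sqrtn_sqr.
have c0 n : 0 <= c n by rewrite invr_ge0 sqrtr_ge0.
have nc2 n : n%:R * c n ^+ 2 <= 1.
  by rewrite c2; case: n => [|n]; rewrite ?mul0r ?ler01// divff.
have mcos : measurable_fun setT (@cos R) by apply: continuous_measurable_fun; exact: continuous_cos.
have msin : measurable_fun setT (@sin R) by apply: continuous_measurable_fun; exact: continuous_sin.
have mcxi n : measurable_fun setT (fun y => c n * xi y) by exact: measurable_funM.
have lxi : L1 Q xi by exact: L1_sq.
pose C n := \int[Q]_y cos (c n * xi y).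
pose D n := \int[Q]_y sin (c n * xi y).
pose rho n := expR (- (c n ^+ 2 * v / 2)).
have Lc n : L1 Q (fun y => cos (c n * xi y)).
  apply: (@L1_bounded _ _ _ _ _ 1) => [|y]; first exact: measurableT_comp.
  by rewrite ler_norml cos_geN1 cos_le1.
have Ls n : L1 Q (fun y => sin (c n * xi y)).
  apply: (@L1_bounded _ _ _ _ _ 1) => [|y]; first exact: measurableT_comp.
  by rewrite ler_norml sin_geN1 sin_le1.
(* n times the Taylor remainders of cos and sin. As c_n^2 = 1 / n they tend to 0 pointwise, and they
   are dominated by 2 xi^2; hence their means tend to 0, which is exactly what n one-step errors
   require. *)
pose F n y := n%:R * (cos (c n * xi y) - 1 + (c n * xi y) ^+ 2 / 2).
pose G n y := n%:R * (sin (c n * xi y) - c n * xi y).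
have mF n : measurable_fun setT (F n).
  apply: measurable_funM => //; apply: measurable_funD => //.
    by apply: measurable_funB => //; exact: measurableT_comp.
  by apply: measurable_funM => //; exact: measurable_funX.
have mG n : measurable_fun setT (G n).
  by apply: measurable_funM => //; apply: measurable_funB => //; exact: measurableT_comp.
have F0 y : F n y @[n --> \oo] --> (0 : R).
  apply: (@cvg0_le _ _ (fun n => n%:R^-1 * xi y ^+ 4)).
    move=> n; rewrite normrM ger0_norm//.
    apply: (le_trans (ler_wpM2l _ (abs_cosBq_le _))) => //.
    rewrite normrM (ger0_norm (c0 n)) exprMn (exprM (c n) 2 2) c2 mulrA -normrX.
    rewrite ger0_norm; last by rewrite (exprM _ 2 2) sqr_ge0.
    case: n => [|n]; first by rewrite !mul0r invr0 mul0r.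
    by rewrite expr2 mulVKf.
  by rewrite -[X in _ --> X](mul0r (xi y ^+ 4)); apply: cvgMl; exact: cvg_invn.
have G0 y : G n y @[n --> \oo] --> (0 : R).
  apply: (@cvg0_le _ _ (fun n => c n * `|xi y| ^+ 3)).
    move=> n; rewrite normrM ger0_norm//.
    apply: (le_trans (ler_wpM2l _ (abs_sinB_le _))) => //.
    rewrite normrM (ger0_norm (c0 n)) exprMn mulrA ler_wpM2r//.
    by rewrite exprS mulrCA ler_piMr.
  by rewrite -[X in _ --> X](mul0r (`|xi y| ^+ 3)); apply: cvgMl; exact: cvg_inv_sqrtn.
have Fd n y : `|F n y| <= 2 * xi y ^+ 2.
  rewrite normrM ger0_norm//.
  apply: (@le_trans _ _ (n%:R * (2 * (c n * xi y) ^+ 2))).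
    apply: ler_wpM2l => //; apply: (le_trans (ler_normD _ _)).
    have := abs_cosB1_le (c n * xi y); rewrite (@ger0_norm _ (_ / 2)) ?divr_ge0 ?sqr_ge0//.
    by have := sqr_ge0 (c n * xi y); lra.
  rewrite exprMn mulrCA ler_wpM2l// mulrA ler_piMl ?sqr_ge0//.
have Gd n y : `|G n y| <= 2 * xi y ^+ 2.
  rewrite normrM ger0_norm//.
  apply: (le_trans (ler_wpM2l _ (abs_sinB_sq _))) => //.
  by rewrite exprMn mulrCA ler_wpM2l// mulrA ler_piMl ?sqr_ge0.
have l2 : L1 Q (fun y => 2 * xi y ^+ 2) by exact: L1Z.
have EF0 : \int[Q]_y F n y @[n --> \oo] --> (0 : R).
  by rewrite -[X in _ --> X](E_cst Q 0); apply: (E_dominated_cvg mF _ l2 F0 Fd).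
have EG0 : \int[Q]_y G n y @[n --> \oo] --> (0 : R).
  by rewrite -[X in _ --> X](E_cst Q 0); apply: (E_dominated_cvg mG _ l2 G0 Gd).
have EFE n : \int[Q]_y F n y = n%:R * (C n - 1 + c n ^+ 2 * v / 2).
  have e : (fun y => (c n * xi y) ^+ 2 / 2) = (fun y => (c n ^+ 2 / 2) * xi y ^+ 2).
    by apply/funext => y; rewrite exprMn mulrAC.
  have l3 : L1 Q (fun y => (c n * xi y) ^+ 2 / 2) by rewrite e; exact: L1Z.
  rewrite EZ; last by apply: L1D => //; apply: L1B => //; exact: L1_cst.
  rewrite ED//; last by apply: L1B => //; exact: L1_cst.
  by rewrite EB ?E_cst//; [rewrite e EZ// mulrAC|exact: L1_cst].
have EGE n : \int[Q]_y G n y = n%:R * D n.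
  rewrite EZ; last by apply: L1B => //; exact: L1Z.
  by rewrite EB//; [rewrite EZ// xi0 mulr0 subr0|exact: L1Z].
have err0 : n%:R * (`|C n - rho n| + `|D n|) @[n --> \oo] --> (0 : R).
  apply: (@cvg0_le _ _ (fun n => `|\int[Q]_y F n y| + `|\int[Q]_y G n y| + n%:R^-1 * v ^+ 2)).
    move=> n; rewrite [leLHS]ger0_norm; last by rewrite mulr_ge0// addr_ge0.
    rewrite mulrDr -[X in _ + X <= _]ger0_norm; last by rewrite mulr_ge0.
    rewrite normrM normr_id -normrM -EGE addrAC lerD2r.
    rewrite -[X in X * _]normr_nat -normrM.
    have -> : n%:R * (C n - rho n) = \int[Q]_y F n y - n%:R * (rho n - 1 + c n ^+ 2 * v / 2).
      by rewrite EFE; ring.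
    apply: (le_trans (ler_normB _ _)); rewrite lerD2l normrM ger0_norm//.
    apply: (le_trans (ler_wpM2l _ (expRN_quadratic _))) => //.
      by rewrite divr_ge0// mulr_ge0// sqr_ge0.
    rewrite c2; case: n => [|n]; first by rewrite mul0r invr0 mul0r.
    rewrite !exprMn !expr2 -!mulrA mulVKf// ler_wpM2l ?invr_ge0//.
    rewrite mulrA ler_piMr ?mulr_ge0//; lra.
  rewrite -[X in _ --> X]addr0; apply: cvgD.
    by rewrite -[X in _ --> X]addr0; apply: cvgD; rewrite -(@normr0 _ R); exact: cvg_norm.
  by rewrite -[X in _ --> X](mul0r (v ^+ 2)); apply: cvgMl; exact: cvg_invn.
apply: cvg_zero; apply: cvg_trans; last first.
  apply: (@cvg0_le _ (fun n => \int[Pr]_w cos (x + \sum_(i < n) c n * xi (X i w)) -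
    rho n ^+ n * cos x) _ _ err0) => n.
  exact: E_cos_sum_bound.
(* For n > 0 the power [rho n ^+ n] equals exp(- v / 2) exactly; for n = 0 it is 1. *)
apply: near_eq_cvg; near=> n; rewrite !fctE/=; congr (_ - _ * _).
rewrite /rho -expRM_natl c2; congr expR.
rewrite mulrN -mulrA mulVKf// pnatr_eq0 -lt0n.
by near: n; exact: nbhs_infty_gt.
Unshelve. all: by end_near. Qed.

End Clt.

(** * Borel sets of R^n *)

Section BorelMatrices.
Context (R : realType).

Lemma open_measurable_rV (n : nat) (U : set 'rV[R]_n) : open U -> measurable U.
Proof. by move=> oU; apply: sub_sigma_algebra. Qed.

(** Cubes with rational centre and radius 1 / (k + 1): a base of the topology indexed by a countable
    type. Thanks to it every open set is a countable union of boxes, and measurability into R^n can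
    be tested on the coordinates. *)
Definition rat_box (n : nat) (p : 'rV[rat]_n * nat) : set 'rV[R]_n :=
  [set u | forall i, `|u 0 i - ratr (p.1 0 i)| < p.2.+1%:R^-1].

Lemma open_rat_box n (U : set 'rV[R]_n) u : open U -> U u ->
  exists p, rat_box p u /\ rat_box p `<=` U.
Proof.
move=> oU Uu; have /nbhs_ballP[e /= e0 eU] := open_nbhs_nbhs (conj oU Uu).
have [k ke] : exists k, k.+1%:R^-1 < e / 2.
  have e20 : 0 < e / 2 by rewrite divr_gt0.
  by have [k] := ltr_add_invr e20; rewrite add0r => ke; exists k.
have k0 : (0 : R) < k.+1%:R^-1 by rewrite invr_gt0.
have [z [zk {}ke {}k0]] : exists z : R, [/\ z = k.+1%:R^-1, z < e / 2 & 0 < z].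
  by exists k.+1%:R^-1.
have /choice[q qP] : forall i : 'I_n, exists q : rat, `|u 0 i - ratr q| < z.
  move=> i; have : u 0 i - z < u 0 i + z by lra.
  move=> /rat_in_itvoo[q]; rewrite in_itv/= => /andP[h1 h2].
  by exists q; rewrite ltr_norml; apply/andP; split; lra.
exists (\row_i q i, k); split => [i|v vb]; first by rewrite mxE -zk.
apply: eU; split => // i j; rewrite (ord1 i) /ball/=.
have := vb j; have := qP j; rewrite /= mxE -zk => h1 h2.
rewrite [X in `|X|](_ : _ = (u 0 j - ratr (q j)) - (v 0 j - ratr (q j))); last by ring.
by apply: (le_lt_trans (ler_normB _ _)); lra.
Qed.

Lemma measurable_to_rV d (T : measurableType d) n (D : set T) (f : T -> 'rV[R]_n) :
  (forall i, measurable_fun D (fun x => f x 0 i)) -> measurable_fun D f.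
Proof.
move=> mf mD; apply: (@measurability _ _ _ _ _ _ (@open 'rV[R]_n)) => //.
move=> _ [U oU <-].
pose F k : set T := if unpickle k is Some p then
  if `[< @rat_box n p `<=` U >] then D `&` f @^-1` rat_box p else set0 else set0.
rewrite (_ : D `&` f @^-1` U = \bigcup_k F k); last first.
  apply/seteqP; split=> x.
    move=> [Dx /= Ux]; have [p [px pU]] := open_rat_box oU Ux.
    by exists (pickle p) => //; rewrite /F pickleK; case: asboolP.
  move=> [k _]; rewrite /F; case: unpickle => // p.
  by case: asboolP => // pU [Dx /pU].
apply: bigcupT_measurable => k; rewrite /F; case: unpickle => // p.
case: asboolP => // _.
have -> : D `&` f @^-1` rat_box p = D `&` \bigcap_(i in [set: 'I_n])
    (D `&` (fun x => `|f x 0 i - ratr (p.1 0 i)|) @^-1` `]-oo, p.2.+1%:R^-1[).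
  apply/seteqP; split=> x.
    move=> [Dx fx]; split => // i _; split => //=.
    by rewrite in_itv/=; exact: fx.
  move=> [Dx h]; split => // i.
  by have [_] := h i I; rewrite /= in_itv.
apply: measurableI => //; apply: fin_bigcap_measurable => // i _.
have : measurable_fun D (fun x => `|f x 0 i - ratr (p.1 0 i)|).
  by apply: measurableT_comp => //; exact: measurable_funB.
by apply => //; exact: measurable_itv.
Qed.

Lemma measurable_fun_continuous_in n (D : set 'rV[R]_n) (f : 'rV[R]_n -> R) :
  open D -> (forall x, D x -> {for x, continuous f}) -> measurable_fun D f.
Proof.
move=> oD cf; apply: (measurability (@RGenOpens.G R)).
  exact: RGenOpens.measurableE.
move=> _ [_ [a [b ->]] <-]; apply: open_measurable_rV.
have oI (A : set 'rV[R]_n) : (forall x, A x -> nbhs x A) -> open A.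
  by move=> h; rewrite openE.
apply: oI => x [Dx fx]; apply: filterI.
  by apply: open_nbhs_nbhs; split.
by apply: (cf x Dx); apply: open_nbhs_nbhs; split.
Qed.

Lemma measurable_coord n (i : 'I_n) : measurable_fun setT (fun u : 'rV[R]_n => u 0 i).
Proof.
apply: measurable_fun_continuous_in; first exact: openT.
by move=> x _; exact: coord_continuous.
Qed.

Lemma measurable_fun_continuous_rV n (f : 'rV[R]_n -> R) :
  continuous f -> measurable_fun setT f.
Proof.
move=> cf; apply: measurable_fun_continuous_in; first exact: openT.
by move=> x _; exact: cf.
Qed.

(** Continuity gives measurability for the Borel sets of the product, whereas the product of two
    measurable spaces carries the product sigma-algebra. The detour through R^(m+n) reconciles them:
    joining two rows is measurable coordinate by coordinate, and splitting a row is continuous. *)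
Lemma measurable_fun_continuous_in2 m n (X : set 'rV[R]_m) (Y : set 'rV[R]_n)
    (F : 'rV[R]_m * 'rV[R]_n -> R) : open X -> open Y ->
  (forall z, X z.1 -> Y z.2 -> {for z, continuous F}) ->
  measurable_fun (X `*` Y) F.
Proof.
move=> oX oY cF.
pose sp (w : 'rV[R]_(m + n)) := (lsubmx w, rsubmx w).
pose jn (z : 'rV[R]_m * 'rV[R]_n) : 'rV[R]_(m + n) := row_mx z.1 z.2.
have jnK z : sp (jn z) = z by rewrite /sp row_mxKl row_mxKr; case: z.
have csp : continuous sp.
  move=> w; apply: differentiable_continuous; apply: differentiable_pair.
    exact: differentiable_lsubmx.
  exact: differentiable_rsubmx.
pose D : set 'rV[R]_(m + n) := sp @^-1` (X `*` Y).
have oD : open D.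
  apply: open_comp => [w _|]; first exact: csp.
  by rewrite openE => -[x y] [/= Xx Yy]; exists (X, Y) => //; split;
    apply: open_nbhs_nbhs.
have -> : F = (F \o sp) \o jn by apply/funext => z /=; rewrite jnK.
apply: (@measurable_comp _ _ _ _ _ _ D) => //.
- exact: open_measurable_rV.
- by move=> _ [z [Xz Yz] <-]; have := jnK z; rewrite /D/preimage/mkset => ->.
- apply: measurable_fun_continuous_in => // w [Xw Yw].
  apply: continuous_comp; [exact: csp|exact: cF].
- apply: measurable_to_rV => i.
  have jnE z : jn z 0 i = match fintype.split i with
      inl k => z.1 0 k | inr k => z.2 0 k end by rewrite /jn mxE.
  under eq_fun do rewrite jnE.
  case: fintype.split => k.
    exact: measurable_funTS (measurableT_comp (measurable_coord k) measurable_fst).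
  exact: measurable_funTS (measurableT_comp (measurable_coord k) measurable_snd).
Qed.

End BorelMatrices.

(** * Normal laws *)

Section GaussianLine.
Context (R : realType).
Notation mu := (@lebesgue_measure R).
Implicit Types (v w s t : R) (A : set (measurableTypeR R)).

(** Integrals against [normal_prob m s] are first expressed by its Radon-Nikodym derivative, which
    equals [normal_pdf m s] almost everywhere since both have the same integral over every
    measurable set. *)
Lemma ge0_integral_normal m s (f : R -> \bar R) : s != 0 ->
  measurable_fun setT f -> (forall x, 0 <= f x)%E ->
  (\int[normal_prob m s]_x f x = \int[mu]_x (f x * (normal_pdf m s x)%:E))%E.
Proof.
move=> s0 mf f0.
rewrite -(Radon_Nikodym_SigmaFinite.change_of_variables (normal_prob_dominates m s))//.
have dom := normal_prob_dominates m s.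
have := Radon_Nikodym_SigmaFinite.f_integrable dom => iRN.
apply: ae_eq_integral => //.
- by apply: emeasurable_funM => //; exact: measurable_int iRN.
- apply: emeasurable_funM => //; apply/measurable_EFinP; exact: measurable_normal_pdf.
apply: filterS (@integral_ae_eq _ _ _ mu setT measurableT (EFin \o normal_pdf m s) _ iRN _ _).
- by move=> x h _; rewrite h.
- apply/measurable_EFinP; exact: measurable_normal_pdf.
- by move=> E _ mE; rewrite -(Radon_Nikodym_SigmaFinite.f_integral dom).
Qed.

Lemma lebesgue_measure_shift (a : R) A : measurable A ->
  pushforward mu (fun x : measurableTypeR R => a + x : measurableTypeR R) A = mu A.
Proof.
move=> mA.
have ma : @measurable_fun _ _ (measurableTypeR R) (measurableTypeR R) setT (fun x => a + x).
  exact: measurable_funD.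
pose Ma : {mfun (measurableTypeR R) >-> (measurableTypeR R)} :=
  @mfun_Sub _ _ (measurableTypeR R) (measurableTypeR R) _ (mem_set ma).
apply/esym/(@lebesgue_measure_unique R (pushforward mu Ma)) => //= _ [[l u]] _ <-.
rewrite /pushforward/= (_ : _ @^-1` _ = `]l - a, u - a]%classic); last first.
  by apply/seteqP; split=> x; rewrite /= !in_itv/= ltrBlDl lerBrDl.
by rewrite !lebesgue_measure_itv/= !lte_fin ltrD2r -!EFinB; congr (if _ then _%:E else _); lra.
Qed.

Lemma lebesgue_measure_scale (c : R) A : 0 < c -> measurable A ->
  (c%:E * pushforward mu (fun x : measurableTypeR R => (c * x)%R : measurableTypeR R) A = mu A)%E.
Proof.
move=> c0 mA.
have ma : @measurable_fun _ _ (measurableTypeR R) (measurableTypeR R) setT (fun x => (c * x)%R).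
  exact: measurable_funM.
pose Ma : {mfun (measurableTypeR R) >-> (measurableTypeR R)} :=
  @mfun_Sub _ _ (measurableTypeR R) (measurableTypeR R) _ (mem_set ma).
have := @lebesgue_measure_unique R (mscale (NngNum (ltW c0)) (pushforward mu Ma)).
move=> -> //= _ [[l u]] _ <-.
rewrite /mscale/= /pushforward/= (_ : _ @^-1` _ = `]l / c, u / c]%classic); last first.
  by apply/seteqP; split=> x; rewrite /= !in_itv/= ltr_pdivrMr// ler_pdivlMr// mulrC.
rewrite !lebesgue_measure_itv/= !lte_fin ltr_pM2r ?invr_gt0//.
case: ifP; rewrite ?mule0// -!EFinB -EFinM => _; congr EFin.
by rewrite -mulrBl mulrCA divff ?gt_eqF// mulr1.
Qed.

Lemma normal_prob_shift m s A : s != 0 -> measurable A ->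
  normal_prob 0 s ((fun x => m + x) @^-1` A) = normal_prob m s A.
Proof.
move=> s0 mA.
have ma : @measurable_fun _ _ (measurableTypeR R) (measurableTypeR R) setT (fun x => m + x).
  exact: measurable_funD.
pose Ma : {mfun (measurableTypeR R) >-> (measurableTypeR R)} :=
  @mfun_Sub _ _ (measurableTypeR R) (measurableTypeR R) _ (mem_set ma).
rewrite /normal_prob.
rewrite [RHS](@eq_measure_integral _ _ _ _ (pushforward mu Ma)); last first.
  by move=> B mB _; exact/esym/lebesgue_measure_shift.
rewrite ge0_integral_pushforward//=; first last.
- by move=> x _; rewrite lee_fin normal_pdf_ge0.
- by apply: measurable_funTS; apply/measurable_EFinP; exact: measurable_normal_pdf.
apply: eq_integral => x _; congr EFin.
by rewrite !normal_pdfE// /normal_fun [m + x]addrC addrK subr0.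
Qed.

Lemma xsection_add (x : R) (A : set R) :
  xsection ((fun z : R * R => z.1 + z.2) @^-1` A) x = (fun y => x + y) @^-1` A.
Proof. by apply/seteqP; split=> y; rewrite /xsection/= inE. Qed.

Lemma measurable_add2 : measurable_fun setT (fun z : R * R => z.1 + z.2).
Proof. by apply: measurable_funD; [exact: measurable_fst|exact: measurable_snd]. Qed.

(** Completing the square. For x of law N(0, s^2) and z given x of law N(x, t^2), the joint density
    is rewritten as the density of z times the conditional density of x given z. *)
Lemma normal_pdf_conv s t x z : s != 0 -> t != 0 ->
  normal_pdf x t z * normal_pdf 0 s x =
  normal_pdf 0 (Num.sqrt (s ^+ 2 + t ^+ 2)) z *
  normal_pdf (z * s ^+ 2 / (s ^+ 2 + t ^+ 2)) (s * t / Num.sqrt (s ^+ 2 + t ^+ 2)) x.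
Proof.
move=> s0 t0.
have s20 : 0 < s ^+ 2 by rewrite exprn_even_gt0.
have t20 : 0 < t ^+ 2 by rewrite exprn_even_gt0.
have u20 : 0 < s ^+ 2 + t ^+ 2 by rewrite addr_gt0.
have u0 : Num.sqrt (s ^+ 2 + t ^+ 2) != 0 by rewrite gt_eqF// sqrtr_gt0.
have st0 : s * t / Num.sqrt (s ^+ 2 + t ^+ 2) != 0.
  by rewrite mulf_neq0 ?mulf_neq0 ?invr_eq0.
rewrite !normal_pdfE// mulrACA [RHS]mulrACA; congr (_ * _).
  rewrite /normal_peak -!invfM -!sqrtrM; last 2 first.
  - by rewrite mulrn_wge0// mulr_ge0 ?sqr_ge0// pi_ge0.
  - by rewrite mulrn_wge0// mulr_ge0 ?sqr_ge0// pi_ge0.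
  congr (_^-1); congr Num.sqrt.
  rewrite !exprMn exprVn sqr_sqrtr ?ltW//; field.
  by rewrite gt_eqF.
rewrite /normal_fun -!expRD; congr expR.
rewrite !exprMn exprVn sqr_sqrtr ?ltW//; field.
by rewrite s0 t0 gt_eqF.
Qed.

Lemma measurable_normal_pdf2 t : measurable_fun setT (fun z : R * R => normal_pdf z.1 t z.2).
Proof.
rewrite /normal_pdf; case: eqP => _.
  by apply: measurableT_comp => //; exact: measurable_indic.
apply: measurable_funM => //; apply: measurableT_comp => //.
apply: measurable_funM => //; apply: measurableT_comp => //; apply: measurable_funX.
by apply: measurable_funB; [exact: measurable_snd|exact: measurable_fst].
Qed.

(** Tonelli's theorem and the factorisation of the joint density; the conditional density of x
    integrates to 1. *)
Lemma normal_prob_conv s t (A : set R) : s != 0 -> t != 0 -> measurable A ->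
  (\int[normal_prob 0 s]_x normal_prob 0 t ((fun y : R => (x : R) + y)%R @^-1` A) =
   normal_prob 0 (Num.sqrt (s ^+ 2 + t ^+ 2)) A)%E.
Proof.
move=> s0 t0 mA.
have mI : measurable_fun setT (fun z : R * R => (\1_A z.2 : R)).
  by apply: measurableT_comp => //; exact: measurable_indic.
have mf1 : measurable_fun setT (fun z : measurableTypeR R * measurableTypeR R =>
    (normal_pdf z.1 t z.2 * \1_A z.2)%:E).
  by apply/measurable_EFinP; apply: measurable_funM => //; exact: measurable_normal_pdf2.
have f10 (z : measurableTypeR R * measurableTypeR R) : (0 <= (normal_pdf z.1 t z.2 * \1_A z.2)%:E)%E.
  by rewrite lee_fin mulr_ge0 ?normal_pdf_ge0.
have mf : measurable_fun setT (fun z : measurableTypeR R * measurableTypeR R =>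
    (normal_pdf z.1 t z.2 * \1_A z.2 * normal_pdf 0 s z.1)%:E).
  apply/measurable_EFinP; apply: measurable_funM; first exact/measurable_EFinP.
  exact: (measurableT_comp (measurable_normal_pdf _ _) measurable_fst).
have f0 (z : measurableTypeR R * measurableTypeR R) :
    (0 <= (normal_pdf z.1 t z.2 * \1_A z.2 * normal_pdf 0 s z.1)%:E)%E.
  by rewrite lee_fin !mulr_ge0 ?normal_pdf_ge0.
have sh (x : R) : normal_prob 0 t ((fun y : R => x + y) @^-1` A) = normal_prob x t A.
  exact: normal_prob_shift.
under eq_integral do rewrite sh.
have inner0 (x : R) : (normal_prob x t A =
    \int[mu]_z (normal_pdf x t z * \1_A z)%:E)%E.
  rewrite /normal_prob integral_mkcond; apply: eq_integral => z _.
  by rewrite patchE indicE; case: ifP => zA; rewrite ?mulr1 ?mulr0.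
have inner (x : R) : (normal_prob x t A * (normal_pdf 0 s x)%:E =
    \int[mu]_z (normal_pdf x t z * \1_A z * normal_pdf 0 s x)%:E)%E.
  rewrite inner0 -ge0_integralZr//=; first last.
  - by rewrite lee_fin normal_pdf_ge0.
  - by move=> z _; exact: (f10 (x, z)).
  - by apply/measurable_EFinP; apply: measurable_funM => //; exact: measurable_normal_pdf.
rewrite ge0_integral_normal//; last first.
  under eq_fun do rewrite inner0.
  exact: (@measurable_fun_fubini_tonelli_F _ _ _ _ _ mu _ mf1 f10).
under eq_integral do rewrite inner.
rewrite (@fubini_tonelli _ _ _ _ _ mu mu _ mf f0)/=.
rewrite [RHS]/normal_prob [RHS]integral_mkcond.
apply: eq_integral => z _; rewrite patchE.
have u20 : 0 < s ^+ 2 + t ^+ 2 by rewrite addr_gt0// exprn_even_gt0.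
under eq_integral => x _.
  rewrite -mulrA mulrCA normal_pdf_conv// mulrA EFinM.
  over.
rewrite ge0_integralZl//; first last.
- by rewrite lee_fin mulr_ge0 ?normal_pdf_ge0.
- by move=> x _; rewrite lee_fin normal_pdf_ge0.
- by apply/measurable_EFinP; exact: measurable_normal_pdf.
rewrite integral_normal_pdf mule1 indicE; case: ifP => _; first by rewrite mul1r.
by rewrite mul0r.
Qed.

End GaussianLine.

Section IdReal.
Context (R : realType).

(** The measure [normal_prob] lives on the copy [measurableTypeR R] of the line; the identity
    carries it over to [R]. *)
Lemma measurable_idR : @measurable_fun _ _ (measurableTypeR R) R setT id.
Proof. by move=> _ A mA; rewrite setTI. Qed.

Definition idR : {mfun (measurableTypeR R) >-> R} :=
  @mfun_Sub _ _ (measurableTypeR R) R id (mem_set measurable_idR).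

End IdReal.

(** Indexed by the variance and completed by the Dirac mass at variance 0, so that variances add up
    under convolution without exception and degenerate linear forms are covered. *)
HB.lock Definition gauss (R : realType) (v : R) : probability R R :=
  if v == 0 then (dirac (0 : R) : probability R R)
  else (distribution (normal_prob 0 (Num.sqrt v)) (idR R) : probability R R).

Section Gauss.
Context (R : realType).
Notation mu := (@lebesgue_measure R).
Implicit Types (v w s t c a h : R) (A : set R).

Lemma gaussE v A : v != 0 -> gauss v A = normal_prob 0 (Num.sqrt v) A.
Proof. by move=> v0; rewrite unlock (negbTE v0). Qed.

Lemma gauss0 A : gauss 0 A = (\1_A 0)%:E.
Proof. by rewrite unlock eqxx /= diracE. Qed.

Lemma integral_gauss0 (f : R -> \bar R) : measurable_fun setT f ->
  (\int[gauss 0]_y f y = f 0%R)%E.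
Proof. by move=> mf; rewrite unlock eqxx integral_dirac//= diracE in_setT mul1e. Qed.

Lemma integral_gaussE v (f : R -> \bar R) : v != 0 -> measurable_fun setT f ->
  (forall y, 0 <= f y)%E ->
  (\int[gauss v]_y f y = \int[normal_prob 0 (Num.sqrt v)]_y f y)%E.
Proof.
by move=> v0 mf f0; rewrite unlock (negbTE v0) ge0_integral_distribution.
Qed.

Lemma normal1_gauss v A : normal1 0 v A = gauss v A.
Proof. by rewrite /normal1; case: eqVneq => [->|v0]; [rewrite gauss0 diracE indicE|rewrite gaussE]. Qed.

Lemma gaussD v w A : 0 <= v -> 0 <= w -> measurable A ->
  (gauss v \x gauss w)%E ((fun z : R * R => z.1 + z.2) @^-1` A) = gauss (v + w) A.
Proof.
move=> v0 w0 mA.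
have mA' : measurable ((fun z : R * R => z.1 + z.2) @^-1` A).
  by rewrite -[X in measurable X]setTI; exact: measurable_add2.
rewrite /product_measure1/=.
have [->|vn0] := eqVneq v 0.
  rewrite integral_gauss0//; last exact: measurable_fun_xsection.
  by rewrite xsection_add add0r; congr (gauss w _); apply/seteqP; split=> y /=; rewrite add0r.
have [->|wn0] := eqVneq w 0.
  rewrite addr0 (eq_integral (fun x => (\1_A x)%:E)); last first.
    by move=> x _; rewrite xsection_add gauss0 !indicE; congr ((nat_of_bool _)%:R%:E);
      apply/idP/idP; rewrite !in_setE/= addr0.
  by rewrite integral_indic// setIT.
have sv : Num.sqrt v != 0 by rewrite gt_eqF// sqrtr_gt0 lt_neqAle eq_sym vn0.
have sw : Num.sqrt w != 0 by rewrite gt_eqF// sqrtr_gt0 lt_neqAle eq_sym wn0.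
have := normal_prob_conv sv sw mA.
rewrite !sqr_sqrtr// => e.
rewrite gaussE; last by rewrite paddr_eq0// negb_and vn0.
rewrite -e.
rewrite (_ : (\int[gauss v]_x _ = \int[normal_prob 0 (Num.sqrt v)]_x
    gauss w (xsection ((fun z : R * R => z.1 + z.2)%R @^-1` A) x))%E); last first.
  rewrite integral_gaussE//; exact: measurable_fun_xsection.
by apply: eq_integral => x _; rewrite xsection_add; exact: gaussE.
Qed.

Lemma normal_probN s A : s != 0 -> measurable A ->
  normal_prob 0 s (-%R @^-1` A) = normal_prob 0 s A.
Proof.
move=> s0 mA.
have ma : @measurable_fun _ _ (measurableTypeR R) (measurableTypeR R) setT -%R.
  exact: measurable_funN.
pose Ma : {mfun (measurableTypeR R) >-> (measurableTypeR R)} :=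
  @mfun_Sub _ _ (measurableTypeR R) (measurableTypeR R) _ (mem_set ma).
rewrite /normal_prob.
rewrite [RHS](@eq_measure_integral _ _ _ _ (pushforward mu Ma)); last first.
  by move=> B mB _; exact/esym/lebesgue_measureN.
rewrite ge0_integral_pushforward//=; first last.
- by move=> x _; rewrite lee_fin normal_pdf_ge0.
- by apply: measurable_funTS; apply/measurable_EFinP; exact: measurable_normal_pdf.
apply: eq_integral => x _; congr EFin.
by rewrite !normal_pdfE// /normal_fun !subr0 sqrrN.
Qed.

Lemma normal_prob_scale s c A : s != 0 -> 0 < c -> measurable A ->
  normal_prob 0 s ((fun x => c * x) @^-1` A) = normal_prob 0 (c * s) A.
Proof.
move=> s0 c0 mA.
have ma : @measurable_fun _ _ (measurableTypeR R) (measurableTypeR R) setT (fun x => c * x).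
  exact: measurable_funM.
pose Ma : {mfun (measurableTypeR R) >-> (measurableTypeR R)} :=
  @mfun_Sub _ _ (measurableTypeR R) (measurableTypeR R) _ (mem_set ma).
have cs0 : c * s != 0 by rewrite mulf_neq0// gt_eqF.
rewrite /normal_prob.
rewrite [RHS](@eq_measure_integral _ _ _ _ (mscale (NngNum (ltW c0)) (pushforward mu Ma))); last first.
  by move=> B mB _; rewrite /mscale/=; exact/esym/lebesgue_measure_scale.
rewrite ge0_integral_mscale//=; first last.
- by move=> x _; rewrite lee_fin normal_pdf_ge0.
- by apply: measurable_funTS; apply/measurable_EFinP; exact: measurable_normal_pdf.
rewrite ge0_integral_pushforward//=; first last.
- by move=> x _; rewrite lee_fin normal_pdf_ge0.
- by apply: measurable_funTS; apply/measurable_EFinP; exact: measurable_normal_pdf.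
rewrite -ge0_integralZl//=; first last.
- by rewrite lee_fin ltW.
- by move=> x _; rewrite lee_fin normal_pdf_ge0.
- apply: measurable_funTS; apply/measurable_EFinP.
  exact: (measurableT_comp (measurable_normal_pdf _ _)).
- by have := ma measurableT A mA; rewrite setTI.
apply: eq_integral => x _; rewrite -EFinM; congr EFin.
rewrite !normal_pdfE// /normal_peak /normal_fun mulrA; congr (_ * expR _).
  have -> : (c * s) ^+ 2 * pi *+ 2 = c ^+ 2 * (s ^+ 2 * pi *+ 2).
    by rewrite exprMn mulrnAr mulrA.
  rewrite sqrtrM ?sqr_ge0// sqrtr_sqr gtr0_norm//.
  by rewrite invfM mulrA divff ?mul1r ?gt_eqF.
rewrite !subr0 !exprMn; field.
by rewrite s0 gt_eqF.
Qed.

Lemma gauss_scale c v A : 0 <= v -> measurable A ->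
  gauss v ((fun x => c * x) @^-1` A) = gauss (c ^+ 2 * v) A.
Proof.
move=> v0 mA.
have [->|vn0] := eqVneq v 0.
  rewrite mulr0 !gauss0 !indicE; congr ((nat_of_bool _)%:R%:E).
  by apply/idP/idP; rewrite !in_setE/= mulr0.
have [->|cn0] := eqVneq c 0.
  rewrite expr0n/= mul0r gauss0 indicE.
  rewrite (_ : _ @^-1` A = if 0 \in A then setT else set0); last first.
    by apply/seteqP; split=> x /=; rewrite mul0r; case: ifPn; rewrite ?in_setE ?notin_setE.
  by case: ifP => _; rewrite ?probability_setT ?measure0.
have cv0 : c ^+ 2 * v != 0 by rewrite mulf_neq0// sqrf_eq0.
rewrite (gaussE _ vn0) [RHS](gaussE A cv0).
have s0 : Num.sqrt v != 0 by rewrite gt_eqF// sqrtr_gt0 lt_neqAle eq_sym vn0.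
rewrite sqrtrM ?sqr_ge0// sqrtr_sqr -normal_prob_scale ?normr_gt0//.
have [c0|c0] := ltP 0 c; first by rewrite gtr0_norm.
rewrite ler0_norm// -normal_probN//; last first.
  rewrite -[X in measurable X]setTI.
  have mc : measurable_fun setT (fun x : R => c * x) by exact: measurable_funM.
  exact: mc.
by congr (normal_prob _ _ _); apply/seteqP; split=> x /=; rewrite mulrN mulNr.
Qed.

(** The integrand times the standard density is (1 - a)^(-1/2) times the density of N(0, 1 / (1 -
    a)). The value a = 1/2 serves to bound the fourth moment, a = - h to compute the transform. *)
Lemma integral_gauss_expR a : a < 1 ->
  (\int[gauss 1]_y (expR (a * y ^+ 2 / 2))%:E = ((Num.sqrt (1 - a))^-1)%:E)%E.
Proof.
move=> a1.
have b0 : 0 < 1 - a by lra.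
have sb0 : 0 < Num.sqrt (1 - a) by rewrite sqrtr_gt0.
rewrite integral_gaussE ?oner_eq0// ?sqrtr1; last first.
  apply/measurable_EFinP; apply: measurableT_comp => //.
  by apply: measurable_funM => //; apply: measurable_funM => //; exact: measurable_funX.
rewrite ge0_integral_normal//; last first.
  apply/measurable_EFinP; apply: measurableT_comp => //.
  by apply: measurable_funM => //; apply: measurable_funM => //; exact: measurable_funX.
rewrite (eq_integral (fun y : measurableTypeR R => ((Num.sqrt (1 - a))^-1)%:E *
    (normal_pdf 0 (Num.sqrt (1 - a))^-1 y)%:E)%E); last first.
  move=> y _; rewrite -!EFinM; congr EFin.
  rewrite !normal_pdfE ?invr_eq0 ?gt_eqF// /normal_peak /normal_fun.
  rewrite [LHS]mulrCA -[in LHS]expRD [RHS]mulrA; congr (_ * expR _).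
    rewrite exprVn sqr_sqrtr ?ltW// expr1n mul1r -invfM -sqrtrM ?ltW//.
    congr (Num.sqrt _)^-1; rewrite mulrnAr mulrA divff ?gt_eqF// mul1r//.
  rewrite exprVn sqr_sqrtr ?ltW//; field.
  by rewrite gt_eqF.
rewrite ge0_integralZl//; first last.
- by move=> x _; rewrite lee_fin normal_pdf_ge0.
- by apply/measurable_EFinP; exact: measurable_normal_pdf.
by rewrite integral_normal_pdf mule1.
Qed.

Lemma L1_gauss_expR a : a < 1 -> L1 (gauss 1) (fun y => expR (a * y ^+ 2 / 2)).
Proof.
move=> a1; apply/integrableP; split.
  apply/measurable_EFinP; apply: measurableT_comp => //.
  by apply: measurable_funM => //; apply: measurable_funM => //; exact: measurable_funX.
under eq_integral do rewrite /= ger0_norm ?expR_ge0//.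
by rewrite integral_gauss_expR// ltry.
Qed.

Lemma E_gauss_expR a : a < 1 ->
  \int[gauss 1]_y expR (a * y ^+ 2 / 2) = (Num.sqrt (1 - a))^-1.
Proof. by move=> a1; rewrite /Rintegral integral_gauss_expR. Qed.

Lemma L1_gauss_pow4 : L1 (gauss 1) (fun y : R => y ^+ 4).
Proof.
(* The square of y^2 / 8 <= exp(y^2 / 8), whence 64 = 8^2. *)
apply: (@L1_le _ _ _ _ _ (fun y : R => 64 * expR (2^-1 * y ^+ 2 / 2))).
- exact: measurable_funX.
- move=> y; rewrite ger0_norm; last by rewrite (exprM _ 2 2) sqr_ge0.
  have := @expR_ge1Dx R (2^-1 * (2^-1 * y ^+ 2 / 2)).
  have -> : expR (2^-1 * y ^+ 2 / 2) = expR (2^-1 * (2^-1 * y ^+ 2 / 2)) ^+ 2.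
    by rewrite -expRM_natl; congr expR; lra.
  rewrite (exprM _ 2 2); have := sqr_ge0 y.
  set z := y ^+ 2; set e := expR _ => z0 h.
  have e8 : z / 8 <= e by lra.
  rewrite (_ : z ^+ 2 = 64 * (z / 8) ^+ 2); last by field.
  by rewrite ler_wpM2l// ler_pXn2r ?nnegrE ?expR_ge0//; lra.
- by apply: L1Z; apply: L1_gauss_expR; lra.
Qed.

(** Both terms lie between 1 - h / 2 and 1 - h / 2 + h^2; the inequality exp(h) >= 1 + h tells which
    one is larger. *)
Lemma inv_sqrt_expR h : 0 <= h -> `|(Num.sqrt (1 + h))^-1 - expR (- h / 2)| <= h ^+ 2.
Proof.
move=> h0; have h1 : 0 < Num.sqrt (1 + h) by rewrite sqrtr_gt0; lra.
set q := (Num.sqrt (1 + h))^-1.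
have q0 : 0 < q by rewrite invr_gt0.
have q2 : q ^+ 2 * (1 + h) = 1.
  by rewrite exprVn sqr_sqrtr ?mulVf ?gt_eqF//; lra.
have e1 : 1 - h / 2 <= expR (- h / 2).
  by have := @expR_ge1Dx R (- h / 2); lra.
have e2 : expR (- h / 2) <= q.
  rewrite -(@ler_pXn2r _ 2) ?nnegrE ?expR_ge0 ?(ltW q0)// -expRM_natl.
  have -> : 2 * (- h / 2) = - h by lra.
  have := expRxMexpNx_1 h; have := @expR_ge1Dx R h; have := expR_ge0 (- h) => E0 E1 E2.
  have h10 : 0 < 1 + h by lra.
  have : expR (- h) * (1 + h) <= q ^+ 2 * (1 + h).
    by rewrite q2 -[leRHS]E2 [leRHS]mulrC; exact: ler_wpM2l.
  by rewrite (ler_pM2r h10).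
rewrite ger0_norm; last by lra.
have : q <= 1 - h / 2 + h ^+ 2.
  have p0 : 0 <= 1 - h / 2 + h ^+ 2 by have := sqr_ge0 (h - 1); lra.
  have h10 : 0 < 1 + h by lra.
  rewrite -(@ler_pXn2r _ 2) ?nnegrE// ?(ltW q0)// -(ler_pM2r h10) q2.
  have -> : (1 - h / 2 + h ^+ 2) ^+ 2 * (1 + h) = 1 + 5 / 4 * h ^+ 2 + 5 / 4 * h ^+ 3 + h ^+ 5 by field.
  by have := exprn_ge0 2 h0; have := exprn_ge0 3 h0; have := exprn_ge0 5 h0; lra.
lra.
Qed.

Let E1 (f : R -> R) v : measurable_fun setT f -> (forall y, `|f y| <= 1) -> L1 (gauss v) f.
Proof. by move=> mf f1; exact: L1_bounded f1. Qed.

Let mcos : measurable_fun setT (@cos R).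
Proof. by apply: continuous_measurable_fun; exact: continuous_cos. Qed.
Let msin : measurable_fun setT (@sin R).
Proof. by apply: continuous_measurable_fun; exact: continuous_sin. Qed.
Let cos1 (z : R) : `|cos z| <= 1. Proof. by rewrite ler_norml cos_geN1 cos_le1. Qed.
Let sin1 (z : R) : `|sin z| <= 1. Proof. by rewrite ler_norml sin_geN1 sin_le1. Qed.
Let Lcos v : L1 (gauss v) cos. Proof. exact: E1. Qed.
Let Lsin v : L1 (gauss v) sin. Proof. exact: E1. Qed.

Lemma E_sin_gauss v : 0 <= v -> \int[gauss v]_y sin y = 0.
Proof.
move=> v0.
have mN : measurable_fun setT (fun x : R => -1 * x) by exact: measurable_funM.
have law A : measurable A -> gauss v ((fun x : R => -1 * x) @^-1` A) = gauss v A.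
  by move=> mA; rewrite (gauss_scale _ v0 mA); congr (gauss _ _); ring.
have := E_law mN law (Lsin v).
under eq_Rintegral do rewrite mulN1r sinN -mulN1r.
rewrite EZ//; lra.
Qed.

Lemma E_cos_gauss_shift v (x : R) : 0 <= v ->
  \int[gauss v]_y cos (x + y) = (\int[gauss v]_y cos y) * cos x.
Proof.
move=> v0; under eq_Rintegral do rewrite cosD.
rewrite EB; [|exact: L1Z|exact: L1Z].
by rewrite !EZ// (E_sin_gauss v0) mulr0 subr0 mulrC.
Qed.

Lemma E_cos_gaussD v w : 0 <= v -> 0 <= w ->
  \int[gauss (v + w)]_y cos y = (\int[gauss v]_y cos y) * \int[gauss w]_y cos y.
Proof.
move=> v0 w0.
have law A : measurable A -> (gauss v \x gauss w)%E ((fun z : R * R => z.1 + z.2) @^-1` A) = gauss (v + w) A.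
  exact: gaussD.
have <- := @E_law _ _ (R * R)%type R R (gauss v \x gauss w)%E (gauss (v + w)) _
  (@measurable_add2 R) law cos (Lcos _).
have mc : measurable_fun setT (fun z : R * R => cos (z.1 + z.2)).
  by apply: measurableT_comp => //; exact: measurable_add2.
have [|x|_ ->] := @E_fubini _ _ _ _ _ (gauss v) (gauss w) (fun z : R * R => cos (z.1 + z.2)).
- by apply: (@L1_bounded _ _ _ _ _ 1).
- apply: (@E1 (fun y => cos (x + y))) => //.
  by apply: measurableT_comp => //; apply: measurable_funD.
under eq_Rintegral do rewrite (E_cos_gauss_shift _ w0).
by rewrite EZ// mulrC.
Qed.

(** The function exp(- h y^2 / 2) agrees with cos(sqrt h y) up to 2 h^2 y^4 and has the explicit
    mean (1 + h)^(-1/2). Used as an intermediate term, it dispenses with computing the second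
    moment. *)
Lemma E_cos_gauss_quadratic : exists B : R, forall h, 0 <= h ->
  `|\int[gauss h]_y cos y - expR (- h / 2)| <= B * h ^+ 2.
Proof.
exists (\int[gauss 1]_y (2 * y ^+ 4) + 1) => h h0.
have msq (c : R) : measurable_fun setT (fun y : R => c * y) by exact: measurable_funM.
have law A : measurable A -> gauss 1 ((fun x : R => Num.sqrt h * x) @^-1` A) = gauss h A.
  by move=> mA; rewrite (gauss_scale _ ler01 mA) sqr_sqrtr// mulr1.
rewrite -(E_law (msq _) law (Lcos _)).
have h1 : - h < 1 by lra.
have mh := L1_gauss_expR h1.
have Lc : L1 (gauss 1) (fun y => cos (Num.sqrt h * y)) by apply: E1 => //; exact: measurableT_comp.
set q := (Num.sqrt (1 + h))^-1.
have qE : q = \int[gauss 1]_y expR (- h * y ^+ 2 / 2) by rewrite E_gauss_expR// opprK.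
rewrite [X in `|X|](_ : _ = (\int[gauss 1]_y cos (Num.sqrt h * y) - q) + (q - expR (- h / 2))); last by ring.
apply: (le_trans (ler_normD _ _)); rewrite mulrDl mul1r; apply: lerD; last exact: inv_sqrt_expR.
have L4 : L1 (gauss 1) (fun y : R => 2 * y ^+ 4) by apply: L1Z; exact: L1_gauss_pow4.
rewrite qE -EB// mulrC -EZ//; apply: E_norm_le; [exact: L1B|exact: L1Z|move=> y].
have := abs_cosBq_le (Num.sqrt h * y).
have t0 : 0 <= (Num.sqrt h * y) ^+ 2 / 2 by rewrite divr_ge0// sqr_ge0.
have := expRN_quadratic t0.
have -> : - h * y ^+ 2 / 2 = - ((Num.sqrt h * y) ^+ 2 / 2).
  by rewrite exprMn sqr_sqrtr//; lra.
rewrite (exprM _ 2 2) real_normK ?num_real// exprMn sqr_sqrtr//.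
rewrite (exprM y 2 2).
set c := cos _; set e := expR _; set z := h * y ^+ 2 => H1 H2.
have z2 : 0 <= z ^+ 2 by exact: sqr_ge0.
have -> : h ^+ 2 * (2 * (y ^+ 2) ^+ 2) = 2 * z ^+ 2 by rewrite /z; ring.
rewrite (_ : c - e = (c - 1 + z / 2) - (e - 1 + z / 2)); last by ring.
apply: (le_trans (ler_normB _ _)).
have : (z / 2) ^+ 2 = z ^+ 2 / 4 by field.
lra.
Qed.

Lemma normB_pow (a b : R) n : `|a| <= 1 -> `|b| <= 1 -> `|a ^+ n - b ^+ n| <= n%:R * `|a - b|.
Proof.
move=> a1 b1; elim: n => [|n IH]; first by rewrite !expr0 subrr normr0 mul0r.
rewrite !exprS (_ : _ - _ = a * (a ^+ n - b ^+ n) + (a - b) * b ^+ n); last by ring.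
apply: (le_trans (ler_normD _ _)); rewrite -[n.+1%:R]natr1 [leRHS]mulrDl mul1r !normrM; apply: lerD.
  by apply: le_trans IH; rewrite ler_piMl.
by rewrite ler_piMr// normrX exprn_ile1.
Qed.

(** Convolution gives C(v) = C(v / n)^n for the cosine transform C. Since C(h) and exp(- h / 2)
    differ by at most B h^2, their n-th powers at h = v / n differ by at most B v^2 / n, for every
    n. *)
Lemma E_cos_gauss v (x : R) : 0 <= v ->
  \int[gauss v]_y cos (x + y) = expR (- v / 2) * cos x.
Proof.
move=> v0.
rewrite (E_cos_gauss_shift _ v0); congr (_ * _).
pose C h := \int[gauss h]_y cos y.
have C1 h : `|C h| <= 1 by exact: E_bounded.
have CX h n : 0 <= h -> C (n%:R * h) = C h ^+ n.
  move=> h0; elim: n => [|n IH].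
    by rewrite mul0r expr0 /C /Rintegral integral_gauss0 ?cos0//; exact/measurable_EFinP.
  by rewrite -natr1 mulrDl mul1r /C E_cos_gaussD ?mulr_ge0// -/(C _) IH exprSr.
have [B HB] := E_cos_gauss_quadratic.
have Bv : (fun n : nat => B * v ^+ 2 / n%:R) @ \oo --> (0 : R).
  by rewrite -[X in _ --> X](mulr0 (B * v ^+ 2)); apply: cvgMr; exact: cvg_invn.
have key n : (0 < n)%N -> `|C v - expR (- v / 2)| <= B * v ^+ 2 / n%:R.
  move=> n0; have nn0 : n%:R != 0 :> R by rewrite pnatr_eq0 -lt0n.
  have vn0 : 0 <= v / n%:R by rewrite divr_ge0.
  rewrite -{1}[v](divfK nn0) mulrC CX//.
  have -> : expR (- v / 2) = expR (- (v / n%:R) / 2) ^+ n.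
    by rewrite -expRM_natl; congr expR; field.
  apply: (le_trans (normB_pow _ (C1 _) _)).
    by rewrite ger0_norm ?expR_ge0// -[leRHS]expR0 ler_expR mulNr oppr_le0 divr_ge0.
  apply: (le_trans (ler_wpM2l _ (HB _ vn0))) => //.
  by rewrite le_eqVlt; apply/orP; left; apply/eqP; field.
apply/eqP; rewrite -subr_eq0 -normr_eq0 eq_le normr_ge0 andbT.
apply: (cvgr_to_ge Bv); near=> n; apply: key.
by near: n; exact: nbhs_infty_gt.
Unshelve. all: by end_near. Qed.

End Gauss.

Section MultivariateNormal.
Context (R : realType) (r : nat).
Implicit Types (t a u : 'rV[R]_r) (V : 'M[R]_r).

Definition dotr u t : R := (u *m t^T) 0 0.

Lemma dotrE u t : dotr u t = \sum_i u 0 i * t 0 i.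
Proof. by rewrite /dotr mxE; apply: eq_bigr => i _; rewrite mxE. Qed.

Lemma dotrC u t : dotr u t = dotr t u.
Proof. by rewrite !dotrE; apply: eq_bigr => i _; rewrite mulrC. Qed.

Lemma dotrDl u v t : dotr (u + v) t = dotr u t + dotr v t.
Proof. by rewrite /dotr mulmxDl mxE. Qed.

Lemma dotrZl (c : R) u t : dotr (c *: u) t = c * dotr u t.
Proof. by rewrite /dotr -scalemxAl mxE. Qed.

Lemma measurable_dotr t : measurable_fun setT (dotr ^~ t).
Proof.
under eq_fun do rewrite dotrE.
apply: measurable_sum => i; apply: measurable_funM => //; exact: measurable_coord.
Qed.

(** The measure is the law of the sum over [L] of g_a a with independent standard normal
    coefficients g_a, built one vector at a time as an image of a product measure. *)
Lemma exists_normal_seq (L : seq 'rV[R]_r) :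
  exists nu : probability 'rV[R]_r R, forall t (A : set R), measurable A ->
    nu [set u | A (dotr u t)] = gauss (\sum_(a <- L) dotr a t ^+ 2) A.
Proof.
elim: L => [|a L [nu nuE]].
  exists (dirac (0 : 'rV[R]_r) : probability 'rV[R]_r R) => t A mA.
  rewrite big_nil gauss0 /= diracE indicE; congr ((nat_of_bool _)%:R%:E).
  by apply/idP/idP; rewrite !in_setE/= /dotr mul0mx mxE.
pose f (z : 'rV[R]_r * R) : 'rV[R]_r := z.1 + z.2 *: a.
have mf : measurable_fun setT f.
  apply: measurable_to_rV => i; rewrite /f.
  under eq_fun do rewrite mxE mxE.
  apply: measurable_funD.
    exact: (measurableT_comp (measurable_coord i) measurable_fst).
  by apply: measurable_funM => //; exact: measurable_snd.
exists (distribution (nu \x gauss 1)%E (mfun_Sub (mem_set mf))) => t A mA.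
rewrite big_cons; set v := \sum_(_ <- _) _; set c := dotr a t.
have v0 : 0 <= v by apply: sumr_ge0 => b _; exact: sqr_ge0.
pose psi (z : 'rV[R]_r * R) : R * R := (dotr z.1 t, c * z.2).
have mpsi : measurable_fun setT psi.
  apply: measurable_fun_pair.
    exact: (measurableT_comp (measurable_dotr t) measurable_fst).
  by apply: measurable_funM => //; exact: measurable_snd.
have mcz : measurable_fun setT (fun y : R => c * y) by exact: measurable_funM.
have law B : measurable B ->
    (gauss v \x gauss (c ^+ 2))%E B = (nu \x gauss 1)%E (psi @^-1` B).
  move=> mB.
  rewrite (@product_measure_unique _ _ _ _ _ _ _
    (distribution (nu \x gauss 1)%E (mfun_Sub (mem_set mpsi))))//.
  move=> C D mC mD.
  have mC' : measurable [set u | C (dotr u t)].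
    exact: (measurable_preimage (measurable_dotr t) mC).
  have mD' : measurable ((fun y : R => c * y) @^-1` D).
    exact: measurable_preimage mD.
  transitivity (gauss v C * gauss (c ^+ 2) D)%E => //.
  have -> : gauss v C = nu [set u | C (dotr u t)] by rewrite nuE.
  rewrite -[c ^+ 2]mulr1 -gauss_scale// -product_measure1E//.
rewrite addrC -gaussD// ?sqr_ge0// law; last first.
  exact: (measurable_preimage (@measurable_add2 R)).
congr ((nu \x gauss 1)%E _); apply/seteqP; split=> z;
  by rewrite /f /psi/= dotrDl dotrZl mulrC.
Qed.

Definition quad V t u : R := (t *m V *m u^T) 0 0.

Lemma quadDl V t t' u : quad V (t + t') u = quad V t u + quad V t' u.
Proof. by rewrite /quad !mulmxDl mxE. Qed.
Lemma quadZl V (c : R) t u : quad V (c *: t) u = c * quad V t u.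
Proof. by rewrite /quad -!scalemxAl mxE. Qed.
Lemma quadC V t u : V^T = V -> quad V t u = quad V u t.
Proof.
move=> VT; rewrite /quad -[in LHS](trmxK (t *m V *m u^T)) mxE !trmx_mul trmxK VT.
by rewrite mulmxA.
Qed.
Lemma quadDr V t u u' : quad V t (u + u') = quad V t u + quad V t u'.
Proof. by rewrite /quad linearD mulmxDr mxE. Qed.
Lemma quadZr V (c : R) t u : quad V t (c *: u) = c * quad V t u.
Proof. by rewrite /quad linearZ -scalemxAr mxE. Qed.
Lemma quad_delta V i j : quad V (delta_mx 0 i) (delta_mx 0 j) = V i j.
Proof. by rewrite /quad -rowE trmx_delta -colE !mxE. Qed.

Lemma quad_cauchy_schwarz V t u : V^T = V -> (forall w, 0 <= quad V w w) ->
  quad V t u ^+ 2 <= quad V t t * quad V u u.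
Proof.
move=> VT pV; set x := quad V t t; set y := quad V u u; set z := quad V t u.
have key (a b : R) : 0 <= a ^+ 2 * x + 2 * a * b * z + b ^+ 2 * y.
  have := pV (a *: t + b *: u).
  rewrite !(quadDl, quadDr) !(quadZl, quadZr) (quadC u t VT) -/x -/y -/z.
  by congr (_ <= _); ring.
have y0 : 0 <= y by exact: pV.
have [yE|yn] := eqVneq y 0.
  (* Without a term in b^2, the form at these coefficients equals - z^2 times a positive number,
     which forces z = 0. *)
  rewrite yE mulr0; have := key (z * (1 + x)) (- (1 + x) ^+ 2).
  have x0 : 0 <= x by exact: pV.
  have h1 : 0 < (1 + x) ^+ 2 * (2 * (1 + x) - x) by rewrite mulr_gt0 ?exprn_gt0//; lra.
  rewrite yE mulr0 addr0.
  rewrite (_ : _ + _ = - (z ^+ 2 * ((1 + x) ^+ 2 * (2 * (1 + x) - x)))); last by ring.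
  by rewrite oppr_ge0 pmulr_lle0.
have := key y (- z); rewrite (_ : _ + _ = y * (x * y - z ^+ 2)); last by ring.
by rewrite pmulr_rge0 ?subr_ge0// lt_neqAle eq_sym yn.
Qed.

(** Cholesky elimination by induction on the number of nonzero diagonal entries. Subtracting a^T a,
    with a the i-th row over the root of V_ii, kills the i-th diagonal entry and keeps the zero
    ones; the rest stays positive by Cauchy-Schwarz. A positive matrix with zero diagonal is 0,
    again by Cauchy-Schwarz. *)
Lemma psd_sum_rank_one V : V^T = V -> (forall t, 0 <= quad V t t) ->
  exists L : seq 'rV[R]_r, V = \sum_(a <- L) a^T *m a.
Proof.
have [k] := ubnP #|[pred i | V i i != 0]|; elim: k V => // k IH V Vk VT pV.
have [i Vi|V0] := pickP [pred i | V i i != 0]; last first.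
  exists [::]; rewrite big_nil; apply/matrixP => i j; rewrite mxE.
  have := quad_cauchy_schwarz (delta_mx 0 i) (delta_mx 0 j) VT pV.
  rewrite !quad_delta; have /= /negbFE/eqP -> := V0 i; rewrite mul0r.
  move=> h; apply/eqP; rewrite -sqrf_eq0 eq_le h sqr_ge0//.
rewrite /= in Vi.
have Vi0 : 0 < V i i by rewrite lt_neqAle eq_sym Vi -quad_delta pV.
have sq : Num.sqrt (V i i) ^+ 2 = V i i by rewrite sqr_sqrtr// ltW.
have s0 : Num.sqrt (V i i) != 0 by rewrite gt_eqF// sqrtr_gt0.
pose a := (Num.sqrt (V i i))^-1 *: row i V.
pose V' := V - a^T *m a.
have aE j : a 0 j = (Num.sqrt (V i i))^-1 * V i j by rewrite !mxE.
have Vsym j l : V j l = V l j by rewrite -[in LHS]VT mxE.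
have V'E j l : V' j l = V j l - V i j * V i l / V i i.
  rewrite !mxE big_ord1 mxE !aE -[in X in _ = _ - X]sq.
  by congr (_ - _); field.
have dota t : dotr a t = quad V (delta_mx 0 i) t / Num.sqrt (V i i).
  by rewrite /dotr /a -scalemxAl mxE mulrC rowE.
have qV' t : quad V' t t = quad V t t - dotr a t ^+ 2.
  rewrite /quad /V' mulmxBr mulmxBl [LHS]mxE; congr (_ + _).
  rewrite [LHS]mxE; congr (- _).
  rewrite mulmxA -mulmxA mxE big_ord1 expr2; congr (_ * _).
  exact: dotrC.
have [| | |L LE] := IH V'.
- have i_in : i \in [pred j | V j j != 0] by rewrite inE.
  move: Vk; have := cardD1 i [pred j | V j j != 0]; rewrite i_in => ->.
  rewrite ltnS; apply: leq_ltn_trans; apply: subset_leq_card; apply/fintype.subsetP => j.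
  rewrite !inE V'E => h.
  apply/andP; split.
    by apply: contraNneq h => ->; rewrite mulfK ?subrr.
  apply: contraNneq h => Vj; have := quad_cauchy_schwarz (delta_mx 0 i) (delta_mx 0 j) VT pV.
  rewrite !quad_delta Vj mulr0 => h.
  have /eqP -> : V i j == 0 by rewrite -sqrf_eq0 eq_le h sqr_ge0.
  by rewrite !mul0r subrr.
- by rewrite /V' linearB/= VT trmx_mul trmxK.
- move=> t; rewrite qV' dota exprMn exprVn sq subr_ge0 ler_pdivrMr//.
  by rewrite mulrC -[in leRHS]quad_delta quad_cauchy_schwarz.
exists (a :: L); rewrite big_cons -LE /V' addrC subrK//.
Qed.

Lemma exists_normal V : V^T = V -> (forall t, 0 <= quad V t t) ->
  exists nu : probability 'rV[R]_r R, is_normal 0 V nu /\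
    forall t (x : R), \int[nu]_u cos (x + dotr u t) = expR (- quad V t t / 2) * cos x.
Proof.
move=> VT pV; have [L VL] := psd_sum_rank_one VT pV.
have [nu nuE] := exists_normal_seq L.
have qE t : quad V t t = \sum_(a <- L) dotr a t ^+ 2.
  rewrite /quad VL mulmx_sumr mulmx_suml summxE; apply: eq_bigr => a _.
  rewrite mulmxA -mulmxA mxE big_ord1 expr2; congr (_ * _).
  exact: dotrC.
exists nu; split.
  split=> // t A mA; rewrite mul0mx mxE normal1_gauss -[X in gauss X A]/(quad V t t) qE.
  exact: nuE.
move=> t x.
have law (A : set R) : measurable A -> nu ((dotr ^~ t) @^-1` A) = gauss (quad V t t) A.
  by move=> mA; rewrite qE -nuE.
have mc : measurable_fun setT (fun y : R => cos (x + y)).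
  apply: measurableT_comp; last exact: measurable_funD.
  by apply: continuous_measurable_fun; exact: continuous_cos.
rewrite -E_cos_gauss//; apply: (E_law (measurable_dotr t) law).
by apply: (@L1_bounded _ _ _ _ _ 1) => // y; rewrite ler_norml cos_geN1 cos_le1.
Qed.

End MultivariateNormal.

(** * The continuity theorem *)

Lemma norm_coord_le (R : realType) m n (A : 'M[R]_(m, n)) i j : `|A i j| <= `|A|.
Proof.
rewrite [leRHS]/Num.Def.normr/= mx_normrE.
exact: (le_bigmax _ (fun ij : 'I_m * 'I_n => `|A ij.1 ij.2|) (i, j)).
Qed.

Lemma norm_mx_le (R : realType) m n (A : 'M[R]_(m, n)) e :
  0 <= e -> (forall i j, `|A i j| <= e) -> `|A| <= e.
Proof.
move=> e0 Ae; rewrite /Num.Def.normr/= mx_normrE.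
by apply: bigmax_le => // -[i j] _; exact: Ae.
Qed.

Lemma norm_mx_lt (R : realType) m n (A : 'M[R]_(m, n)) e :
  0 < e -> (forall i j, `|A i j| < e) -> `|A| < e.
Proof.
move=> e0 Ae; rewrite /Num.Def.normr/= mx_normrE.
by apply: bigmax_lt => // -[i j] _; exact: Ae.
Qed.

(** * Fejer kernel and trigonometric approximation *)

Section Fejer.
Context (R : realType).
Implicit Types (u alpha : R) (N : nat).

(** The square modulus of the sum of exp(i l u) over l < N, divided by N^2. With this normalisation
    its N translates by multiples of 2 pi / N sum up to 1, so that they serve as interpolation
    weights. *)
Definition fejer N u : R :=
  ((\sum_(l < N) cos (l%:R * u)) ^+ 2 + (\sum_(l < N) sin (l%:R * u)) ^+ 2) / N%:R ^+ 2.

Lemma fejer_ge0 N u : 0 <= fejer N u.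
Proof. by rewrite divr_ge0 ?addr_ge0 ?sqr_ge0// exprn_ge0. Qed.

Lemma sum_cos_telescope N u : 2 * sin (u / 2) * (\sum_(l < N) cos (l%:R * u)) =
  sin (N%:R * u - u / 2) + sin (u / 2).
Proof.
elim: N => [|N IH]; first by rewrite big_ord0 mulr0 mul0r sub0r sinN addNr.
rewrite big_ord_recr/= mulrDr IH -[N.+1%:R]natr1 [(N%:R + 1) * u]mulrDl mul1r.
rewrite (_ : N%:R * u + u - u / 2 = N%:R * u + u / 2); last by field.
by rewrite !sinD !sinN !cosN; ring.
Qed.

Lemma sum_sin_telescope N u : 2 * sin (u / 2) * (\sum_(l < N) sin (l%:R * u)) =
  cos (u / 2) - cos (N%:R * u - u / 2).
Proof.
elim: N => [|N IH]; first by rewrite big_ord0 mulr0 mul0r sub0r cosN subrr.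
rewrite big_ord_recr/= mulrDr IH -[N.+1%:R]natr1 [(N%:R + 1) * u]mulrDl mul1r.
rewrite (_ : N%:R * u + u - u / 2 = N%:R * u + u / 2); last by field.
by rewrite !cosD !sinN !cosN; ring.
Qed.

(** Since 1 - cos u = 2 sin(u / 2)^2, the two telescoping identities apply, and each of their
    right-hand sides is at most 2 in absolute value. *)
Lemma fejer_far N u : (1 - cos u) * fejer N u <= 4 / N%:R ^+ 2.
Proof.
rewrite /fejer mulrA ler_wpM2r ?invr_ge0 ?exprn_ge0//.
set A := \sum_(_ < _) _; set B := \sum_(_ < _) _.
have -> : 1 - cos u = 2 * sin (u / 2) ^+ 2.
  have -> : cos u = cos (u / 2 + u / 2) by congr cos; field.
  by rewrite cosD -!expr2 cos2sin2; ring.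
have hA := sum_cos_telescope N u; have hB := sum_sin_telescope N u.
rewrite -/A in hA; rewrite -/B in hB.
rewrite [leLHS](_ : _ = ((2 * sin (u / 2) * A) ^+ 2 + (2 * sin (u / 2) * B) ^+ 2) / 2); last by field.
rewrite hA hB.
have := cos_le1 (u / 2); have := cos_geN1 (u / 2).
have := sin_le1 (u / 2); have := sin_geN1 (u / 2).
have := cos_le1 (N%:R * u - u / 2); have := cos_geN1 (N%:R * u - u / 2).
have := sin_le1 (N%:R * u - u / 2); have := sin_geN1 (N%:R * u - u / 2).
set a := sin (_ - _); set b := cos (_ - _); set c := sin _; set e := cos _.
move=> *; have h1 : (a + c) ^+ 2 <= 4 by nra.
have h2 : (e - b) ^+ 2 <= 4 by nra.
lra.
Qed.

(** The sum of a nontrivial character over the N-th roots of unity. Multiplied by 2 sin(g / 2) it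
    telescopes over a full period to 0, and sin(g / 2) > 0 because 0 < m < N. *)
Lemma sum_cos_roots N m (b : R) : (0 < m < N)%N ->
  \sum_(j < N) cos (b - m%:R * (2 * pi * j%:R / N%:R)) = 0.
Proof.
move=> /andP[m0 mN]; have N0 : N%:R != 0 :> R.
  by rewrite pnatr_eq0 -lt0n (leq_trans m0)// ltnW.
pose g : R := 2 * pi * m%:R / N%:R.
have gE j : m%:R * (2 * pi * j%:R / N%:R) = j%:R * g by rewrite /g; field.
under eq_bigr do rewrite gE.
have tel n : 2 * sin (g / 2) * (\sum_(j < n) cos (b - j%:R * g)) =
    sin (b + g / 2) - sin (b - n%:R * g + g / 2).
  elim: n => [|n IH]; first by rewrite big_ord0 mulr0 mul0r subr0 subrr.
  rewrite big_ord_recr/= mulrDr IH -[n.+1%:R]natr1 [(n%:R + 1) * g]mulrDl mul1r.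
  rewrite (_ : b - (n%:R * g + g) + g / 2 = (b - n%:R * g) - g / 2); last by field.
  rewrite [sin (b - n%:R * g + _)]sinD [sin (b - n%:R * g - _)]sinB; ring.
have per n (x : R) : sin (x - n%:R * (2 * pi)) = sin x.
  elim: n => [|n IH]; first by rewrite mul0r subr0.
  rewrite -IH -(sinD2pi (x - _)); congr sin; rewrite -[n.+1%:R]natr1 -mulr_natr; ring.
have := tel N; rewrite (_ : b - N%:R * g + g / 2 = b + g / 2 - m%:R * (2 * pi)); last first.
  by rewrite /g; field.
rewrite per subrr => /eqP; rewrite !mulf_eq0 pnatr_eq0/= => /orP[|/eqP//].
rewrite gt_eqF//; apply: sin_gt0_pi; rewrite /g.
have NR : 0 < N%:R :> R by rewrite lt_neqAle eq_sym N0 ler0n.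
have mR : 0 < m%:R :> R by rewrite ltr0n.
have pi0 := pi_gt0 R.
rewrite (_ : 2 * pi * m%:R / N%:R / 2 = pi * (m%:R / N%:R)); last by field.
rewrite mulr_gt0 ?divr_gt0//=.
by rewrite gtr_pMr// ltr_pdivrMr// mul1r ltr_nat.
Qed.

(** After expanding the squares, the terms with l different from k cancel over the N translates, and
    each of the N diagonal terms contributes N. *)
Lemma fejer_sum N alpha : (0 < N)%N ->
  \sum_(j < N) fejer N (alpha - 2 * pi * j%:R / N%:R) = 1.
Proof.
move=> N0; have N0R : N%:R != 0 :> R by rewrite pnatr_eq0 -lt0n.
have fE u : fejer N u = (\sum_(l < N) \sum_(k < N) cos (l%:R * u - k%:R * u)) / N%:R ^+ 2.
  congr (_ / _); rewrite !expr2 !big_distrlr/= -big_split/=; apply: eq_bigr => l _.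
  rewrite -big_split/=; apply: eq_bigr => k _; by rewrite cosB.
under eq_bigr do rewrite fE.
rewrite -mulr_suml exchange_big/=.
under eq_bigr do rewrite exchange_big/=.
rewrite (eq_bigr (fun=> N%:R)) => [|l _].
  by rewrite sumr_const card_ord -[_ *+ N]mulr_natr -expr2 divff// sqrf_eq0.
rewrite (bigD1 l)//= [X in _ + X]big1 ?addr0 => [|k kl].
  under eq_bigr do rewrite subrr cos0.
  by rewrite sumr_const card_ord.
case: (ltngtP k l) => [kl'|lk'|/ord_inj/eqP]; last by rewrite (negbTE kl).
- have h : (0 < l - k < N)%N by rewrite subn_gt0 kl'/= (leq_ltn_trans (leq_subr _ _)).
  rewrite -[RHS](sum_cos_roots (l%:R * alpha - k%:R * alpha) h).
  by apply: eq_bigr => j _; rewrite natrB 1?ltnW//; congr cos; ring.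
- have h : (0 < k - l < N)%N by rewrite subn_gt0 lk'/= (leq_ltn_trans (leq_subr _ _)).
  rewrite -[RHS](sum_cos_roots (k%:R * alpha - l%:R * alpha) h).
  by apply: eq_bigr => j _; rewrite natrB 1?ltnW// -[LHS]cosN; congr cos; ring.
Qed.

End Fejer.

Section TrigPoly.
Context (R : realType) (r : nat).
Implicit Types (g h : 'rV[R]_r -> R).

Lemma dotrDr (u t t' : 'rV[R]_r) : dotr u (t + t') = dotr u t + dotr u t'.
Proof. by rewrite dotrC dotrDl ![dotr _ u]dotrC. Qed.

Lemma dotrBr (u t t' : 'rV[R]_r) : dotr u (t - t') = dotr u t - dotr u t'.
Proof. by rewrite dotrDr -[- t']scaleN1r [dotr u (_ *: _)]dotrC dotrZl mulN1r [dotr t' u]dotrC. Qed.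

(** The phases cover the sines, so that this real class is closed under products; its members are
    the test functions whose means are controlled by real characteristic functions. *)
Definition trig_poly g := exists s : seq (R * R * 'rV[R]_r),
  forall u, g u = \sum_(p <- s) p.1.1 * cos (p.1.2 + dotr u p.2).

Lemma trig_poly_ext g h : (forall u, g u = h u) -> trig_poly g -> trig_poly h.
Proof. by move=> gh [s sE]; exists s => u; rewrite -gh sE. Qed.

Lemma trig_poly_cos (b : R) (t : 'rV[R]_r) : trig_poly (fun u => cos (b + dotr u t)).
Proof. by exists [:: (1, b, t)] => u; rewrite big_seq1 mul1r. Qed.

Lemma trig_polyD g h : trig_poly g -> trig_poly h -> trig_poly (fun u => g u + h u).
Proof. by move=> [s sE] [s' s'E]; exists (s ++ s') => u; rewrite big_cat -sE -s'E. Qed.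

Lemma trig_polyZ (c : R) g : trig_poly g -> trig_poly (fun u => c * g u).
Proof.
move=> [s sE]; exists [seq (c * p.1.1, p.1.2, p.2) | p <- s] => u.
by rewrite big_map sE mulr_sumr; apply: eq_bigr => p _; rewrite mulrA.
Qed.

Lemma trig_poly_cst (c : R) : trig_poly (fun=> c).
Proof.
apply: (@trig_poly_ext (fun u => c * cos (0 + dotr u 0))) => [u|].
  by rewrite /dotr trmx0 mulmx0 mxE addr0 cos0 mulr1.
by apply: trig_polyZ; exact: trig_poly_cos.
Qed.

Lemma trig_poly_sum (I : Type) (s : seq I) (P : pred I) (F : I -> 'rV[R]_r -> R) :
  (forall i, P i -> trig_poly (F i)) -> trig_poly (fun u => \sum_(i <- s | P i) F i u).
Proof.
move=> tF; elim: s => [|i s IH].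
  by apply: (trig_poly_ext _ (trig_poly_cst 0)) => u; rewrite big_nil.
case Pi: (P i).
  apply: (trig_poly_ext _ (trig_polyD (tF _ Pi) IH)) => u.
  by rewrite big_cons Pi.
by apply: (trig_poly_ext _ IH) => u; rewrite big_cons Pi.
Qed.

Lemma trig_polyM g h : trig_poly g -> trig_poly h -> trig_poly (fun u => g u * h u).
Proof.
move=> [s sE] [s' s'E].
apply: (@trig_poly_ext (fun u => \sum_(p <- s) \sum_(q <- s')
    (p.1.1 * q.1.1 / 2) * (cos ((p.1.2 + q.1.2) + dotr u (p.2 + q.2)) +
                           cos ((p.1.2 - q.1.2) + dotr u (p.2 - q.2))))) => [u|].
  rewrite sE s'E big_distrlr/=; apply: eq_bigr => p _; apply: eq_bigr => q _.
  rewrite dotrBr dotrDr.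
  rewrite (_ : p.1.2 + q.1.2 + _ = (p.1.2 + dotr u p.2) + (q.1.2 + dotr u q.2)); last by ring.
  rewrite (_ : p.1.2 - q.1.2 + _ = (p.1.2 + dotr u p.2) - (q.1.2 + dotr u q.2)); last by ring.
  by rewrite cosD cosB; field.
apply: trig_poly_sum => p _; apply: trig_poly_sum => q _; apply: trig_polyZ.
by apply: trig_polyD; exact: trig_poly_cos.
Qed.

Lemma trig_poly_prod (I : Type) (s : seq I) (F : I -> 'rV[R]_r -> R) :
  (forall i, trig_poly (F i)) -> trig_poly (fun u => \prod_(i <- s) F i u).
Proof.
move=> tF; elim: s => [|i s IH].
  by apply: (trig_poly_ext _ (trig_poly_cst 1)) => u; rewrite big_nil.
apply: (trig_poly_ext _ (trig_polyM (tF i) IH)) => u.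
by rewrite big_cons.
Qed.

Lemma trig_poly_fejer N (c b : R) i : trig_poly (fun u => fejer N (c * u 0 i + b)).
Proof.
have tc (l : R) (a : R) : trig_poly (fun u => cos (l * (c * u 0 i + b) + a)).
  apply: (trig_poly_ext _ (trig_poly_cos (l * b + a) ((l * c) *: delta_mx 0 i))) => u.
  rewrite dotrC dotrZl {1}/dotr -rowE !mxE; congr cos; ring.
apply: (@trig_poly_ext (fun u => (N%:R ^+ 2)^-1 *
   ((\sum_(l < N) cos (l%:R * (c * u 0 i + b) + 0)) * (\sum_(l < N) cos (l%:R * (c * u 0 i + b) + 0)) +
    (\sum_(l < N) cos (l%:R * (c * u 0 i + b) + - (pi / 2))) * (\sum_(l < N) cos (l%:R * (c * u 0 i + b) + - (pi / 2)))))).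
  move=> u; rewrite /fejer mulrC; congr (_ * _).
  under eq_bigr do rewrite addr0; rewrite -!expr2; congr (_ + _ ^+ 2).
  by apply: eq_bigr => l _; rewrite cosBpihalf.
apply: trig_polyZ; apply: trig_polyD; apply: trig_polyM; apply: trig_poly_sum => l _; exact: tc.
Qed.

Lemma continuous_unif_compact (K : set 'rV[R]_r) (f : 'rV[R]_r -> R) (e : R) :
  compact K -> continuous f -> 0 < e ->
  exists2 dl, 0 < dl & forall x y, K x -> `|y - x| < dl -> `|f y - f x| < e.
Proof.
move=> /compact_near_coveringP cK cf e0.
have H : \forall dl \near 0^'+, K `<=` (fun x => forall y, `|y - x| < dl -> `|f y - f x| < e).
  apply: cK => x Kx; have e20 : 0 < e / 2 by rewrite divr_gt0.
  have /cvgrPdist_lt/(_ _ e20)/nbhs_ballP[d /= d0 dP] := cf x.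
  have d20 : 0 < d / 2 by rewrite divr_gt0.
  exists (ball x (d / 2), [set dl | dl < d / 2]) => /=.
    by split; [exact: nbhsx_ballx|exact: nbhs_right_lt].
  move=> [x' dl] /= [xx' dld] y yx'.
  rewrite -ball_normE /ball_/= in xx'.
  have h1 : `|f x - f x'| < e / 2.
    apply: dP; rewrite -ball_normE /ball_/=; lra.
  have h2 : `|f x - f y| < e / 2.
    apply: dP; rewrite -ball_normE /ball_/=.
    rewrite (_ : x - y = (x - x') - (y - x')); last by rewrite opprB addrA subrK.
    by apply: (le_lt_trans (ler_normB _ _)); lra.
  rewrite (_ : f y - f x' = (f x - f x') - (f x - f y)); last by ring.
  by apply: (le_lt_trans (ler_normB _ _)); lra.
near (0 : R)^'+ => dl; exists dl.
  by near: dl; exact: nbhs_right_gt.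
move=> x y Kx; move: x Kx y; near: dl; exact: H.
Unshelve. all: by end_near. Qed.

(** The angle may exceed pi as long as cos stays nonpositive: the nodes of the approximation below
    lie as far as three quarters of a period from the point. *)
Lemma cos_le_away (a b : R) : 0 <= a <= pi / 2 -> a <= `|b| <= 3 / 2 * pi -> cos b <= cos a.
Proof.
move=> /andP[a0 a1] /andP[ab b1]; have pi0 := pi_gt0 R.
have -> : cos b = cos `|b| by case: (ler0P b) => //; rewrite cosN.
have [bpi|bpi] := leP `|b| pi.
  move: ab; rewrite le_eqVlt => /predU1P[->//|ab].
  by apply/ltW; rewrite ltr_cos// in_itv/=; apply/andP; split; lra.
apply: (@le_trans _ _ 0); last by apply: cos_ge0_pihalf; apply/andP; split; lra.
rewrite (_ : `|b| = (`|b| - pi) + pi); last by rewrite subrK.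
by rewrite cosDpi oppr_le0; apply: cos_ge0_pihalf; apply/andP; split; lra.
Qed.

(** The values of f at a grid of nodes are averaged with products of Fejer weights. These are
    nonnegative with sum 1, so the bound B holds on the whole space and not only for [|u| <= M];
    near u the values of f are close to f u, and far nodes carry little weight. *)
Lemma trig_poly_approx (f : 'rV[R]_r -> R) (B M e : R) : continuous f ->
  (forall u, `|f u| <= B) -> 0 < M -> 0 < e ->
  exists p, [/\ trig_poly p, forall u, `|p u| <= B &
    forall u, `|u| <= M -> `|p u - f u| <= e].
Proof.
move=> cf fB M0 e0; have pi0 := pi_gt0 R.
have B0 : 0 <= B by apply: le_trans (fB 0).
pose K : set 'rV[R]_r := [set u | forall i, `[(- M), M]%classic (u ord0 i)].
have cK : compact K by apply: (@rV_compact _ _ (fun=> `[(- M), M]%classic)) => i; exact: segment_compact.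
have e20 : 0 < e / 2 by rewrite divr_gt0.
have [dl0 dl00 dlP0] := continuous_unif_compact cK cf e20.
pose dl := Num.min dl0 M.
have dl_gt0 : 0 < dl by rewrite lt_min dl00 M0.
have dlM : dl <= M by rewrite ge_min lexx orbT.
(* The weights then have period 4 M. For |x| <= M and nodes in [- 2 M, 2 M] the distance is at most
   3 M, an angle of 3 pi / 2, so no node is mistaken for a near one by periodicity. *)
pose c : R := pi / (2 * M).
have c0 : 0 < c by rewrite divr_gt0// mulr_gt0.
pose eta := 1 - cos (c * dl).
have cM : c * M = pi / 2 by rewrite /c; field; rewrite gt_eqF.
have eta0 : 0 < eta.
  have cdl : c * dl <= pi / 2 by rewrite -cM ler_wpM2l// ltW.
  have cdl0 : 0 < c * dl by rewrite mulr_gt0.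
  rewrite subr_gt0 -[ltRHS]cos0 ltr_cos ?in_itv//=.
    by apply/andP; split; lra.
  by apply/andP; split; lra.
(* In one coordinate the far nodes have total weight at most N times 4 / (eta N^2). A union over the
   r coordinates, with values of f differing by at most 2 B, has to stay below e / 2. *)
have [N0 N0P] : exists N : nat, 2 * B * r%:R * (4 / eta) < N%:R * (e / 2).
  exists (Num.truncn (2 * B * r%:R * (4 / eta) / (e / 2))).+1.
  rewrite -ltr_pdivrMr//; exact: truncnS_gt.
pose N := N0.+1.
have NP : 2 * B * r%:R * (4 / eta) < N%:R * (e / 2).
  by apply: (lt_trans N0P); rewrite ltr_pM2r// ltr_nat.
have N_gt0 : 0 < N%:R :> R by rewrite ltr0n.
pose y (j : 'I_N) : R := 2 * M * (2 * j%:R / N%:R - 1).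
pose W (x : R) (j : 'I_N) := fejer N (c * x + (pi - 2 * pi * j%:R / N%:R)).
have W0 x j : 0 <= W x j by exact: fejer_ge0.
have W1 x : \sum_j W x j = 1.
  rewrite -(fejer_sum (c * x + pi) (ltn0Sn N0)); apply: eq_bigr => j _.
  by rewrite /W addrA.
have Warg x (j : 'I_N) : c * x + (pi - 2 * pi * j%:R / N%:R) = c * (x - y j).
  by rewrite /y /c; field; rewrite !gt_eqF.
have yb (j : 'I_N) : - (2 * M) <= y j <= 2 * M.
  have j0 : 0 <= j%:R / N%:R :> R by rewrite divr_ge0.
  have j1 : j%:R / N%:R <= 1 :> R by rewrite ler_pdivrMr// mul1r ler_nat ltnW.
  by rewrite /y -mulrA; apply/andP; split; nra.
have Wfar x (j : 'I_N) : `|x| <= M -> dl <= `|x - y j| -> W x j <= 4 / eta / N%:R ^+ 2.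
  move=> xM far; rewrite /W Warg.
  have /andP[y1 y2] := yb j.
  have h : cos (c * (x - y j)) <= cos (c * dl).
    apply: cos_le_away.
      apply/andP; split; first exact: (mulr_ge0 (ltW c0) (ltW dl_gt0)).
      by rewrite -cM; exact: (ler_wpM2l (ltW c0) dlM).
    rewrite normrM gtr0_norm// ler_wpM2l ?(ltW c0)//=.
    have -> : 3 / 2 * pi = c * (3 * M) by rewrite mulrCA cM; field.
    rewrite ler_wpM2l ?(ltW c0)//.
    have : `|y j| <= 2 * M by rewrite ler_norml y1 y2.
    by have := ler_normB x (y j); lra.
  rewrite [leRHS]mulrAC ler_pdivlMr// [leLHS]mulrC; apply: le_trans (fejer_far N (c * (x - y j))).
  by rewrite ler_wpM2r ?fejer_ge0// /eta lerD2l lerN2.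
pose yy (F : {ffun 'I_r -> 'I_N}) : 'rV[R]_r := \row_i y (F i).
pose w (u : 'rV[R]_r) (F : {ffun 'I_r -> 'I_N}) := \prod_i W (u ord0 i) (F i).
have w0 u F : 0 <= w u F by apply: prodr_ge0.
have w1 u : \sum_F w u F = 1.
  rewrite /w -(bigA_distr_bigA (fun i j => W (u ord0 i) j)) big1//.
exists (fun u => \sum_F f (yy F) * w u F); split.
- apply: trig_poly_sum => F _; apply: trig_polyZ; apply: trig_poly_prod => i.
  exact: trig_poly_fejer.
- move=> u; apply: (le_trans (ler_norm_sum _ _ _)).
  rewrite -[leRHS]mulr1 -(w1 u) mulr_sumr; apply: ler_sum => F _.
  by rewrite normrM (ger0_norm (w0 _ _)) ler_wpM2r.
move=> u uM.
have uiM i : `|u ord0 i| <= M.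
  by apply: le_trans uM; exact: norm_coord_le.
have Ku : K u by move=> i; rewrite /= in_itv/= -ler_norml.
rewrite -[f u]mulr1 -(w1 u) mulr_sumr -sumrB.
apply: (le_trans (ler_norm_sum _ _ _)).
pose far i (F : {ffun 'I_r -> 'I_N}) := dl <= `|u ord0 i - y (F i)|.
apply: (@le_trans _ _ (\sum_F (e / 2 * w u F + \sum_i (2 * B * ((far i F)%:R * w u F))))).
  apply: ler_sum => F _; rewrite -mulrBl normrM (ger0_norm (w0 _ _)).
  have [/existsP[i fi]|/existsPn near] := boolP [exists i, far i F].
    rewrite (bigD1 i)//= fi mul1r.
    apply: (@le_trans _ _ (2 * B * w u F)).
      rewrite ler_wpM2r//; apply: (le_trans (ler_normB _ _)).
      by have := fB (yy F); have := fB u; lra.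
    rewrite addrCA lerDl; apply: addr_ge0; first exact: (mulr_ge0 (ltW e20) (w0 _ _)).
    by apply: sumr_ge0 => k _; rewrite !mulr_ge0.
  rewrite big1 ?addr0 => [|i _]; last by rewrite (negbTE (near i)) mul0r mulr0.
  rewrite ler_wpM2r// ltW//; apply: dlP0 => //.
  apply: (@lt_le_trans _ _ dl); last by rewrite ge_min lexx.
  apply: norm_mx_lt => // a i; rewrite (ord1 a) !mxE distrC ltNge.
  exact: near.
rewrite big_split/= -mulr_sumr w1 mulr1 exchange_big/= [leRHS](splitr e) lerD2l.
have Wsum i : \sum_F (far i F)%:R * w u F <= 4 / eta / N%:R.
  pose G (k : 'I_r) (j : 'I_N) : R := if k == i then (dl <= `|u ord0 i - y j|)%R%:R * W (u ord0 k) j else W (u ord0 k) j.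
  rewrite (eq_bigr (fun F : {ffun 'I_r -> 'I_N} => \prod_k G k (F k))); last first.
    move=> F _; rewrite /w (bigD1 i)//= [RHS](bigD1 i)//= mulrA; congr (_ * _).
      by rewrite /G eqxx.
    by apply: eq_bigr => k /negbTE ki; rewrite /G ki.
  rewrite -(bigA_distr_bigA G) (bigD1 i)//= [X in _ * X]big1 ?mulr1; last first.
    by move=> k /negbTE ki; rewrite /G ki W1.
  rewrite /G eqxx.
  apply: (@le_trans _ _ (\sum_(j < N) (4 / eta / N%:R ^+ 2))).
    apply: ler_sum => j _; case: (leP dl) => [h|_]; rewrite ?mul1r ?mul0r.
      exact: Wfar.
    by rewrite divr_ge0 ?exprn_ge0// divr_ge0// ltW.
  rewrite sumr_const card_ord -mulr_natr le_eqVlt; apply/orP; left; apply/eqP.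
  by field; rewrite !gt_eqF.
apply: (@le_trans _ _ (\sum_(i < r) (2 * B * (4 / eta / N%:R)))).
  by apply: ler_sum => i _; rewrite -mulr_sumr ler_wpM2l// mulr_ge0.
rewrite sumr_const card_ord -[leLHS]mulr_natr.
have -> : 2 * B * (4 / eta / N%:R) * r%:R = 2 * B * r%:R * (4 / eta) / N%:R by ring.
by rewrite ler_pdivrMr// [leRHS]mulrC ltW.
Qed.

End TrigPoly.

(** * From characteristic functions to convergence in distribution *)

Section LevyContinuity.
Context (R : realType) (r : nat) d (T : measurableType d) (Pr : probability T R).
Variables (Z : nat -> T -> 'rV[R]_r) (nu : probability 'rV[R]_r R).
Hypothesis mZ : forall n, measurable_fun setT (Z n).
Hypothesis cvg_cos : forall (x : R) t,
  \int[Pr]_w cos (x + dotr (Z n w) t) @[n --> \oo] --> \int[nu]_u cos (x + dotr u t).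
Hypothesis tightZ : forall e : R, 0 < e -> exists2 M : R, 0 < M &
  \forall n \near \oo, (Pr [set w | (M <= `|Z n w|)%R] <= e%:E)%E.

Let mcos (x : R) (t : 'rV[R]_r) : measurable_fun setT (fun u => cos (x + dotr u t)).
Proof.
apply: measurableT_comp; last by apply: measurable_funD => //; exact: measurable_dotr.
by apply: continuous_measurable_fun; exact: continuous_cos.
Qed.

Let cos1 (z : R) : `|cos z| <= 1. Proof. by rewrite ler_norml cos_geN1 cos_le1. Qed.

Lemma measurable_trig_poly (g : 'rV[R]_r -> R) : trig_poly g -> measurable_fun setT g.
Proof.
move=> [s sE]; rewrite (funext sE); apply: measurable_sum => p.
exact: measurable_funM.
Qed.

Lemma cvg_sum_seq (I : Type) (s : seq I) (F : nat -> I -> R) (l : I -> R) :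
  (forall p, F n p @[n --> \oo] --> l p) ->
  \sum_(p <- s) F n p @[n --> \oo] --> \sum_(p <- s) l p.
Proof.
move=> Fl; elim: s => [|p s IH].
  rewrite big_nil (_ : (fun n => _) = cst 0); first exact: cvg_cst.
  by apply/funext => n; rewrite big_nil.
rewrite big_cons (_ : (fun n => _) = (fun n => F n p + \sum_(p <- s) F n p)).
  by apply: cvgD.
by apply/funext => n; rewrite big_cons.
Qed.

Lemma cvg_trig_poly (g : 'rV[R]_r -> R) : trig_poly g ->
  \int[Pr]_w g (Z n w) @[n --> \oo] --> \int[nu]_u g u.
Proof.
move=> [s sE]; rewrite (funext sE).
have Lc p : L1 nu (fun u => p.1.1 * cos (p.1.2 + dotr u p.2)).
  by apply: L1Z; exact: (@L1_bounded _ _ _ _ _ 1).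
have LcZ n p : L1 Pr (fun w => p.1.1 * cos (p.1.2 + dotr (Z n w) p.2)).
  apply: L1Z; apply: (@L1_bounded _ _ _ _ _ 1) => //.
  exact: (measurableT_comp (mcos p.1.2 p.2) (mZ n)).
rewrite E_sum//.
under eq_fun do rewrite E_sum//.
apply: cvg_sum_seq => p.
rewrite EZ; last exact: (@L1_bounded _ _ _ _ _ 1).
under eq_fun => n.
  rewrite EZ; last first.
    apply: (@L1_bounded _ _ _ _ _ 1) => //.
    exact: (measurableT_comp (mcos p.1.2 p.2) (mZ n)).
  over.
by apply: cvgMr; exact: cvg_cos.
Qed.

Lemma measurable_norm_ge (M : R) : measurable [set u : 'rV[R]_r | M <= `|u|].
Proof.
have mn : measurable_fun setT (fun u : 'rV[R]_r => `|u|).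
  by apply: measurable_fun_continuous_rV => u; exact: norm_continuous.
have := measurable_preimage mn (measurable_itv `[M, +oo[).
by congr measurable; apply/seteqP; split=> u; rewrite /= in_itv/= andbT.
Qed.

Lemma probability_norm_tail (e : R) : 0 < e ->
  exists2 M : R, 0 < M & (nu [set u | (M <= `|u|)%R] <= e%:E)%E.
Proof.
move=> e0; pose A (k : nat) := [set u : 'rV[R]_r | k%:R <= `|u|].
have mA k : measurable (A k) by exact: measurable_norm_ge.
have h : \int[nu]_u \1_(A k) u @[k --> \oo] --> (0 : R).
  rewrite -[X in _ --> X](E_cst nu 0).
  apply: (@E_dominated_cvg _ _ _ _ _ _ (fun=> 1)) => //.
  - by move=> k; exact: measurable_indic.
  - exact: L1_cst.
  - move=> u; apply: cvg_near_cst; near=> k.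
    rewrite indicE memNset//= => ku.
    have : `|u| < k%:R by near: k; exact: nbhs_infty_gtr.
    by rewrite ltNge ku.
  - by move=> k u; rewrite indicE normr_nat lern1 leq_b1.
have /cvgrPdist_le/(_ _ e0) [k0 _ hk] := h.
exists k0.+1%:R => //.
have := hk k0.+1 (leqnSn _); rewrite /= E_indic// sub0r normrN ger0_norm ?fine_ge0// => hle.
by rewrite -lee_fin fineK ?fin_num_measure in hle.
Unshelve. all: by end_near. Qed.

Lemma dist_expectation_le (d' : measure_display) (S : measurableType d') (P : probability S R)
    (Y : S -> 'rV[R]_r) (f g : 'rV[R]_r -> R) (B M e e' : R) :
  measurable_fun setT Y -> measurable_fun setT f -> measurable_fun setT g -> 0 <= e ->
  (forall u, `|f u| <= B) -> (forall u, `|g u| <= B) ->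
  (forall u, `|u| <= M -> `|g u - f u| <= e) ->
  (P [set w | (M <= `|Y w|)%R] <= e'%:E)%E ->
  `|\int[P]_w f (Y w) - \int[P]_w g (Y w)| <= e + 2 * B * e'.
Proof.
move=> mY mf mg e0 fB gB gf PM.
have B0 : 0 <= B by apply: le_trans (fB 0).
have mA : measurable [set w | M <= `|Y w|].
  exact: (measurable_preimage mY (measurable_norm_ge M)).
have LB (h : 'rV[R]_r -> R) : measurable_fun setT h -> (forall u, `|h u| <= B) ->
    L1 P (fun w => h (Y w)).
  move=> mh hB; apply: (@L1_bounded _ _ _ _ _ B) => [|w]; [exact: measurableT_comp|exact: hB].
rewrite -EB; [|exact: LB|exact: LB].
have LI : L1 P (fun w => 2 * B * \1_[set w | M <= `|Y w|] w).
  by apply: L1Z; apply: (@L1_bounded _ _ _ _ _ 1) => // w; rewrite indicE normr_nat lern1 leq_b1.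
apply: (@le_trans _ _ (\int[P]_w (e + 2 * B * \1_[set w | M <= `|Y w|] w))).
  apply: E_norm_le; [by apply: L1B; exact: LB|by apply: L1D => //; exact: L1_cst|move=> w].
  rewrite indicE; have [h|h] := leP M `|Y w|.
    rewrite mem_set//= mulr1; apply: (le_trans (ler_normB _ _)).
    by have := fB (Y w); have := gB (Y w); lra.
  rewrite memNset/= ?mulr0 ?addr0; last by apply/negP; rewrite -ltNge.
  by rewrite distrC gf// ltW.
rewrite ED//; last exact: L1_cst.
rewrite E_cst lerD2l EZ//; last first.
  by apply: (@L1_bounded _ _ _ _ _ 1) => // w; rewrite indicE normr_nat lern1 leq_b1.
rewrite ler_wpM2l ?mulr_ge0// E_indic//.
by rewrite -lee_fin fineK// fin_num_measure.
Qed.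

(** The test function is replaced by a trigonometric polynomial under both laws. Off the ball only
    the common bound B is available, and there the tails of [nu] and of [Z n] are small. *)
Theorem levy_continuity : cvg_in_distribution Pr Z nu.
Proof.
move=> f cf [B fB].
have B0 : 0 <= B by apply: le_trans (fB 0).
have mf := measurable_fun_continuous_rV cf.
apply/cvgrPdist_le => e e0.
pose e1 := e / (4 * (1 + 2 * B)).
have e10 : 0 < e1 by rewrite divr_gt0// mulr_gt0//; lra.
have e1E : 4 * (e1 + 2 * B * e1) = e.
  by rewrite /e1; field; rewrite gt_eqF//; lra.
have [M1 M10 M1P] := probability_norm_tail e10.
have [M2 M20 M2P] := tightZ e10.
pose M := Num.max M1 M2.
have M0 : 0 < M by rewrite lt_max M10.
have [p [tp pB pf]] := trig_poly_approx cf fB M0 e10.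
have mp := measurable_trig_poly tp.
have sub1 (S : Type) (Y : S -> 'rV[R]_r) M' : M' <= M -> [set w | M <= `|Y w|] `<=` [set w | M' <= `|Y w|].
  by move=> M'M w /=; exact: le_trans.
have hnu : `|\int[nu]_u f u - \int[nu]_u p u| <= e1 + 2 * B * e1.
  apply: (@dist_expectation_le _ _ nu id _ _ _ M) => //; first exact: ltW.
  apply: le_trans M1P; apply: le_measure; rewrite ?inE; try exact: measurable_norm_ge.
  by apply: sub1; rewrite le_max lexx.
have /cvgrPdist_le/(_ _ e10) cp := cvg_trig_poly tp.
near=> n.
have hZ : `|\int[Pr]_w f (Z n w) - \int[Pr]_w p (Z n w)| <= e1 + 2 * B * e1.
  apply: (@dist_expectation_le _ _ Pr (Z n) _ _ _ M) => //; first exact: ltW.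
  apply: (@le_trans _ _ (Pr [set w | (M2 <= `|Z n w|)%R])); last by near: n.
  apply: le_measure; rewrite ?inE; try exact: (measurable_preimage (mZ n) (measurable_norm_ge _)).
  by apply: sub1; rewrite le_max lexx orbT.
have hp : `|\int[nu]_u p u - \int[Pr]_w p (Z n w)| <= e1 by near: n.
rewrite (_ : _ - _ = (\int[nu]_u f u - \int[nu]_u p u) +
  (\int[nu]_u p u - \int[Pr]_w p (Z n w)) - (\int[Pr]_w f (Z n w) - \int[Pr]_w p (Z n w))); last by ring.
apply: (le_trans (ler_normB _ _)); rewrite -e1E.
apply: (le_trans (lerD (ler_normD _ _) hZ)).
have := mulr_ge0 B0 (ltW e10).
lra.
Unshelve. all: by end_near. Qed.

End LevyContinuity.

(** * U-statistics *)

Section UStatistics.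
Context d d' (T : measurableType d) (S : measurableType d') (R : realType).
Context (Pr : probability T R) (Q : probability S R).
Variable X : nat -> {RV Pr >-> S}.
Hypothesis iidX : iid Q X.
Implicit Types h : S * S -> R.

Definition usum h n w : R :=
  \sum_(i < n) \sum_(j < n | j != i) h (X i w, X j w).

Lemma usum_pairE h n w :
  usum h n w = \sum_(p : 'I_n * 'I_n | p.2 != p.1) h (X p.1 w, X p.2 w).
Proof. by rewrite /usum pair_big_dep. Qed.

Lemma usumD h h' n w : usum (fun z => h z + h' z) n w = usum h n w + usum h' n w.
Proof. by rewrite !usum_pairE big_split. Qed.

Lemma usumZ (c : R) h n w : usum (fun z => c * h z) n w = c * usum h n w.
Proof. by rewrite !usum_pairE mulr_sumr. Qed.

Lemma usum_cst (c : R) n w : usum (fun=> c) n w = (n * n.-1)%:R * c.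
Proof.
rewrite /usum (eq_bigr (fun=> c *+ n.-1)) => [|i _].
  by rewrite sumr_const card_ord -mulrnA mulr_natl mulnC.
by rewrite (eq_bigl (mem (predC1 i)))// sumr_const cardC1 card_ord.
Qed.

Lemma usum_marginals (f : S -> R) n w :
  usum (fun z => f z.1 + f z.2) n w = 2 * n.-1%:R * \sum_(i < n) f (X i w).
Proof.
have h1 : usum (fun z => f z.1) n w = n.-1%:R * \sum_(i < n) f (X i w).
  rewrite /usum mulr_sumr; apply: eq_bigr => i _ /=.
  by rewrite (eq_bigl (mem (predC1 i)))// sumr_const cardC1 card_ord mulr_natl.
have h2 : usum (fun z => f z.2) n w = usum (fun z => f z.1) n w.
  rewrite /usum (exchange_big_dep xpredT)//=; apply: eq_bigr => j _.
  by apply: eq_bigl => i; rewrite eq_sym.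
by rewrite usumD h2 h1; ring.
Qed.

Let mX i : measurable_fun setT (X i). Proof. exact: measurable_funPT. Qed.

Let mpair i j h : measurable_fun setT h ->
  measurable_fun setT (fun w => h (X i w, X j w)).
Proof. by move=> mh; apply: (measurableT_comp mh); apply: measurable_fun_pair. Qed.

Lemma L1_usum h n : L1 (Q \x Q)%E h -> L1 Pr (usum h n).
Proof.
move=> lh; apply: L1_sum => i _; apply: L1_sum => j ji.
by have [] := E_pair iidX (i := i) (j := j) _ lh; rewrite // eq_sym.
Qed.

Lemma E_usum h n : L1 (Q \x Q)%E h ->
  \int[Pr]_w usum h n w = (n * n.-1)%:R * \int[(Q \x Q)%E]_z h z.
Proof.
move=> lh.
have E (i j : 'I_n) : j != i -> L1 Pr (fun w => h (X i w, X j w)) /\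
    \int[Pr]_w h (X i w, X j w) = \int[(Q \x Q)%E]_z h z.
  by move=> ji; apply: E_pair => //; rewrite eq_sym.
rewrite /usum E_sum => [|i _]; last by apply: L1_sum => j ji; exact: (E i j ji).1.
rewrite -(usum_cst _ n point) /usum; apply: eq_bigr => i _.
rewrite E_sum => [|j ji]; last exact: (E i j ji).1.
by apply: eq_bigr => j ji; exact: (E i j ji).2.
Qed.

Lemma E_sum_sq (xi : S -> R) n : measurable_fun setT xi ->
  L1 Q (fun y => xi y ^+ 2) -> \int[Q]_y xi y = 0 ->
  L1 Pr (fun w => (\sum_(i < n) xi (X i w)) ^+ 2) /\
  \int[Pr]_w (\sum_(i < n) xi (X i w)) ^+ 2 = n%:R * \int[Q]_y (xi y ^+ 2).
Proof.
move=> mxi xi2 xi0; have lxi := L1_sq mxi xi2.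
have mxX i : measurable_fun setT (fun w => xi (X i w)) by exact: measurableT_comp.
have lX2 i : L1 Pr (fun w => xi (X i w) ^+ 2).
  exact: (L1_law (mX i) (iid_law iidX i) xi2).
have lXX i j : L1 Pr (fun w => xi (X i w) * xi (X j w)) by exact: L1_sqM.
have sqE w : (\sum_(i < n) xi (X i w)) ^+ 2 =
    \sum_(i < n) \sum_(j < n) xi (X i w) * xi (X j w) by rewrite expr2 big_distrlr.
under eq_fun do rewrite sqE.
split; first by apply: L1_sum => i _; apply: L1_sum.
rewrite E_sum => [|i _]; last exact: L1_sum.
rewrite (eq_bigr (fun=> \int[Q]_y (xi y ^+ 2))) => [|i _].
  by rewrite sumr_const card_ord mulr_natl.
rewrite E_sum// (bigD1 i)//= [X in _ + X]big1 ?addr0 => [|j ji].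
  under eq_Rintegral do rewrite -expr2.
  exact: (E_law (mX i) (iid_law iidX i) xi2).
have lp := L1_prodM lxi lxi.
have [|_ ->] := E_pair iidX (i := i) (j := j) _ lp; first by rewrite eq_sym.
have [|_ ->] := E_fubini lp; first by move=> x; exact: (L1Z (xi x) lxi).
by under eq_Rintegral do rewrite /= EZ// xi0 mulr0; rewrite E_cst.
Qed.

Section Degenerate.
Variable h : S * S -> R.
Hypothesis mh : measurable_fun setT h.
Hypothesis h2 : L1 (Q \x Q)%E (fun z => h z ^+ 2).
Hypothesis hs : forall x, L1 Q (fun y => h (x, y)).
Hypothesis h0 : forall x, \int[Q]_y h (x, y) = 0.
Hypothesis hC : forall x y, h (x, y) = h (y, x).

Let lh2 i j : i != j -> L1 Pr (fun w => h (X i w, X j w) ^+ 2).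
Proof. by move=> ij; have [] := E_pair iidX ij h2. Qed.

Let lhh i j k l : i != j -> k != l ->
  L1 Pr (fun w => h (X i w, X j w) * h (X k w, X l w)).
Proof. by move=> ij kl; apply: L1_sqM; rewrite ?lh2//; exact: mpair. Qed.

(** The index j occurs in one factor only. With the other observations frozen, integrating out X_j
    gives 0 by degeneracy. *)
Lemma E_degenerate_cross i j k l : j != i -> j != k -> j != l -> k != l ->
  \int[Pr]_w (h (X i w, X j w) * h (X k w, X l w)) = 0.
Proof.
move=> ji jk jl kl.
pose f (p : others X j * S) := h (X i p.1, p.2) * h (X k p.1, X l p.1).
have mo a : j != a -> measurable_fun setT (fun p : others X j * S => X a p.1).
  move=> ja; apply: (@measurableT_comp _ _ _ _ _ _ (X a : others X j -> S)) => //.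
  by apply: measurable_fun_others; rewrite eq_sym.
have mf : measurable_fun setT f.
  by apply: measurable_funM; apply: (measurableT_comp mh);
    apply: measurable_fun_pair => //; exact: mo.
have [| |_ E] := E_others iidX mf.
- by apply: lhh => //; rewrite eq_sym.
- by move=> w; rewrite /f/=; under eq_fun do rewrite mulrC; exact: (L1Z _ (hs _)).
rewrite E; under eq_Rintegral => w _.
  under eq_Rintegral do rewrite /f/= mulrC; rewrite EZ// h0 mulr0.
  over.
by rewrite E_cst.
Qed.

(** A pair (i, j) is correlated only with itself and with (j, i), so each of the at most n^2 pairs
    contributes 2 c. *)
Lemma E_degenerate_usum_sq n : L1 Pr (fun w => usum h n w ^+ 2) /\
  \int[Pr]_w (usum h n w ^+ 2) <= 2 * n%:R ^+ 2 * \int[(Q \x Q)%E]_z (h z ^+ 2).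
Proof.
set c := \int[(Q \x Q)%E]_z (h z ^+ 2).
have c0 : 0 <= c by apply: Rintegral_ge0 => // z _; exact: sqr_ge0.
have sqE w : usum h n w ^+ 2 = \sum_(p : 'I_n * 'I_n | p.2 != p.1)
    \sum_(q : 'I_n * 'I_n | q.2 != q.1) h (X p.1 w, X p.2 w) * h (X q.1 w, X q.2 w).
  by rewrite usum_pairE expr2 big_distrlr.
under eq_fun do rewrite sqE.
have lpq (p q : 'I_n * 'I_n) : p.2 != p.1 -> q.2 != q.1 ->
    L1 Pr (fun w => h (X p.1 w, X p.2 w) * h (X q.1 w, X q.2 w)).
  by move=> p12 q12; apply: lhh; rewrite eq_sym.
split.
  by apply: L1_sum => p p12; apply: L1_sum => q q12; exact: lpq.
rewrite E_sum => [|p p12]; last by apply: L1_sum => q q12; exact: lpq.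
apply: (@le_trans _ _ (\sum_(p : 'I_n * 'I_n | p.2 != p.1) 2 * c)); last first.
  rewrite big_mkcond/= (@le_trans _ _ (\sum_(p : 'I_n * 'I_n) 2 * c))//.
    by apply: ler_sum => p _; case: ifP => // _; rewrite mulr_ge0.
  rewrite sumr_const card_prod card_ord -[leLHS]mulr_natl natrM expr2.
  by rewrite mulrA [_ * 2]mulrC.
apply: ler_sum => -[i j] /= ji.
rewrite E_sum => [|q q12]; last exact: (lpq (i, j) q).
have sq (k l : nat) : k != l -> \int[Pr]_w (h (X k w, X l w) ^+ 2) = c.
  by move=> kl; have [_ ->] := E_pair iidX kl h2.
rewrite (bigD1 (i, j))//= (bigD1 (j, i))/=; last first.
  by rewrite eq_sym ji/= xpair_eqE negb_and ji.
rewrite big1 => [|[k l]/= /andP[/andP[lk kl1] kl2]].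
  under eq_Rintegral do rewrite -expr2.
  under [X in _ + (X + _)]eq_Rintegral do rewrite [h (X j _, _)]hC -expr2.
  by rewrite !sq// 1?eq_sym//; lra.
have ij : i != j by rewrite eq_sym.
have kl : k != l by rewrite eq_sym.
(* If j is one of k and l, then i is neither, as (k, l) differs from (i, j) and (j, i). In that case
   i is the isolated index, moved to the second place by the symmetry of h. *)
have [ejk|jk] := eqVneq j k.
  have il : i != l by apply: contraNneq kl2 => <-; rewrite ejk.
  have ik : i != k by rewrite -ejk.
  under eq_Rintegral do rewrite hC.
  exact: (E_degenerate_cross ij ik il kl).
have [ejl|jl] := eqVneq j l.
  have ik : i != k by apply: contraNneq kl1 => <-; rewrite ejl.
  have il : i != l by rewrite -ejl.
  under eq_Rintegral do rewrite hC.
  exact: (E_degenerate_cross ij ik il kl).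
exact: (E_degenerate_cross ji jk jl kl).
Qed.

End Degenerate.

Section Hoeffding.
Variables (h : S * S -> R) (G : S -> R).
Hypothesis mh : measurable_fun setT h.
Hypothesis hC : forall x y, h (x, y) = h (y, x).
Hypothesis mG : measurable_fun setT G.
Hypothesis G2 : L1 Q (fun x => G x ^+ 2).
Hypothesis hG : forall x y, `|h (x, y)| <= G x * G y.
Hypothesis Eh : \int[(Q \x Q)%E]_z h z = 0.

Definition marginal (k : S * S -> R) x := \int[Q]_y k (x, y).

Let lG : L1 Q G. Proof. exact: L1_sq. Qed.

Lemma L1_dominated_section x : L1 Q (fun y => h (x, y)).
Proof.
apply: (@L1_le _ _ _ _ _ (fun y => G x * G y)) => //; last exact: L1Z.
by apply: (measurableT_comp mh); exact: measurable_pair1.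
Qed.

Lemma L1_dominated : L1 (Q \x Q)%E h.
Proof.
apply: (@L1_le _ _ _ _ _ (fun z => G z.1 * G z.2)) => //; last exact: L1_prodM.
by move=> [x y]; exact: hG.
Qed.

Lemma L1_dominated_sq : L1 (Q \x Q)%E (fun z => h z ^+ 2).
Proof.
apply: (@L1_le _ _ _ _ _ (fun z => G z.1 ^+ 2 * G z.2 ^+ 2)).
- exact: measurable_funX.
- move=> [x y]; rewrite normrX -exprMn ler_sqr ?nnegrE// ?hG//.
  exact: le_trans (hG x y).
- exact: (L1_prodM G2 G2).
Qed.

Let fub := E_fubini L1_dominated L1_dominated_section.

Lemma L1_marginal : L1 Q (marginal h). Proof. exact: fub.1. Qed.

Lemma E_marginal : \int[Q]_x marginal h x = 0.
Proof. by rewrite -[RHS]Eh fub.2. Qed.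

Lemma marginal_le x : `|marginal h x| <= \int[Q]_y `|G y| * `|G x|.
Proof.
apply: (@le_trans _ _ (\int[Q]_y (`|G x| * `|G y|))).
  apply: E_norm_le; [exact: L1_dominated_section|by apply: L1Z; exact: L1_norm|].
  by move=> y; rewrite -normrM; apply: le_trans (ler_norm _); exact: hG.
by rewrite EZ; [rewrite [leLHS]mulrC|exact: L1_norm].
Qed.

Lemma L1_marginal_sq : L1 Q (fun x => marginal h x ^+ 2).
Proof.
apply: (@L1_le _ _ _ _ _ (fun x => (\int[Q]_y `|G y|) ^+ 2 * G x ^+ 2)).
- by apply: measurable_funX; exact: L1_measurable L1_marginal.
- move=> x; rewrite normrX -[G x ^+ 2]real_normK ?num_real// -exprMn.
  by rewrite ler_sqr ?nnegrE ?marginal_le// (le_trans _ (marginal_le x)).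
- exact: L1Z.
Qed.

(** Since the mean of h is 0, subtracting both marginals leaves a degenerate kernel k. Its sum over
    pairs has a second moment of order n^2 only, one power of n below that of the projected part. *)
Lemma E_hoeffding_remainder : exists2 C : R, 0 <= C & forall n,
  L1 Pr (fun w => (usum h n w - 2 * n.-1%:R * \sum_(i < n) marginal h (X i w)) ^+ 2) /\
  \int[Pr]_w ((usum h n w - 2 * n.-1%:R * \sum_(i < n) marginal h (X i w)) ^+ 2)
    <= C * n%:R ^+ 2.
Proof.
pose k z := h z + (- 1) * (marginal h z.1 + marginal h z.2).
have mm := L1_measurable L1_marginal.
have mk : measurable_fun setT k.
  apply: measurable_funD => //; apply: measurable_funM => //.
  by apply: measurable_funD; exact: measurableT_comp.
have lm1 (x : S) : L1 Q (fun y => marginal h x + marginal h y).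
  by apply: L1D; [exact: L1_cst|exact: L1_marginal].
have k2 : L1 (Q \x Q)%E (fun z => k z ^+ 2).
  pose c := \int[Q]_y `|G y|.
  have c0 : 0 <= c by apply: Rintegral_ge0.
  apply: (@L1_le _ _ _ _ _ (fun z => 3 * (h z ^+ 2) +
    (3 * ((marginal h z.1 ^+ 2) * 1) + 3 * (1 * (marginal h z.2 ^+ 2))))).
  - exact: measurable_funX.
  - move=> z; rewrite ger0_norm ?sqr_ge0// /k.
    set a := h z; set b := marginal _ _; set e := marginal _ _.
    have := sqr_ge0 (a + b); have := sqr_ge0 (a + e); have := sqr_ge0 (b - e).
    nra.
  - apply: L1D; first by apply: L1Z; exact: L1_dominated_sq.
    apply: L1D; apply: L1Z.
      exact: (L1_prodM L1_marginal_sq (L1_cst Q 1)).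
    exact: (L1_prodM (L1_cst Q 1) L1_marginal_sq).
have ks x : L1 Q (fun y => k (x, y)).
  exact: (L1D (L1_dominated_section x) (L1Z (-1) (lm1 x))).
have k0 x : \int[Q]_y k (x, y) = 0.
  rewrite /k/= ED; [|exact: L1_dominated_section|exact: L1Z].
  rewrite EZ// ED; [|exact: L1_cst|exact: L1_marginal].
  by rewrite E_cst E_marginal /marginal addr0 mulN1r subrr.
have kC x y : k (x, y) = k (y, x).
  by rewrite /k/= hC [marginal h x + _]addrC.
exists (2 * \int[(Q \x Q)%E]_z (k z ^+ 2)).
  by rewrite mulr_ge0//; apply: Rintegral_ge0 => // z _; exact: sqr_ge0.
move=> n; have := E_degenerate_usum_sq mk k2 ks k0 kC n.
have kE w : usum k n w = usum h n w - 2 * n.-1%:R * \sum_(i < n) marginal h (X i w).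
  by rewrite /k usumD usumZ usum_marginals mulN1r.
by under eq_fun do rewrite kE; rewrite mulrAC.
Qed.

End Hoeffding.

End UStatistics.

(** * M-estimation *)

Lemma measurable_norm_ge1 d (T : measurableType d) (R : realType) (f : T -> R) (e : R) :
  measurable_fun setT f -> measurable [set w | e <= `|f w|].
Proof.
move=> mf; have mn : measurable_fun setT (fun w => `|f w|) by exact: measurableT_comp.
have := measurable_preimage mn (measurable_itv `[e, +oo[).
by congr measurable; apply/seteqP; split=> u; rewrite /= in_itv/= andbT.
Qed.

Lemma measurable_norm_gt1 d (T : measurableType d) (R : realType) (f : T -> R) (e : R) :
  measurable_fun setT f -> measurable [set w | e < `|f w|].
Proof.
move=> mf; have mn : measurable_fun setT (fun w => `|f w|) by exact: measurableT_comp.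
have := measurable_preimage mn (measurable_itv `]e, +oo[).
by congr measurable; apply/seteqP; split=> u; rewrite /= in_itv/= andbT.
Qed.

(** * Smallness and boundedness in probability *)

Section HighProbability.
Context d (T : measurableType d) (R : realType) (Pr : probability T R).
Implicit Types (A B : nat -> set T) (f g : nat -> T -> R).

(* Outer probabilities: the sets A n need not be measurable. *)
Definition whp A := forall p : R, 0 < p -> \forall n \near \oo,
  exists2 B, measurable B /\ ~` A n `<=` B & (Pr B <= p%:E)%E.

Definition op1 f := forall e : R, 0 < e -> whp (fun n => [set w | `|f n w| <= e]).

Definition tight1 f := forall p : R, 0 < p -> exists2 M : R, 0 < M &
  \forall n \near \oo, exists2 B, measurable B /\ [set w | M <= `|f n w|] `<=` B &
    (Pr B <= p%:E)%E.

Lemma whp_sub A B : (\forall n \near \oo, A n `<=` B n) -> whp A -> whp B.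
Proof.
move=> AB hA p p0; apply: filterS2 AB (hA p p0) => n AB [C [mC AC] PC].
by exists C => //; split => //; apply: subset_trans AC; exact: subsetC.
Qed.

Lemma whpI A B : whp A -> whp B -> whp (fun n => A n `&` B n).
Proof.
move=> hA hB p p0; have p20 : 0 < p / 2 by rewrite divr_gt0.
apply: filterS2 (hA _ p20) (hB _ p20) => n [C [mC AC] PC] [D [mD BD] PD].
exists (C `|` D).
  by split; [exact: measurableU|rewrite setCI; exact: setUSS].
by rewrite [p]splitr EFinD; apply: (le_trans (measureU2 _ mC mD)); exact: leeD.
Qed.

Lemma whpT A : (\forall n \near \oo, A n = setT) -> whp A.
Proof.
move=> hA p p0; near=> n; exists set0; last by rewrite measure0 lee_fin ltW.
split => //; rewrite (_ : A n = setT) ?setCT//; by near: n.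
Unshelve. all: by end_near. Qed.

Lemma whp_ae A : (\forall n \near \oo, {ae Pr, forall w, A n w}) -> whp A.
Proof.
move=> hA p p0; apply: filterS hA => n [B [mB PB AB]].
by exists B; rewrite ?PB ?lee_fin ?(ltW p0).
Qed.

Lemma op1_le f g A : whp A -> op1 g ->
  (\forall n \near \oo, forall w, A n w -> `|f n w| <= `|g n w|) -> op1 f.
Proof.
move=> hA og fg e e0; apply: whp_sub (whpI hA (og e e0)).
by apply: filterS fg => n fg w [Aw gw]; exact: le_trans (fg w Aw) gw.
Qed.

Lemma op1_dom f g : op1 g -> (forall n w, `|f n w| <= `|g n w|) -> op1 f.
Proof.
move=> og fg; apply: (@op1_le f g (fun=> setT)) => //.
  by apply: whpT; exact: nearW.
by apply: nearW => n w _.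
Qed.

Lemma op1_near f g : op1 g -> (\forall n \near \oo, forall w, `|f n w| <= `|g n w|) ->
  op1 f.
Proof.
move=> og fg; apply: (@op1_le f g (fun=> setT)) => //.
  by apply: whpT; exact: nearW.
by apply: filterS fg => n fg w _.
Qed.

Lemma op1D f g : op1 f -> op1 g -> op1 (fun n w => f n w + g n w).
Proof.
move=> of_ og e e0; have e20 : 0 < e / 2 by rewrite divr_gt0.
apply: whp_sub (whpI (of_ _ e20) (og _ e20)); apply: nearW => n w [fw gw] /=.
by rewrite [e]splitr; apply: (le_trans (ler_normD _ _)); exact: lerD.
Qed.

Lemma op1_norm f : op1 f -> op1 (fun n w => `|f n w|).
Proof. by move=> of_; apply: (op1_dom of_) => n w; rewrite normr_id. Qed.

Lemma op1_0 : op1 (fun _ _ => 0).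
Proof.
move=> e e0; apply: whpT; apply: nearW => n; apply/seteqP; split => // w _ /=.
by rewrite normr0 ltW.
Qed.

Lemma op1Z (c : R) f : op1 f -> op1 (fun n w => c * f n w).
Proof.
move=> of_ e e0; have c0 : 0 < `|c| + 1 by rewrite ltr_wpDl.
have ec0 : 0 < e / (`|c| + 1) by rewrite divr_gt0.
apply: whp_sub (of_ _ ec0); apply: nearW => n w /= fw.
rewrite normrM (@le_trans _ _ ((`|c| + 1) * `|f n w|))//.
  by rewrite ler_wpM2r// lerDl.
by rewrite -ler_pdivlMl// mulrC.
Qed.

Lemma op1_sum (I : Type) (s : seq I) (F : I -> nat -> T -> R) :
  (forall i, op1 (F i)) -> op1 (fun n w => \sum_(i <- s) F i n w).
Proof.
move=> oF; elim: s => [|i s IH].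
  by apply: (op1_dom op1_0) => n w; rewrite big_nil.
by apply: (op1_dom (op1D (oF i) IH)) => n w; rewrite big_cons.
Qed.

Lemma op1_tight f g : op1 f -> tight1 g -> op1 (fun n w => f n w * g n w).
Proof.
move=> of_ tg e e0 p p0; have p20 : 0 < p / 2 by rewrite divr_gt0.
have [M M0 hM] := tg _ p20.
have eM : 0 < e / M by rewrite divr_gt0.
apply: filterS2 (of_ _ eM _ p20) hM => n [C [mC AC] PC] [D [mD BD] PD].
exists (C `|` D); last first.
  by rewrite [p]splitr EFinD; apply: (le_trans (measureU2 _ mC mD)); exact: leeD.
split; first exact: measurableU.
move=> w /= hw; have [gM|gM] := leP M `|g n w|; first by right; exact: BD.
left; apply: AC => /= fe; apply: hw; rewrite normrM.
rewrite -[e](divfK (lt0r_neq0 M0)); apply: ler_pM => //; exact: ltW.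
Qed.

Lemma tight1_le f g : tight1 g -> (forall n w, `|f n w| <= `|g n w|) -> tight1 f.
Proof.
move=> tg fg p p0; have [M M0 hM] := tg p p0; exists M => //.
apply: filterS hM => n [B [mB gB] PB]; exists B => //; split => // w /= Mf.
by apply: gB; exact: le_trans Mf (fg n w).
Qed.

Lemma tight1_add f g : op1 f -> tight1 g -> tight1 (fun n w => f n w + g n w).
Proof.
move=> of_ tg p p0; have p20 : 0 < p / 2 by rewrite divr_gt0.
have [M M0 hM] := tg _ p20; exists (1 + M + 1); first by rewrite !addr_gt0.
apply: filterS2 (of_ _ (@ltr01 R) _ p20) hM => n [C [mC AC] PC] [D [mD BD] PD].
exists (C `|` D); last first.
  by rewrite [p]splitr EFinD; apply: (le_trans (measureU2 _ mC mD)); exact: leeD.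
split; first exact: measurableU.
move=> w /= hw; have [gM|gM] := leP M `|g n w|; first by right; exact: BD.
left; apply: AC => /= fe.
by have := ler_normD (f n w) (g n w); lra.
Qed.

Lemma op1_E_sq f (a : nat -> R) : (forall n, L1 Pr (fun w => f n w ^+ 2)) ->
  (forall n, measurable_fun setT (f n)) ->
  (forall n, \int[Pr]_w (f n w ^+ 2) <= a n) -> a n @[n --> \oo] --> (0 : R) -> op1 f.
Proof.
move=> lf mf fa /cvgrPdist_le a0 e e0 p p0.
have ep : 0 < p * e ^+ 2 by rewrite mulr_gt0// exprn_gt0.
near=> n; exists [set w | e <= `|f n w|].
  split; last by move=> w /= /negP; rewrite -ltNge; exact: ltW.
  exact: measurable_norm_ge1.
apply: (le_trans (markov_sq e0 (lf n))); rewrite lee_fin ler_pdivrMr ?exprn_gt0//.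
apply: (le_trans (fa n)).
have : `|0 - a n| <= p * e ^+ 2 by near: n; exact: a0.
by rewrite sub0r normrN; apply: le_trans; exact: ler_norm.
Unshelve. all: by end_near. Qed.

Lemma tight1_E f (C : R) : (forall n, L1 Pr (f n)) ->
  (\forall n \near \oo, \int[Pr]_w `|f n w| <= C) -> tight1 f.
Proof.
move=> lf fC p p0; pose M := (`|C| + 1) / p.
have M0 : 0 < M by rewrite divr_gt0// ltr_wpDl.
exists M => //; near=> n; exists [set w | M <= `|f n w|].
  split => //.
  by apply: measurable_norm_ge1; exact: L1_measurable.
apply: (le_trans (markov_norm M0 (lf n))); rewrite lee_fin ler_pdivrMr//.
have : \int[Pr]_w `|f n w| <= C by near: n.
move=> /le_trans; apply; rewrite /M mulrCA divff ?gt_eqF// mulr1.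
by rewrite (le_trans (ler_norm C))// lerDl.
Unshelve. all: by end_near. Qed.

Lemma E_op1 f (C : R) : (forall n, measurable_fun setT (f n)) ->
  (forall n w, `|f n w| <= C) -> op1 f -> \int[Pr]_w f n w @[n --> \oo] --> (0 : R).
Proof.
move=> mf fC of_; have C0 : 0 <= C by apply: le_trans (fC 0%N point).
apply/cvgrPdist_le => e e0; have e20 : 0 < e / 2 by rewrite divr_gt0.
have p0 : 0 < e / 2 / (C + 1) by rewrite divr_gt0// ltr_wpDl.
apply: filterS (of_ _ e20 _ p0) => n [B [mB hB] PB].
have LI : L1 Pr (\1_B : T -> R).
  by apply: (@L1_bounded _ _ _ _ _ 1) => // w; rewrite indicE normr_nat lern1 leq_b1.
rewrite sub0r normrN (@le_trans _ _ (\int[Pr]_w (e / 2 + C * \1_B w)))//.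
  apply: E_norm_le; [exact: L1_bounded|apply: L1D; [exact: L1_cst|exact: L1Z]|].
  move=> w; rewrite indicE; have [wB|wB] := pselect (B w).
    by rewrite mem_set//= mulr1 (le_trans (fC n w))// lerDr ltW.
  by rewrite memNset//= mulr0 addr0; apply: contrapT => h; apply: wB; exact: hB.
rewrite ED; [|exact: L1_cst|exact: L1Z].
rewrite E_cst EZ// E_indic// [leRHS]splitr lerD2l.
have PB' : fine (Pr B) <= e / 2 / (C + 1).
  by rewrite -lee_fin fineK// fin_num_measure.
apply: (le_trans (ler_wpM2l C0 PB')).
by rewrite mulrCA ler_piMr ?(ltW e20)// ler_pdivrMr ?ltr_wpDl// mul1r lerDl.
Qed.

End HighProbability.

(** * Limits of U-statistics *)

Section UStatisticLimits.
Context d d' (T : measurableType d) (S : measurableType d') (R : realType).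
Context (Pr : probability T R) (Q : probability S R).
Variable X : nat -> {RV Pr >-> S}.
Hypothesis iidX : iid Q X.

Let mX i : measurable_fun setT (X i). Proof. exact: measurable_funPT. Qed.

(** For n >= 2 the left-hand side is n / (n - 1)^2; for n < 2 it is 0, as the inverse of 0 is 0. *)
Lemma sqrt_ustat_weight_le n : Num.sqrt n%:R ^+ 2 * ((n * n.-1)%:R^-1 ^+ 2 * n%:R ^+ 2)
  <= 4 * n%:R^-1 :> R.
Proof.
case: n => [|[|n]]; rewrite ?muln0 ?mul0n ?invr0 ?expr0n/= ?mul0r ?mulr0//.
rewrite sqr_sqrtr// natrM -[n.+2%:R]natr1 -[n.+1%:R]natr1.
have : 0 <= n%:R :> R by [].
set x := n%:R => x0; have x1 : 0 < x + 1 by lra.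
have x2 : 0 < x + 1 + 1 by lra.
rewrite (_ : _ * _ = (x + 1 + 1) / (x + 1) ^+ 2); last by field; rewrite !gt_eqF.
by rewrite ler_pdivrMr ?exprn_gt0// mulrAC ler_pdivlMr//; nra.
Qed.

Lemma op1_hoeffding (h : S * S -> R) (G : S -> R) :
  measurable_fun setT h -> (forall x y, h (x, y) = h (y, x)) ->
  measurable_fun setT G -> L1 Q (fun x => G x ^+ 2) ->
  (forall x y, `|h (x, y)| <= G x * G y) -> \int[(Q \x Q)%E]_z h z = 0 ->
  op1 Pr (fun n w => Num.sqrt n%:R * ((n * n.-1)%:R^-1 *
    (usum X h n w - 2 * n.-1%:R * \sum_(i < n) marginal Q h (X i w)))).
Proof.
move=> mh hC mG G2 hG Eh.
have [C C0 hC'] := E_hoeffding_remainder iidX mh hC mG G2 hG Eh.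
pose D n w := usum X h n w - 2 * n.-1%:R * \sum_(i < n) marginal Q h (X i w).
have mm := L1_measurable (L1_marginal mh mG G2 hG).
have mD n : measurable_fun setT (D n).
  apply: measurable_funB.
    by apply: L1_measurable; apply: (L1_usum iidX); exact: (L1_dominated mh mG G2 hG).
  apply: measurable_funM => //; apply: measurable_sum => i; exact: measurableT_comp.
apply: (@op1_E_sq _ _ _ _ _ (fun n => C * 4 * n%:R^-1)).
- move=> n; under eq_fun do rewrite !exprMn; apply: L1Z; apply: L1Z.
  exact: (hC' n).1.
- by move=> n; apply: measurable_funM => //; apply: measurable_funM => //; exact: (mD n).
- move=> n; under eq_Rintegral do rewrite !exprMn.
  rewrite EZ; last by apply: L1Z; exact: (hC' n).1.
  rewrite EZ; last exact: (hC' n).1.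
  apply: (@le_trans _ _ (Num.sqrt n%:R ^+ 2 * ((n * n.-1)%:R^-1 ^+ 2 * (C * n%:R ^+ 2)))).
    by rewrite ler_wpM2l ?sqr_ge0// ler_wpM2l ?sqr_ge0//; exact: (hC' n).2.
  rewrite -mulrA (_ : _ * (_ * (C * _)) = C * (Num.sqrt n%:R ^+ 2 * ((n * n.-1)%:R^-1 ^+ 2 * n%:R ^+ 2))); last by ring.
  by rewrite ler_wpM2l// sqrt_ustat_weight_le.
- rewrite -[X in _ --> X](mulr0 (C * 4)); apply: cvgMr; exact: cvg_invn.
Qed.

(** A bounded kernel is dominated by G(x) G(y) with G the constant sqrt B, so the Hoeffding
    decomposition applies; both of its parts vanish in mean square. *)
Lemma ustat_lln_bounded (h : S * S -> R) (B : R) : measurable_fun setT h ->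
  (forall x y, h (x, y) = h (y, x)) -> (forall z, `|h z| <= B) ->
  \int[(Q \x Q)%E]_z h z = 0 -> op1 Pr (fun n w => (n * n.-1)%:R^-1 * usum X h n w).
Proof.
move=> mh hC hB Eh; pose G := fun _ : S => Num.sqrt B.
have B0 : 0 <= B by apply: le_trans (hB point).
have mG : measurable_fun setT G by exact: measurable_cst.
have G2 : L1 Q (fun x => G x ^+ 2) by exact: (L1_cst Q (Num.sqrt B ^+ 2)).
have hG x y : `|h (x, y)| <= G x * G y by rewrite -expr2 sqr_sqrtr.
have m2 := L1_marginal_sq mh mG G2 hG.
have mm := L1_measurable (L1_marginal mh mG G2 hG).
have m0 := E_marginal mh mG G2 hG Eh.
have o2 : op1 Pr (fun n w => 2 * n%:R^-1 * \sum_(i < n) marginal Q h (X i w)).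
  apply: (@op1_E_sq _ _ _ _ _ (fun n => 4 * (\int[Q]_x (marginal Q h x ^+ 2)) * n%:R^-1)).
  - move=> n; under eq_fun do rewrite exprMn.
    by apply: L1Z; exact: (E_sum_sq iidX n mm m2 m0).1.
  - move=> n; apply: measurable_funM => //; apply: measurable_sum => i.
    exact: measurableT_comp.
  - move=> n; under eq_Rintegral do rewrite exprMn.
    have [l El] := E_sum_sq iidX n mm m2 m0.
    rewrite EZ// El.
    case: n {l El} => [|n]; first by rewrite mul0r mulr0 invr0 mulr0.
    rewrite le_eqVlt; apply/orP; left; apply/eqP; field.
    by rewrite nat1r pnatr_eq0.
  - rewrite -[X in _ --> X](mulr0 (4 * \int[Q]_x (marginal Q h x ^+ 2))).
    by apply: cvgMr; exact: cvg_invn.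
apply: (op1_near (op1D (op1_norm (op1_hoeffding mh hC mG G2 hG Eh)) (op1_norm o2))).
exists 2%N => // n /= n2 w; rewrite [leRHS]ger0_norm ?addr_ge0//.
have n0 : 0 < n%:R :> R by rewrite ltr0n ltnW.
have n10 : 0 < n.-1%:R :> R by rewrite ltr0n -subn1 subn_gt0.
have s1 : 1 <= Num.sqrt n%:R :> R.
  by rewrite -[leLHS]sqrtr1 ler_wsqrtr// ler1n ltnW.
set U := usum _ _ _ _; set s := \sum_(i < n) _.
have -> : (n * n.-1)%:R^-1 * U = (n * n.-1)%:R^-1 * (U - 2 * n.-1%:R * s) + 2 * n%:R^-1 * s.
  by rewrite natrM; field; rewrite !gt_eqF.
apply: (le_trans (ler_normD _ _)); rewrite lerD2r [leRHS]normrM.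
by rewrite ger0_norm ?sqrtr_ge0// ler_peMl.
Qed.

(** Truncation at level M reduces to bounded centred kernels. The mean absolute value of the
    discarded U-statistic is at most that of h - tr M, whatever n, so Markov's inequality handles it
    with h merely integrable. *)
Lemma ustat_lln (h : S * S -> R) : (forall x y, h (x, y) = h (y, x)) ->
  L1 (Q \x Q)%E h ->
  op1 Pr (fun n w => (n * n.-1)%:R^-1 * usum X h n w - \int[(Q \x Q)%E]_z h z).
Proof.
move=> hC lh; have mh := L1_measurable lh.
pose A (M : nat) := [set z | `|h z| <= M%:R].
have mA M : measurable (A M).
  rewrite -[A M]setCK (_ : ~` A M = [set z | M%:R < `|h z|]).
    by apply: measurableC; exact: measurable_norm_gt1.
  by apply/seteqP; split => z /=; [move/negP; rewrite -ltNge|move=> h1; apply/negP; rewrite -ltNge].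
pose tr M z := h z * \1_(A M) z.
have mtr M : measurable_fun setT (tr M) by apply: measurable_funM => //; exact: measurable_indic.
have trM M z : `|tr M z| <= M%:R.
  rewrite /tr indicE; have [zA|zA] := pselect (A M z); first by rewrite mem_set// mulr1.
  by rewrite memNset// mulr0 normr0.
have trh M z : `|tr M z| <= `|h z|.
  by rewrite normrM ler_piMr// indicE normr_nat lern1 leq_b1.
have ltr M : L1 (Q \x Q)%E (tr M) by exact: (@L1_bounded _ _ _ _ _ M%:R).
have ldiff M : L1 (Q \x Q)%E (fun z => h z - tr M z) by exact: L1B.
have cvg_diff : \int[(Q \x Q)%E]_z `|h z - tr M z| @[M --> \oo] --> (0 : R).
  rewrite -[X in _ --> X](E_cst (Q \x Q)%E 0).
  apply: (@E_dominated_cvg _ _ _ _ _ _ (fun z => `|h z|)) => //.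
  - by move=> M; exact: L1_measurable (L1_norm (ldiff M)).
  - exact: L1_norm.
  - move=> z; apply: cvg_near_cst; near=> M.
    rewrite /tr indicE mem_set ?mulr1 ?subrr ?normr0//=.
    by apply: ltW; near: M; exact: nbhs_infty_gtr.
  - move=> M z; rewrite normr_id /tr indicE; case: (_ \in _) => /=.
      by rewrite mulr1 subrr normr0.
    by rewrite mulr0 subr0.
move=> e e0 p p0.
have e3 : e / 3 + e / 3 + e / 3 = e by field.
have e30 : 0 < e / 3 by rewrite divr_gt0.
have p20 : 0 < p / 2 by rewrite divr_gt0.
(* The first bound controls the change of the mean under truncation; the second one makes the
   discarded part exceed e / 3 with probability at most p / 2. *)
pose t := Num.min (e / 3) (e / 3 * (p / 2)).
have t0 : 0 < t by rewrite lt_min e30 mulr_gt0.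
have /cvgrPdist_le/(_ t t0) [M _ hM] := cvg_diff.
have {hM} : \int[(Q \x Q)%E]_z `|h z - tr M z| <= t.
  have := hM M (leqnn M); rewrite /= sub0r normrN; apply: le_trans; exact: ler_norm.
rewrite le_min => /andP[dM1 dM2].
pose c := \int[(Q \x Q)%E]_z tr M z.
pose k z := tr M z - c.
have AC x y : tr M (x, y) = tr M (y, x).
  rewrite /tr hC !indicE; congr (_ * _%:R); congr (nat_of_bool _).
  by apply/idP/idP => /set_mem; rewrite /A/= => h'; apply/mem_set; rewrite /= hC.
have kop : op1 Pr (fun n w => (n * n.-1)%:R^-1 * usum X k n w).
  apply: (@ustat_lln_bounded _ (M%:R + `|c|)).
  - exact: measurable_funB.
  - by move=> x y; rewrite /k AC.
  - by move=> z; apply: (le_trans (ler_normB _ _)); rewrite lerD2r.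
  - by rewrite EB// ?E_cst ?subrr//; exact: L1_cst.
apply: filterS2 (nbhs_infty_gt 1) (kop _ e30 _ p20) => n n2 [C [mC hCk] PC].
have n0 : 0 < (n * n.-1)%:R :> R.
  by rewrite ltr0n muln_gt0 ltnW//= -subn1 subn_gt0.
pose U w := (n * n.-1)%:R^-1 * usum X (fun z => h z - tr M z) n w.
have lU : L1 Pr U by apply: L1Z; exact: (L1_usum iidX).
have EU : \int[Pr]_w `|U w| <= e / 3 * (p / 2).
  apply: le_trans dM2.
  have lN := L1_norm (ldiff M).
  apply: (@le_trans _ _ (\int[Pr]_w ((n * n.-1)%:R^-1 * usum X (fun z => `|h z - tr M z|) n w))).
    apply: E_le; [exact: L1_norm|by apply: L1Z; exact: (L1_usum iidX)|move=> w].
    rewrite /U normrM ger0_norm ?invr_ge0 ?(ltW n0)// ler_wpM2l ?invr_ge0 ?(ltW n0)//.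
    by rewrite !usum_pairE; exact: ler_norm_sum.
  rewrite EZ; last exact: (L1_usum iidX).
  by rewrite (E_usum iidX)// mulrA mulVf ?gt_eqF// mul1r.
exists (C `|` [set w | e / 3 <= `|U w|]); last first.
  have mU : measurable [set w | e / 3 <= `|U w|].
    exact: (measurable_norm_ge1 _ (L1_measurable lU)).
  rewrite [p]splitr EFinD; apply: (le_trans (measureU2 _ mC mU)); apply: leeD => //.
  apply: (le_trans (markov_norm e30 lU)); rewrite lee_fin ler_pdivrMr//.
  by rewrite mulrC.
split.
  apply: measurableU => //.
  exact: (measurable_norm_ge1 _ (L1_measurable lU)).
move=> w /= hw; have [Ue|Ue] := leP (e / 3) `|U w|; first by right.
left; apply: hCk => /= ke; apply: hw.
have -> : (n * n.-1)%:R^-1 * usum X h n w = U w + (n * n.-1)%:R^-1 * usum X k n w + c.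
  have -> : usum X h n w = usum X (fun z => h z - tr M z) n w + usum X k n w + (n * n.-1)%:R * c.
    rewrite -(usum_cst X c n w) -!usumD; congr usum; apply/funext => z.
    by rewrite /k; ring.
  by rewrite /U !mulrDr mulKf ?gt_eqF.
have hc : `|c - \int[(Q \x Q)%E]_z h z| <= e / 3.
  rewrite distrC -EB//; apply: le_trans dM1; exact: E_norm.
rewrite -addrA -[e]e3; apply: (le_trans (ler_normD _ _)); apply: lerD => //.
by apply: (le_trans (ler_normD _ _)); apply: lerD => //; exact: ltW.
Unshelve. all: by end_near. Qed.

End UStatisticLimits.

Section MatrixNorms.
Context (R : realType).

Lemma norm_mulmx_le m n p (A : 'M[R]_(m, n)) (B : 'M[R]_(n, p)) :
  `|A *m B| <= n%:R * (`|A| * `|B|).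
Proof.
apply: norm_mx_le => [|i j]; first by rewrite !mulr_ge0.
rewrite mxE (le_trans (ler_norm_sum _ _ _))//.
rewrite (@le_trans _ _ (\sum_(k < n) `|A| * `|B|))//.
  by apply: ler_sum => k _; rewrite normrM ler_pM// norm_coord_le.
by rewrite sumr_const card_ord -[leLHS]mulr_natl.
Qed.

Lemma norm_mx_le_sum m n (A : 'M[R]_(m, n)) : `|A| <= \sum_i \sum_j `|A i j|.
Proof.
apply: norm_mx_le => [|i j]; first by apply: sumr_ge0 => i _; apply: sumr_ge0.
rewrite (bigD1 i)//= (bigD1 j)//= -addrA lerDl addr_ge0//; first exact: sumr_ge0.
by apply: sumr_ge0 => k _; apply: sumr_ge0.
Qed.

Lemma abs_dotr_le n (u t : 'rV[R]_n) : `|dotr u t| <= n%:R * (`|u| * `|t|).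
Proof.
rewrite dotrE (le_trans (ler_norm_sum _ _ _))//.
rewrite (@le_trans _ _ (\sum_(k < n) `|u| * `|t|))//.
  by apply: ler_sum => k _; rewrite normrM ler_pM// norm_coord_le.
by rewrite sumr_const card_ord -[leLHS]mulr_natl.
Qed.

Lemma abs_cosB_le (x y : R) : `|cos (x + y) - cos x| <= 2 * `|y|.
Proof.
rewrite cosD (_ : _ - cos x = cos x * (cos y - 1) - sin x * sin y); last by ring.
rewrite (le_trans (ler_normB _ _))// !normrM.
have c1 : `|cos x| <= 1 by rewrite ler_norml cos_geN1 cos_le1.
have s1 : `|sin x| <= 1 by rewrite ler_norml sin_geN1 sin_le1.
have hs := abs_sin_le y.
have hc : `|cos y - 1| <= `|y|.
  have [y1|y1] := leP `|y| 1.
    rewrite (le_trans (abs_cosB1_le y))// -[leLHS]real_normK ?num_real// expr2.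
    by rewrite ler_piMr.
  have : `|cos y - 1| <= 2 * `|y / 2|.
    have -> : cos y - 1 = - (2 * sin (y / 2) ^+ 2).
      rewrite {1}(_ : y = y / 2 + y / 2); last by field.
      by rewrite cosD -!expr2 cos2sin2; ring.
    rewrite normrN normrM (@ger0_norm _ 2)// ler_wpM2l// normrX expr2.
    have s2 : `|sin (y / 2)| <= 1 by rewrite ler_norml sin_geN1 sin_le1.
    by apply: (le_trans (ler_piMr _ s2)) => //; exact: abs_sin_le.
  by move=> h; apply: (le_trans h); rewrite normrM (@ger0_norm _ 2^-1)//; lra.
have h1 : `|cos x| * `|cos y - 1| <= 1 * `|y| by rewrite ler_pM.
have h2 : `|sin x| * `|sin y| <= 1 * `|y| by rewrite ler_pM.
by rewrite mulr2n mulrDl; apply: lerD.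
Qed.

End MatrixNorms.

(** * Asymptotic normality from a linearised estimating equation *)

Section MEstimation.
Context d d' (T : measurableType d) (S : measurableType d') (R : realType).
Context (Pr : probability T R) (Q : probability S R).
Variable X : nat -> {RV Pr >-> S}.
Hypothesis iidX : iid Q X.
Variables (r : nat) (h : 'I_r -> S * S -> R) (H : 'I_r -> 'I_r -> S * S -> R).
Variables (L : S * S -> R) (G : S -> R) (g : 'M[R]_r).
Variables (ts : 'rV[R]_r) (that : nat -> {RV Pr >-> 'rV[R]_r}).
Hypothesis mh : forall j, measurable_fun setT (h j).
Hypothesis hC : forall j x y, h j (x, y) = h j (y, x).
Hypothesis mG : measurable_fun setT G.
Hypothesis G2 : L1 Q (fun x => G x ^+ 2).
Hypothesis hG : forall j x y, `|h j (x, y)| <= G x * G y.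
Hypothesis Eh : forall j, \int[(Q \x Q)%E]_z h j z = 0.
Hypothesis lH : forall i j, L1 (Q \x Q)%E (H i j).
Hypothesis HC : forall i j x y, H i j (x, y) = H i j (y, x).
Hypothesis EH : forall i j, \int[(Q \x Q)%E]_z H i j z = 2 * g i j.
Hypothesis lL : L1 (Q \x Q)%E L.
Hypothesis L0 : forall z, 0 <= L z.
Hypothesis gu : g \in unitmx.
Hypothesis gT : g^T = g.
Hypothesis consistent : op1 Pr (fun n w => `|that n w - ts|).
(** The gradient, which vanishes at the estimator, is expanded around ts: h is the gradient kernel,
    H the kernel of second derivatives and L a majorant of the remainder. *)
Hypothesis score : whp Pr (fun n => [set w | forall j,
  `|usum X (h j) n w + \sum_i (that n w - ts) 0 i * usum X (H i j) n w| <=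
  `|that n w - ts| ^+ 2 * usum X L n w]).

Let Z n w : 'rV[R]_r := Num.sqrt n%:R *: (that n w - ts).
Let xi (a : 'rV[R]_r) x : R := - \sum_j a 0 j * marginal Q (h j) x.
(** The linear approximation of Z. The factor 2 of the projected gradient cancels against that of
    the Hessian 2 g. *)
Let Y n w : 'rV[R]_r := - ((Num.sqrt n%:R)^-1 *:
  ((\row_j (\sum_(i < n) marginal Q (h j) (X i w))) *m invmx g)).
Let Sigma : 'M[R]_r :=
  \matrix_(i, j) \int[Q]_x (marginal Q (h i) x * marginal Q (h j) x).
Let V := invmx g *m Sigma *m invmx g.

Let mm j : measurable_fun setT (marginal Q (h j)).
Proof. exact: L1_measurable (L1_marginal (mh j) mG G2 (hG j)). Qed.

Let lm j : L1 Q (marginal Q (h j)).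
Proof. exact: (L1_marginal (mh j) mG G2 (hG j)). Qed.

Let lmm i j : L1 Q (fun x => marginal Q (h i) x * marginal Q (h j) x).
Proof.
by apply: L1_sqM => //; exact: (L1_marginal_sq (mh _) mG G2 (hG _)).
Qed.

Let mxi a : measurable_fun setT (xi a).
Proof.
apply: measurableT_comp => //; apply: measurable_sum => j.
exact: measurable_funM.
Qed.

Let xiE a : \int[Q]_x xi a x = 0.
Proof.
rewrite /xi; under eq_Rintegral do rewrite -mulN1r.
rewrite EZ; last by apply: L1_sum => j _; exact: L1Z.
rewrite E_sum => [|j _]; last exact: L1Z.
rewrite big1 ?mulr0// => j _.
by rewrite EZ// (E_marginal (mh j) mG G2 (hG j) (Eh j)) mulr0.
Qed.

Let xi_sqE a x : xi a x ^+ 2 = \sum_i \sum_j a 0 i * a 0 j *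
  (marginal Q (h i) x * marginal Q (h j) x).
Proof.
rewrite /xi sqrrN expr2 big_distrlr/=; apply: eq_bigr => i _.
by apply: eq_bigr => j _; ring.
Qed.

Let lxi2 a : L1 Q (fun x => xi a x ^+ 2).
Proof.
under eq_fun do rewrite xi_sqE.
by apply: L1_sum => i _; apply: L1_sum => j _; exact: L1Z.
Qed.

Let Exi2 a : \int[Q]_x (xi a x ^+ 2) = quad Sigma a a.
Proof.
under eq_Rintegral do rewrite xi_sqE.
rewrite E_sum => [|i _]; last by apply: L1_sum => j _; exact: L1Z.
rewrite /quad !mxE; under [RHS]eq_bigr do rewrite !mxE mulr_suml.
rewrite [RHS]exchange_big/=; apply: eq_bigr => i _.
rewrite E_sum => [|j _]; last exact: L1Z.
by apply: eq_bigr => j _; rewrite mxE EZ//; ring.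
Qed.

Let gVT : (invmx g)^T = invmx g. Proof. by rewrite trmx_inv gT. Qed.

Let SigmaT : Sigma^T = Sigma.
Proof. by apply/matrixP => i j; rewrite !mxE; apply: eq_Rintegral => x _; rewrite mulrC. Qed.

Let quadV t : quad V t t = quad Sigma (t *m invmx g) (t *m invmx g).
Proof. by rewrite /quad /V trmx_mul gVT !mulmxA. Qed.

Let dotrY n w t : dotr (Y n w) t =
  \sum_(i < n) (Num.sqrt n%:R)^-1 * xi (t *m invmx g) (X i w).
Proof.
rewrite -mulr_sumr /Y -scalerN dotrZl; congr (_ * _).
rewrite /dotr -scaleN1r -scalemxAl mxE -mulmxA.
have -> : invmx g *m t^T = (t *m invmx g)^T by rewrite trmx_mul gVT.
set a := t *m invmx g; rewrite mxE /xi sumrN mulN1r; congr (- _).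
rewrite exchange_big/=; apply: eq_bigr => j _.
by rewrite !mxE mulr_suml; apply: eq_bigr => i _; rewrite mulrC.
Qed.

Let measurable_Z n : measurable_fun setT (Z n).
Proof.
apply: measurable_to_rV => i; rewrite /Z.
under eq_fun do rewrite !mxE.
apply: measurable_funM => //; apply: measurable_funB => //.
by apply: (measurableT_comp (measurable_coord i)); exact: measurable_funPT.
Qed.

(** Every coordinate of Y has a second moment bounded in n, and |y| <= 1 + y^2 turns this into a
    bound of the mean norm. *)
Let tightY : tight1 Pr (fun n w => `|Y n w|).
Proof.
pose F n w := \sum_(k < r) (1 + (\sum_(i < n) (Num.sqrt n%:R)^-1 * xi (ebasis R k *m invmx g) (X i w)) ^+ 2).
have FE n k : L1 Pr (fun w => (\sum_(i < n) (Num.sqrt n%:R)^-1 * xi (ebasis R k *m invmx g) (X i w)) ^+ 2)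
   /\ \int[Pr]_w ((\sum_(i < n) (Num.sqrt n%:R)^-1 * xi (ebasis R k *m invmx g) (X i w)) ^+ 2) <=
      quad Sigma (ebasis R k *m invmx g) (ebasis R k *m invmx g).
  have [l E] := E_sum_sq iidX n (mxi _) (lxi2 (ebasis R k *m invmx g)) (xiE _).
  under eq_fun do rewrite -mulr_sumr exprMn.
  split; first exact: L1Z.
  rewrite EZ// E Exi2 mulrA inv_sqrtn_sqr.
  have q0 : 0 <= quad Sigma (ebasis R k *m invmx g) (ebasis R k *m invmx g).
    by rewrite -Exi2; apply: Rintegral_ge0 => // x _; exact: sqr_ge0.
  by case: n {l E} => [|n]; rewrite ?invr0 ?mul0r// mulVf ?mul1r// pnatr_eq0.
apply: (@tight1_le _ _ _ _ _ F).
  apply: (@tight1_E _ _ _ _ _ (\sum_(k < r) (1 + quad Sigma (ebasis R k *m invmx g) (ebasis R k *m invmx g)))).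
    by move=> n; apply: L1_sum => k _; apply: L1D; [exact: L1_cst|exact: (FE n k).1].
  apply: nearW => n; under eq_Rintegral => w _.
    rewrite ger0_norm; last by apply: sumr_ge0 => k _; rewrite addr_ge0// sqr_ge0.
    over.
  rewrite E_sum => [|k _]; last by apply: L1D; [exact: L1_cst|exact: (FE n k).1].
  apply: ler_sum => k _; rewrite ED; [|exact: L1_cst|exact: (FE n k).1].
  by rewrite E_cst lerD2l; exact: (FE n k).2.
move=> n w; rewrite normr_id ger0_norm; last first.
  by apply: sumr_ge0 => k _; rewrite addr_ge0// sqr_ge0.
apply: (le_trans (norm_mx_le_sum _)); rewrite big_ord1; apply: ler_sum => k _.
rewrite (_ : Y n w ord0 k = dotr (Y n w) (ebasis R k)); last first.
  by rewrite dotrC /dotr -rowE !mxE.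
rewrite dotrY; set y := \sum_(i < n) _.
by have := sqr_ge0 (`|y| - 2^-1); rewrite -[y ^+ 2]real_normK ?num_real//; nra.
Qed.

(** The equation, solved for Z - Y, gives |Z - Y| <= c (e1 + eta |Z|) with e1 and eta negligible. No
    rate is known for Z beforehand, so |Z| is split into |Z - Y| + |Y|: where c eta <= 1/2 the first
    part is absorbed on the left, and tightness of Y takes care of the second. *)
Let ZY : op1 Pr (fun n w => `|Z n w - Y n w|).
Proof.
pose R1 j n w := Num.sqrt n%:R * ((n * n.-1)%:R^-1 *
    (usum X (h j) n w - 2 * n.-1%:R * \sum_(i < n) marginal Q (h j) (X i w))).
pose D i j n w := (n * n.-1)%:R^-1 * usum X (H i j) n w - \int[(Q \x Q)%E]_z H i j z.
pose Lb n w := (n * n.-1)%:R^-1 * usum X L n w.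
have Lb0 n w : 0 <= Lb n w.
  rewrite /Lb mulr_ge0 ?invr_ge0// usum_pairE; exact: sumr_ge0.
have oR1 j : op1 Pr (R1 j) by exact: (op1_hoeffding iidX (mh j) (hC j) mG G2 (hG j) (Eh j)).
have oD i j : op1 Pr (D i j) by exact: (ustat_lln iidX (HC i j) (lH i j)).
have tL : tight1 Pr Lb.
  apply: (@tight1_E _ _ _ _ _ (\int[(Q \x Q)%E]_z L z)).
    by move=> n; apply: L1Z; exact: (L1_usum iidX).
  apply: nearW => n; under eq_Rintegral do rewrite ger0_norm//.
  rewrite EZ; last exact: (L1_usum iidX).
  rewrite (E_usum iidX)// mulrA ler_piMl//; first exact: Rintegral_ge0.
  by have [->|n0] := eqVneq ((n * n.-1)%:R : R) 0; rewrite ?mulr0// mulVf.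
(* The factor r is the cost of a matrix product in the maximum norm; the rest is the norm of the
   inverse of 2 g. *)
pose c : R := r%:R * `|invmx g| / 2.
have c0 : 0 <= c by rewrite /c divr_ge0// mulr_ge0.
pose e1 n w := \sum_j `|R1 j n w|.
have oe1 : op1 Pr e1 by apply: op1_sum => j; apply: op1_norm; exact: oR1.
(* Error of the Hessian: the quadratic remainder, which consistency makes negligible, and the
   deviation of the empirical second derivatives from their means. *)
pose eta n w := `|that n w - ts| * Lb n w + r%:R * \sum_i \sum_j `|D i j n w|.
have eta0 n w : 0 <= eta n w.
  by rewrite addr_ge0// mulr_ge0//; apply: sumr_ge0 => i _; exact: sumr_ge0.
have oeta : op1 Pr eta.
  apply: op1D; first exact: op1_tight.
  by apply: op1Z; apply: op1_sum => i; apply: op1_sum => j; apply: op1_norm; exact: oD.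
have oceta : op1 Pr (fun n w => c * eta n w) by exact: op1Z.
have oB : op1 Pr (fun n w => 2 * (c * e1 n w) + 2 * (c * eta n w * `|Y n w|)).
  by apply: op1D; apply: op1Z; [exact: op1Z|exact: (op1_tight oceta tightY)].
have c20 : 0 < 2^-1 :> R by rewrite invr_gt0.
apply: (op1_le (whpI score (oceta _ c20)) oB).
exists 2%N => // n /= n2 w [sc ce].
rewrite normr_id [leRHS]ger0_norm; last first.
  by rewrite addr_ge0// !mulr_ge0// /e1; exact: sumr_ge0.
rewrite ger0_norm ?mulr_ge0// in ce.
have n0 : 0 < n%:R :> R by rewrite ltr0n ltnW.
have n10 : 0 < n.-1%:R :> R by rewrite ltr0n -subn1 subn_gt0.
have nn0 : 0 < (n * n.-1)%:R :> R by rewrite natrM mulr_gt0.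
have sn0 : 0 < Num.sqrt n%:R :> R by rewrite sqrtr_gt0.
pose de := that n w - ts.
pose Dm : 'M[R]_r := \matrix_(i, j) D i j n w.
pose Rm : 'rV[R]_r := \row_j R1 j n w.
pose rho : 'rV[R]_r := \row_j ((n * n.-1)%:R^-1 *
  (usum X (h j) n w + \sum_i de 0 i * usum X (H i j) n w)).
have rhoL : `|Num.sqrt n%:R *: rho| <= `|Z n w| * (`|de| * Lb n w).
  apply: norm_mx_le => [|i j].
    exact: (mulr_ge0 (normr_ge0 _) (mulr_ge0 (normr_ge0 _) (Lb0 _ _))).
  rewrite !mxE normrM (ger0_norm (ltW sn0)) normrM ger0_norm ?invr_ge0 ?(ltW nn0)//.
  have -> : `|Z n w| = Num.sqrt n%:R * `|de| by rewrite normrZ ger0_norm ?(ltW sn0).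
  by rewrite -mulrA ler_wpM2l ?(ltW sn0)// mulrA -expr2 mulrCA ler_wpM2l ?invr_ge0 ?(ltW nn0)//.
have RmL : `|Rm| <= e1 n w.
  apply: (le_trans (norm_mx_le_sum _)); rewrite big_ord1 /e1.
  by apply: ler_sum => j _; rewrite mxE.
have DmL : `|Dm| <= \sum_i \sum_j `|D i j n w|.
  apply: (le_trans (norm_mx_le_sum _)); apply: ler_sum => i _.
  by apply: ler_sum => j _; rewrite mxE.
have eqn : (Z n w - Y n w) *m (2 *: g) = Num.sqrt n%:R *: rho - Rm - Z n w *m Dm.
  have YgE : Y n w *m (2 *: g) = - (2 / Num.sqrt n%:R) *:
      \row_j \sum_(i < n) marginal Q (h j) (X i w).
    rewrite /Y -scaleN1r -scalemxAr -!scalemxAl -mulmxA mulVmx// mulmx1 !scalerA.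
    by congr (_ *: _); ring.
  rewrite mulmxBl YgE; apply/rowP => j; rewrite !mxE.
  have -> : \sum_j0 Z n w 0 j0 * (2 *: g) j0 j = Num.sqrt n%:R * \sum_i de 0 i * (2 * g i j).
    by rewrite mulr_sumr; apply: eq_bigr => i _; rewrite /Z /de !mxE; ring.
  have -> : \sum_j0 Z n w 0 j0 * Dm j0 j = Num.sqrt n%:R *
      ((n * n.-1)%:R^-1 * (\sum_i de 0 i * usum X (H i j) n w) - \sum_i de 0 i * (2 * g i j)).
    rewrite mulrBr !mulr_sumr -sumrB; apply: eq_bigr => i _; rewrite !mxE /D EH; ring.
  rewrite /R1; set u := usum _ _ _ _; set s := \sum_(i < n) _; set A := \sum_i _; set B := \sum_i _.
  have sE : 2 / Num.sqrt n%:R * s = Num.sqrt n%:R * ((n * n.-1)%:R^-1 * (2 * n.-1%:R * s)).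
    move: sn0; set q := Num.sqrt n%:R => q0.
    have nE : n%:R = q ^+ 2 by rewrite sqr_sqrtr// ltW.
    by rewrite natrM nE; field; rewrite !gt_eqF.
  by rewrite mulNr sE; ring.
have ZYE : Z n w - Y n w = 2^-1 *: ((Num.sqrt n%:R *: rho - Rm - Z n w *m Dm) *m invmx g).
  rewrite -eqn -mulmxA -scalemxAl mulmxV// -scalemxAr mulmx1 scalerA.
  by rewrite mulVf ?scale1r.
have main : `|Z n w - Y n w| <= c * (e1 n w + eta n w * `|Z n w|).
  rewrite ZYE normrZ ger0_norm ?invr_ge0//.
  rewrite (_ : c * _ = 2^-1 * (r%:R * ((e1 n w + eta n w * `|Z n w|) * `|invmx g|))); last first.
    by rewrite /c; ring.
  rewrite ler_wpM2l ?invr_ge0// (le_trans (norm_mulmx_le _ _))// ler_wpM2l// ler_wpM2r//.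
  apply: (le_trans (ler_normB _ _)); apply: (le_trans (lerD (ler_normB _ _) (norm_mulmx_le _ _))).
  have hD : r%:R * (`|Z n w| * `|Dm|) <= r%:R * (`|Z n w| * \sum_i \sum_j `|D i j n w|).
    by rewrite ler_wpM2l// ler_wpM2l.
  rewrite /eta mulrDl; apply: (le_trans (lerD (lerD rhoL RmL) hD)).
  by rewrite le_eqVlt; apply/orP; left; apply/eqP; rewrite /de; ring.
have tri : `|Z n w| <= `|Z n w - Y n w| + `|Y n w|.
  by rewrite -{1}(subrK (Y n w) (Z n w)); exact: ler_normD.
have hce : c * eta n w * `|Z n w| <= c * eta n w * (`|Z n w - Y n w| + `|Y n w|).
  by rewrite ler_wpM2l// mulr_ge0.
have hce2 : c * eta n w * `|Z n w - Y n w| <= 2^-1 * `|Z n w - Y n w|.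
  by rewrite ler_wpM2r.
move: main hce hce2; move: (e1 n w) (eta n w) => e E.
rewrite mulrDr (mulrA c E); move: (c * E) (c * e) => p q.
by rewrite mulrDr; lra.
Qed.

(** The central limit theorem applies to each linear form of Y. As cos is Lipschitz and Z - Y is
    negligible, Z has the same limiting transform; its tightness is inherited from Y. *)
Theorem m_estimation : exists nu : probability 'rV[R]_r R,
  is_normal 0 V nu /\ cvg_in_distribution Pr Z nu.
Proof.
have VT : V^T = V by rewrite /V !trmx_mul gVT SigmaT mulmxA.
have V0 t : 0 <= quad V t t.
  by rewrite quadV -Exi2; apply: Rintegral_ge0 => // x _; exact: sqr_ge0.
have [nu [nuV nuE]] := exists_normal VT V0; exists nu; split => //.
apply: levy_continuity => //.
- move=> x t; rewrite nuE.
  have lim : \int[Pr]_w cos (x + dotr (Y n w) t) @[n --> \oo] --> expR (- quad V t t / 2) * cos x.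
    have := clt_cos (x := x) iidX (mxi (t *m invmx g)) (lxi2 (t *m invmx g)) (xiE (t *m invmx g)).
    rewrite Exi2 -quadV -mulNr.
    rewrite (_ : (fun n => \int[Pr]_w cos (x + dotr (Y n w) t)) = (fun n => \int[Pr]_w
        cos (x + \sum_(i < n) (Num.sqrt n%:R)^-1 * xi (t *m invmx g) (X i w))))//.
    by apply/funext => n; apply: eq_Rintegral => w _; rewrite dotrY.
  have mcosY n : measurable_fun setT (fun w => cos (x + dotr (Y n w) t)).
    apply: (@measurableT_comp _ _ _ _ _ _ (@cos R)).
      by apply: continuous_measurable_fun; exact: continuous_cos.
    apply: measurable_funD => //; under eq_fun do rewrite dotrY.
    apply: measurable_sum => i; apply: measurable_funM => //.
    by apply: (measurableT_comp (mxi _)); exact: measurable_funPT.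
  have mcosZ n : measurable_fun setT (fun w => cos (x + dotr (Z n w) t)).
    apply: (@measurableT_comp _ _ _ _ _ _ (@cos R)).
      by apply: continuous_measurable_fun; exact: continuous_cos.
    by apply: measurable_funD => //; exact: (measurableT_comp (measurable_dotr t)).
  have c1 (z : R) : `|cos z| <= 1 by rewrite ler_norml cos_geN1 cos_le1.
  have diff : \int[Pr]_w (cos (x + dotr (Z n w) t) - cos (x + dotr (Y n w) t)) @[n --> \oo] --> (0 : R).
    apply: (@E_op1 _ _ _ _ _ 2).
    + by move=> n; exact: measurable_funB.
    + move=> n w; apply: (le_trans (ler_normB _ _)).
      by have := c1 (x + dotr (Z n w) t); have := c1 (x + dotr (Y n w) t); lra.
    + apply: (op1_dom (op1Z (2 * (r%:R * `|t|)) ZY)) => n w.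
      rewrite (_ : dotr (Z n w) t = dotr (Y n w) t + dotr (Z n w - Y n w) t); last first.
        by rewrite -dotrDl addrC subrK.
      rewrite addrA (le_trans (abs_cosB_le _ _))// [leRHS]ger0_norm ?mulr_ge0//.
      rewrite -mulrA ler_wpM2l// (le_trans (abs_dotr_le _ _))// -mulrA ler_wpM2l//.
      by rewrite [leRHS]mulrC.
  rewrite (_ : (fun n => _) = (fun n =>
    \int[Pr]_w (cos (x + dotr (Z n w) t) - cos (x + dotr (Y n w) t)) +
    \int[Pr]_w cos (x + dotr (Y n w) t))).
    by rewrite -[X in _ --> X]add0r; exact: cvgD.
  apply/funext => n; rewrite EB ?subrK//; exact: (@L1_bounded _ _ _ _ _ 1).
- have tZ : tight1 Pr (fun n w => `|Z n w|).
    apply: (@tight1_le _ _ _ _ _ (fun n w => `|Z n w - Y n w| + `|Y n w|)).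
      exact: (tight1_add ZY tightY).
    move=> n w; rewrite normr_id [leRHS]ger0_norm ?addr_ge0//.
    by rewrite -{1}(subrK (Y n w) (Z n w)); exact: ler_normD.
  move=> e e0; have [M M0 hM] := tZ e e0; exists M => //.
  apply: filterS hM => n [B [mB ZB] PB]; apply: le_trans PB.
  apply: le_measure; rewrite ?inE//.
    exact: (measurable_preimage (measurable_Z n) (measurable_norm_ge _)).
  by move=> w /= Mw; apply: ZB; rewrite /= normr_id.
Qed.

End MEstimation.

(** * Differential calculus *)

Section DirectionalDerivatives.
Context (R : realType) (V : normedModType R).
Implicit Types (f g : V -> R) (p q u v : V).

Lemma is_derive_line f q u (s : R) : derivable f (q + s *: u) u ->
  is_derive s 1 (fun s => f (q + s *: u)) ('D_u f (q + s *: u)).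
Proof.
move=> df; have E : (fun h : R => h^-1 *: (((fun s => f (q + s *: u)) \o shift s) (h *: 1) - f (q + s *: u)))
  = (fun h => h^-1 *: ((f \o shift (q + s *: u)) (h *: u) - f (q + s *: u))).
  apply/funext => h /=; do 3 congr (_ _); rewrite -[h *: 1]/(h * 1) mulr1 scalerDl.
  by rewrite addrCA.
by split; rewrite /derivable /derive E.
Qed.

Lemma cvg_difference_quotient (c : R) f p u : c != 0 -> derivable f p u ->
  (c * n.+1%:R^-1)^-1 * (f (p + (c * n.+1%:R^-1) *: u) - f p) @[n --> \oo] --> 'D_u f p.
Proof.
move=> c0 df.
pose F (h : R) := h^-1 *: ((f \o shift p) (h *: u) - f p).
have cF : F h @[h --> 0^'] --> 'D_u f p by exact: df.
have ch : c * n.+1%:R^-1 @[n --> \oo] --> (0 : R).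
  by rewrite -[X in _ --> X](mulr0 c); apply: cvgMr; exact: cvg_harmonic.
have /cvgr_dnbhsP/(_ (fun n => c * n.+1%:R^-1)) := cF.
have h : (forall n, c * n.+1%:R^-1 != 0) /\ c * n.+1%:R^-1 @[n --> \oo] --> (0 : R).
  by split => // n; rewrite mulf_neq0// invr_neq0// pnatr_eq0.
move=> /(_ h); rewrite (_ : (fun n => F _) = (fun n =>
  (c * n.+1%:R^-1)^-1 * (f (p + (c * n.+1%:R^-1) *: u) - f p)))//.
by apply/funext => n; rewrite /F/= [_ + p]addrC.
Qed.

(** Derivatives as limits along one fixed sequence: such limits preserve measurability and
    inequalities, and uniqueness of the limit identifies derivatives obtained in different ways. *)
Lemma cvg_firstdiff f p u : derivable f p u ->
  n.+1%:R * (f (p + n.+1%:R^-1 *: u) - f p) @[n --> \oo] --> 'D_u f p.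
Proof.
move=> /(cvg_difference_quotient (oner_neq0 R)).
rewrite (_ : (fun n => _) = (fun n => n.+1%:R * (f (p + n.+1%:R^-1 *: u) - f p)))//.
by apply/funext => n; rewrite mul1r invrK.
Qed.

Lemma cvg_shrink p u : p + n.+1%:R^-1 *: u @[n --> \oo] --> p.
Proof.
rewrite -[X in _ --> X]addr0 -[X in _ --> _ + X](scale0r u).
by apply: cvgD; [exact: cvg_cst|apply: cvgZr_tmp; exact: cvg_harmonic].
Qed.

Lemma local_min_derive0 f p u : derivable f p u ->
  (\forall q \near p, f p <= f q) -> 'D_u f p = 0.
Proof.
move=> df fp.
have near_p (c : R) : \forall n \near \oo, f p <= f (p + (c * n.+1%:R^-1) *: u).
  have h : p + (c * n.+1%:R^-1) *: u @[n --> \oo] --> p.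
    rewrite -[X in _ --> X]addr0 -[X in _ --> _ + X](scale0r u).
    apply: cvgD; first exact: cvg_cst.
    apply: cvgZr_tmp; rewrite -[X in _ --> X](mulr0 c); apply: cvgMr.
    exact: cvg_harmonic.
  by have := h _ fp.
have n1 : (- 1 : R) != 0 by rewrite oppr_eq0 oner_eq0.
apply/eqP; rewrite eq_le; apply/andP; split.
- apply: (cvgr_to_le (cvg_difference_quotient n1 df)).
  apply: filterS (near_p (- 1)) => n hn.
  by rewrite mulN1r invrN invrK mulNr oppr_le0 mulr_ge0// subr_ge0 -mulN1r.
- apply: (cvgr_to_ge (cvg_difference_quotient (oner_neq0 R) df)).
  apply: filterS (near_p 1) => n hn.
  by rewrite mul1r invrK mulr_ge0// subr_ge0 -(mul1r n.+1%:R^-1).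
Qed.

Lemma differentiable_expansion f p (e : R) : 0 < e -> differentiable f p ->
  exists2 dl, 0 < dl & forall w, `|w| < dl ->
    `|f (p + w) - f p - 'd f p w| <= e * `|w|.
Proof.
move=> e0 /diff_locallyP[_ /eqaddoP/(_ _ e0)/nbhs_ballP[dl /= dl0 h]].
exists dl => // w wdl; have := h w; rewrite -ball_normE /ball_/= sub0r normrN => /(_ wdl).
by rewrite /= -[X in `|X|]/(f (w + p) - (f p + 'd f p w)) opprD addrA [w + p]addrC.
Qed.

Lemma differentiable_ext f g p : {near p, f =1 g} -> differentiable f p ->
  differentiable g p.
Proof.
move=> fg df; have fgp : f p = g p by exact: nbhs_singleton fg.
have [cd /eqaddoP Ef] := (diff_locallyP _ _).1 df.
have E : g \o shift p = cst (g p) + 'd f p +o_ 0 id.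
  apply/eqaddoP => e e0; have := Ef e e0.
  have : \forall h \near 0, f (h + p) = g (h + p).
    have fg' : nbhs (0 + p) (fun x => f x = g x) by rewrite add0r; exact: fg.
    have cs : h + p @[h --> 0] --> 0 + p by apply: cvgD; [exact: cvg_id|exact: cvg_cst].
    exact: cs _ fg'.
  by apply: filterS2 => h /= fgh; rewrite -[X in `|X|]/(f (h + p) - (f p + _)) fgp fgh.
have dE := diff_unique cd E.
by apply/diff_locallyP; rewrite dE.
Qed.

(** The mixed second difference. Being symmetric in u and v, it has both iterated derivatives as its
    limit, which proves Schwarz's theorem; it is also an inner product of difference quotients for a
    reproducing kernel. *)
Definition secdiff f p u v n : R := n.+1%:R ^+ 2 *
  (f (p + n.+1%:R^-1 *: u + n.+1%:R^-1 *: v) - f (p + n.+1%:R^-1 *: u)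
   - f (p + n.+1%:R^-1 *: v) + f p).

Lemma secdiffC f p u v n : secdiff f p u v n = secdiff f p v u n.
Proof. by rewrite /secdiff; congr (_ * _); rewrite [p + _ *: v + _]addrAC; ring. Qed.

(** Mean value theorem along u, applied to the increment [phi] of f in the direction v. The
    increment of the derivative along u which appears is then expanded to first order at p, the only
    point where that derivative is differentiated. *)
Lemma cvg_secdiff f p u v : (\forall q \near p, differentiable f q) ->
  differentiable ('D_u f) p -> secdiff f p u v n @[n --> \oo] --> 'D_v ('D_u f) p.
Proof.
move=> /nbhs_ballP[r1 /= r10 hf] dDu.
rewrite (deriveE _ dDu); set l := 'd ('D_u f) p.
apply/cvgrPdist_le => e e0.
pose c := `|u| + `|v|; have c0 : 0 <= c by rewrite addr_ge0.
have e10 : 0 < e / (2 * (c + 1)) by rewrite divr_gt0// mulr_gt0// ltr_wpDl.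
have [r2 r20 hl] := differentiable_expansion e10 dDu.
have rr0 : 0 < Num.min r1 r2 by rewrite lt_min r10.
near=> n.
have hc : n.+1%:R^-1 * c < Num.min r1 r2.
  near: n; have : n.+1%:R^-1 * c @[n --> \oo] --> (0 : R).
    by rewrite -[X in _ --> X](mul0r c); apply: cvgMl; exact: cvg_harmonic.
  by move=> /cvgr_lt; apply.
pose h : R := n.+1%:R^-1; rewrite -/h in hc.
have h0 : 0 < h by rewrite invr_gt0.
have small s t : 0 <= s <= h -> 0 <= t <= h -> `|s *: u + t *: v| <= h * c.
  move=> /andP[s0 s1] /andP[t0 t1]; apply: (le_trans (ler_normD _ _)).
  by rewrite !normrZ !ger0_norm// /c mulrDr lerD// ler_wpM2r.
have ball_p w : `|w| <= h * c -> ball p r1 (p + w).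
  move=> wc; rewrite -ball_normE /ball_/= opprD addNKr normrN.
  by apply: (le_lt_trans wc); move: hc; rewrite lt_min => /andP[].
pose phi s := f (p + h *: v + s *: u) - f (p + s *: u).
pose dphi s := 'D_u f (p + h *: v + s *: u) - 'D_u f (p + s *: u).
have dphiE s : 0 <= s <= h -> is_derive s 1 phi (dphi s).
  move=> sh; apply: is_deriveB.
    apply: is_derive_line; apply: diff_derivable; apply: hf.
    rewrite -addrA [h *: v + _]addrC; apply: ball_p; apply: small => //.
    by rewrite lexx ltW.
  apply: is_derive_line; apply: diff_derivable; apply: hf; apply: ball_p.
  have := small s 0 sh; rewrite scale0r addr0; apply.
  by rewrite lexx ltW.
have [||xi] := MVT h0 (f := phi) (df := dphi).
- by move=> s; rewrite in_itv/= => /andP[s0 s1]; apply: dphiE; rewrite !ltW.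
- apply: derivable_within_continuous => s; rewrite in_itv/= => sh.
  by have [] := dphiE s sh.
rewrite in_itv/= => /andP[xi0 xih]; rewrite subr0 /dphi => E.
have xih' : 0 <= xi <= h by rewrite !ltW.
have hh : 0 <= h <= h by rewrite lexx ltW.
have oo : 0 <= (0 : R) <= h by rewrite lexx ltW.
have {E} -> : secdiff f p u v n = h^-1 * dphi xi.
  rewrite /secdiff -/h (_ : n.+1%:R = h^-1); last by rewrite /h invrK.
  rewrite expr2 -mulrA; congr (_ * _).
  rewrite [dphi _](_ : _ = h^-1 * (phi h - phi 0)); last first.
    by rewrite E mulrCA mulVf ?mulr1 ?gt_eqF.
  rewrite /phi !scale0r !addr0 [p + h *: v + _]addrAC; congr (_ * _); ring.
have l1 := hl (h *: v + xi *: u); have l2 := hl (xi *: u).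
have s1 : `|h *: v + xi *: u| <= h * c by rewrite addrC; exact: small.
have s2 : `|xi *: u| <= h * c by have := small xi 0 xih' oo; rewrite scale0r addr0.
have r2c : h * c < r2 by move: hc; rewrite lt_min => /andP[].
have {l1} l1 := l1 (le_lt_trans s1 r2c); have {l2} l2 := l2 (le_lt_trans s2 r2c).
have E2 : l v - h^-1 * dphi xi = h^-1 *
    (('D_u f (p + xi *: u) - 'D_u f p - l (xi *: u)) -
     ('D_u f (p + (h *: v + xi *: u)) - 'D_u f p - l (h *: v + xi *: u))).
  have -> : l (h *: v + xi *: u) = h * l v + l (xi *: u) by rewrite linearD linearZ.
  rewrite /dphi -[p + h *: v + _]addrA.
  by field; rewrite gt_eqF.
rewrite E2 normrM ger0_norm ?invr_ge0 ?(ltW h0)// ler_pdivrMl//.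
apply: (le_trans (ler_normB _ _)); apply: (le_trans (lerD l2 l1)).
rewrite -mulrDr; apply: (@le_trans _ _ (e / (2 * (c + 1)) * (2 * (h * c)))).
  by rewrite ler_wpM2l ?(ltW e10)//; lra.
rewrite (_ : e / _ * _ = h * (e * (c / (c + 1)))); last by field; lra.
rewrite ler_wpM2l ?(ltW h0)// ler_piMr ?(ltW e0)// ler_pdivrMr ?ltr_wpDl// mul1r.
by rewrite lerDl.
Unshelve. all: by end_near. Qed.

Lemma schwarz f p u v : (\forall q \near p, differentiable f q) ->
  differentiable ('D_u f) p -> differentiable ('D_v f) p ->
  'D_v ('D_u f) p = 'D_u ('D_v f) p.
Proof.
move=> df du dv; have := cvg_secdiff (v := v) df du.
rewrite (_ : secdiff f p u v = secdiff f p v u); last by apply/funext => n; exact: secdiffC.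
by move=> /cvg_unique; apply => //; exact: cvg_secdiff.
Qed.

End DirectionalDerivatives.

Section Taylor.
Context (R : realType) (r : nat).
Implicit Types (f : 'rV[R]_r -> R) (t dl : 'rV[R]_r).

Lemma derive_row f t dl : differentiable f t ->
  'D_dl f t = \sum_i dl 0 i * 'D_(ebasis R i) f t.
Proof.
move=> df; rewrite deriveE// [in LHS](row_sum_delta dl) linear_sum/=.
by apply: eq_bigr => i _; rewrite linearZ/= deriveE.
Qed.

Lemma sum_coord_le (dl : 'rV[R]_r) (a : 'I_r -> R) M : (forall i, `|a i| <= M) ->
  `|\sum_i dl 0 i * a i| <= r%:R * (`|dl| * M).
Proof.
move=> aM; apply: (le_trans (ler_norm_sum _ _ _)).
rewrite (@le_trans _ _ (\sum_(k < r) `|dl| * M))//.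
  by apply: ler_sum => k _; rewrite normrM ler_pM// norm_coord_le.
by rewrite sumr_const card_ord -[leLHS]mulr_natl.
Qed.

Variables (ts : 'rV[R]_r) (rho : R).

Lemma ball_line dl s : `|dl| < rho -> 0 <= s <= 1 -> ball ts rho (ts + s *: dl).
Proof.
move=> dr /andP[s0 s1]; rewrite -ball_normE /ball_/= opprD addNKr normrN normrZ.
by rewrite ger0_norm// (le_lt_trans _ dr)// ler_piMl.
Qed.

Lemma mean_value_line f dl : `|dl| < rho ->
  (forall t, ball ts rho t -> differentiable f t) ->
  exists2 s : R, 0 <= s <= 1 & f (ts + dl) - f ts =
    \sum_i dl 0 i * 'D_(ebasis R i) f (ts + s *: dl).
Proof.
move=> dr df.
have D (s : R) : 0 <= s <= 1 -> is_derive s 1 (fun s => f (ts + s *: dl)) ('D_dl f (ts + s *: dl)).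
  by move=> s01; apply: is_derive_line; apply: diff_derivable; apply: df; exact: ball_line.
have [||s] := MVT (@ltr01 R) (f := fun s => f (ts + s *: dl)) (df := fun s => 'D_dl f (ts + s *: dl)).
- by move=> s; rewrite in_itv/= => /andP[s0 s1]; apply: D; rewrite !ltW.
- apply: derivable_within_continuous => s; rewrite in_itv/= => s01.
  by have [] := D s s01.
rewrite in_itv/= => /andP[s0 s1]; rewrite scale1r scale0r addr0 subr0 mulr1 => ->.
have s01 : 0 <= s <= 1 by rewrite !ltW.
by exists s => //; rewrite derive_row//; apply: df; exact: ball_line.
Qed.

Lemma taylor0 f dl M : `|dl| < rho ->
  (forall t, ball ts rho t -> differentiable f t) ->
  (forall t i, ball ts rho t -> `|'D_(ebasis R i) f t| <= M) ->
  `|f (ts + dl) - f ts| <= r%:R * (`|dl| * M).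
Proof.
move=> dr df dM; have [s s01 ->] := mean_value_line dr df.
by apply: sum_coord_le => i; apply: dM; exact: ball_line.
Qed.

Lemma taylor1 f dl M : `|dl| < rho ->
  (forall t, ball ts rho t -> differentiable f t) ->
  (forall t i, ball ts rho t -> differentiable ('D_(ebasis R i) f) t) ->
  (forall t i j, ball ts rho t -> `|'D_(ebasis R j) ('D_(ebasis R i) f) t| <= M) ->
  `|f (ts + dl) - f ts - \sum_i dl 0 i * 'D_(ebasis R i) f ts| <=
    r%:R ^+ 2 * (`|dl| ^+ 2 * M).
Proof.
move=> dr df ddf dM; have [s s01 ->] := mean_value_line dr df.
rewrite -sumrB; under eq_bigr do rewrite -mulrBr.
apply: (@le_trans _ _ (r%:R * (`|dl| * (r%:R * (`|dl| * M))))); last first.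
  by rewrite le_eqVlt; apply/orP; left; apply/eqP; ring.
apply: sum_coord_le => i; have [s0 s1] := andP s01.
have sd : `|s *: dl| <= `|dl| by rewrite normrZ ger0_norm// ler_piMl.
apply: (@le_trans _ _ (r%:R * (`|s *: dl| * M))).
  apply: (@taylor0 ('D_(ebasis R i) f) (s *: dl) M (le_lt_trans sd dr)) => t tb; first exact: ddf.
  by move=> j; exact: dM.
rewrite ler_wpM2l// ler_wpM2r//.
by apply: le_trans (dM ts i i _) => //; apply: ballxx; exact: le_lt_trans dr.
Qed.

End Taylor.

Section DerivativeNorms.
Context (R : realType) (V W : normedModType R) (I : finType) (e : I -> V).
Implicit Types (f g : V -> W) (A : set V).

Lemma dnorm_ge0 k f t : 0 <= dnorm e k f t.
Proof. by elim: k f => [|k IH] f //=; apply: sumr_ge0. Qed.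

Lemma dnorm_derive_le k f t i : dnorm e k (fun s => 'D_(e i) f s) t <= dnorm e k.+1 f t.
Proof.
rewrite /= (bigD1 i)//= lerDl; apply: sumr_ge0 => j _; exact: dnorm_ge0.
Qed.

End DerivativeNorms.

(** * Kernels depending smoothly on a parameter *)

Section DerivativeSums.
Context (R : realType) (V : normedModType R).

Lemma is_derive_prod (f g : V -> R) x v df dg :
  is_derive x v f df -> is_derive x v g dg ->
  is_derive x v (fun t => f t * g t) (f x * dg + g x * df).
Proof. by move=> hf hg; have := is_deriveM hf hg. Qed.

Lemma is_derive_scale (c : R) (f : V -> R) x v df :
  is_derive x v f df -> is_derive x v (fun t => c * f t) (c * df).
Proof. by move=> hf; have := is_deriveZ c hf. Qed.

Lemma is_derive_add (f g : V -> R) x v df dg :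
  is_derive x v f df -> is_derive x v g dg ->
  is_derive x v (fun t => f t + g t) (df + dg).
Proof. by move=> hf hg; have := is_deriveD hf hg. Qed.

Lemma is_derive_bigsum (I : Type) (s : seq I) (P : pred I) (f : I -> V -> R) (df : I -> R) x v :
  (forall i, P i -> is_derive x v (f i) (df i)) ->
  is_derive x v (fun t => \sum_(i <- s | P i) f i t) (\sum_(i <- s | P i) df i).
Proof.
move=> hf; elim: s => [|i s IH].
  rewrite big_nil (_ : (fun _ => _) = cst 0); first exact: is_derive_cst.
  by apply/funext => t; rewrite big_nil.
case Pi : (P i); rewrite big_cons Pi.
  rewrite (_ : (fun _ => _) = (fun t => f i t + \sum_(i <- s | P i) f i t)).
    by apply: is_derive_add => //; exact: hf.
  by apply/funext => t; rewrite big_cons Pi.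
rewrite (_ : (fun _ => _) = (fun t => \sum_(i <- s | P i) f i t))//.
by apply/funext => t; rewrite big_cons Pi.
Qed.

End DerivativeSums.

(** * Derivatives read off from a Taylor expansion *)

Section Expansion.
Context (R : realType) (r : nat).
Variables (Phi : 'rV[R]_r -> R) (ts b : 'rV[R]_r) (M : 'M[R]_r) (c rho : R).
Hypothesis rho0 : 0 < rho.
Hypothesis expansion : forall dl, `|dl| < rho ->
  `|Phi (ts + dl) - Phi ts - dotr dl b - 2^-1 * quad M dl dl| <= c * `|dl| ^+ 3.

Let near_small (u : 'rV[R]_r) : \forall n \near \oo, `|n.+1%:R^-1 *: u| < rho.
Proof.
have h : n.+1%:R^-1 * `|u| @[n --> \oo] --> (0 : R).
  by rewrite -[X in _ --> X](mul0r `|u|); apply: cvgMl; exact: cvg_harmonic.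
have /cvgr_lt/(_ _ rho0) := h; apply: filterS => n.
by rewrite normrZ ger0_norm.
Qed.

(** The quadratic and cubic terms are divided by 1 / (n + 1) only once and vanish. Compared with the
    limit of the same quotients when [Phi] is differentiable, this identifies b with the
    gradient. *)
Lemma cvg_expansion_first u : n.+1%:R * (Phi (ts + n.+1%:R^-1 *: u) - Phi ts) @[n --> \oo]
  --> dotr u b.
Proof.
apply/cvgrPdist_le => e e0.
pose C := `|2^-1 * quad M u u| + `|c * `|u| ^+ 3|.
have C0 : 0 <= C by rewrite addr_ge0.
have h : n.+1%:R^-1 * C @[n --> \oo] --> (0 : R).
  by rewrite -[X in _ --> X](mul0r C); apply: cvgMl; exact: cvg_harmonic.
have /cvgr_lt/(_ _ e0) := h; have := near_small u; apply: filterS2 => n hn Cn.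
apply: ltW; apply: le_lt_trans Cn; have E := expansion hn.
have h0 : 0 < n.+1%:R^-1 :> R by [].
have h1 : n.+1%:R^-1 <= 1 :> R by rewrite invf_le1// ler1n.
have hE : n.+1%:R = n.+1%:R^-1^-1 :> R by rewrite invrK.
rewrite [X in `|_ - X * _|]hE; move: h0 h1 E {hn hE}; move: (n.+1%:R^-1) => h' h0 h1.
rewrite dotrZl quadZl quadZr normrZ (ger0_norm (ltW h0)).
set P := Phi _ - Phi _; set a := dotr u b; set q := quad M u u => E.
have -> : a - h'^-1 * P = - (h'^-1 * (P - h' * a - 2^-1 * (h' * (h' * q)))) - h' * (2^-1 * q).
  by field; rewrite gt_eqF.
rewrite (le_trans (ler_normB _ _))// normrN !normrM (@ger0_norm _ h'^-1) ?invr_ge0 ?(ltW h0)//.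
rewrite (ger0_norm (ltW h0)) /C mulrDr addrC normrM; apply: lerD => //.
rewrite ler_pdivrMl//; apply: (le_trans E).
have -> : c * (h' * `|u|) ^+ 3 = h' * (h' * (h' * (c * `|u| ^+ 3))) by ring.
rewrite !ler_wpM2l ?(ltW h0)//.
apply: (@le_trans _ _ (h' * `|c * `|u| ^+ 3|)); first by rewrite ler_wpM2l ?(ltW h0)// ler_norm.
by rewrite ler_piMl.
Qed.

(** Linear terms cancel in the mixed difference and cubic ones vanish. Only the symmetric part of M
    is recovered, the expansion seeing M through its quadratic form. *)
Lemma cvg_expansion_second u v : secdiff Phi ts u v n @[n --> \oo] -->
  2^-1 * (quad M u v + quad M v u).
Proof.
apply/cvgrPdist_le => e e0.
pose C := `|c * `|u + v| ^+ 3| + `|c * `|u| ^+ 3| + `|c * `|v| ^+ 3|.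
have h : n.+1%:R^-1 * C @[n --> \oo] --> (0 : R).
  by rewrite -[X in _ --> X](mul0r C); apply: cvgMl; exact: cvg_harmonic.
have {}h : \forall n \near \oo, n.+1%:R^-1 * C < e by have /cvgr_lt/(_ _ e0) := h.
apply: filterS2 h (filterI (near_small (u + v)) (filterI (near_small u) (near_small v))).
move=> n Cn [huv [hu hv]].
apply: ltW; apply: le_lt_trans Cn.
have h0 : 0 < n.+1%:R^-1 :> R by [].
have hE : n.+1%:R ^+ 2 = n.+1%:R^-1 ^- 2 :> R by rewrite exprVn invrK.
rewrite /secdiff [X in `|_ - X * _|]hE.
move: (expansion huv) (expansion hu) (expansion hv).
rewrite scalerDr [in ts + (_ + _)]addrA -scalerDr; move: h0 {hu hv huv hE}; move: (n.+1%:R^-1) => h' h0.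
have key w P : `|P - h' * dotr w b - 2^-1 * (h' * (h' * quad M w w))| <= c * (h' * `|w|) ^+ 3 ->
    `|h'^-2 * (P - h' * dotr w b - 2^-1 * (h' * (h' * quad M w w)))| <= h' * `|c * `|w| ^+ 3|.
  rewrite normrM ger0_norm ?invr_ge0 ?exprn_ge0 ?(ltW h0)// ler_pdivrMl ?exprn_gt0// => E.
  apply: (le_trans E); rewrite (_ : c * _ = h' ^+ 2 * (h' * (c * `|w| ^+ 3))); last by ring.
  by rewrite !ler_wpM2l ?exprn_ge0 ?(ltW h0)// ler_norm.
rewrite !dotrZl !quadZl !quadZr !normrZ (ger0_norm (ltW h0)).
move=> /key E1 /key E2 /key E3.
rewrite !dotrDl !quadDl !quadDr in E1.
set P0 := Phi ts in E1 E2 E3 *.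
set P1 := Phi (ts + _ + _) in E1 *; set P2 := Phi (ts + h' *: u) in E2 *.
set P3 := Phi (ts + h' *: v) in E3 *.
move: E1 E2 E3; set a1 := h'^-2 * _; set a2 := h'^-2 * _; set a3 := h'^-2 * _ => E1 E2 E3.
rewrite [X in `|X|](_ : _ = - a1 + a2 + a3); last first.
  by rewrite /a1 /a2 /a3; field; rewrite gt_eqF.
rewrite (le_trans (ler_normD _ _))// /C mulrDr; apply: lerD => //.
by rewrite (le_trans (ler_normD _ _))// mulrDr normrN; apply: lerD.
Qed.

End Expansion.

(** * Kernels bilinear in smooth features *)

Section SmoothKernel.
Context d d' (T : measurableType d) (S : measurableType d') (R : realType).
Context (Pr : probability T R) (Q : probability S R).
Variable X : nat -> {RV Pr >-> S}.
Hypothesis iidX : iid Q X.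
Variables (r : nat) (A : finType) (ts : 'rV[R]_r) (rho : R).
Variables (psi : A -> 'rV[R]_r -> S -> R) (KK : A -> A -> S * S -> R).
Variables (F G : S -> R) (C : R).
Hypothesis rho0 : 0 < rho.
Hypothesis KKb : forall a b z, `|KK a b z| <= C.
Hypothesis mKK : forall a b, measurable_fun setT (KK a b).
Hypothesis KKC : forall a b x y, KK a b (x, y) = KK b a (y, x).
Hypothesis mpsi : forall a t, ball ts rho t -> measurable_fun setT (psi a t).
Hypothesis ndpsi : forall a x, ndiff (@ebasis R r) 3 (ball ts rho) (psi a ^~ x).
Hypothesis dn01 : forall a x t, ball ts rho t ->
  dnorm (@ebasis R r) 0 (psi a ^~ x) t + dnorm (@ebasis R r) 1 (psi a ^~ x) t <= F x.
Hypothesis dn23 : forall a x t, ball ts rho t ->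
  dnorm (@ebasis R r) 2 (psi a ^~ x) t + dnorm (@ebasis R r) 3 (psi a ^~ x) t <= G x.
Hypothesis mF : measurable_fun setT F.
Hypothesis F2 : L1 Q (fun x => F x ^+ 2).
Hypothesis lG : L1 Q G.

Definition skernel t (z : S * S) : R :=
  \sum_a \sum_b KK a b z * (psi a t z.1 * psi b t z.2).

Let e i := ebasis R i : 'rV[R]_r.
Let psi1 i a t x := 'D_(e i) (psi a ^~ x) t.
Let psi2 i j a t x := 'D_(e i) ('D_(e j) (psi a ^~ x)) t.

Definition skernel1 j t (z : S * S) : R :=
  \sum_a \sum_b KK a b z * (psi1 j a t z.1 * psi b t z.2 + psi a t z.1 * psi1 j b t z.2).

Definition skernel2 i j (z : S * S) : R :=
  \sum_a \sum_b KK a b z *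
    (psi2 i j a ts z.1 * psi b ts z.2 + psi1 j a ts z.1 * psi1 i b ts z.2 +
     (psi1 i a ts z.1 * psi1 j b ts z.2 + psi a ts z.1 * psi2 i j b ts z.2)).

(** There are #|A|^2 pairs of features with coefficients bounded by C. Each of the two products in
    [skernel1] leaves 2 G F + F G, one with x and y exchanged, hence the 3; r^2 comes from expanding
    in r coordinates. *)
Definition skernelL (z : S * S) : R :=
  #|A|%:R ^+ 2 * (C * (3 * r%:R ^+ 2 * (G z.1 * F z.2 + F z.1 * G z.2))).

Let B0 : ball ts rho ts. Proof. exact: ballxx. Qed.

Hypothesis F0 : forall x, 0 <= F x.
Hypothesis G0 : forall x, 0 <= G x.
Hypothesis C0 : 0 <= C.

Let psiF a t x : ball ts rho t -> `|psi a t x| <= F x.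
Proof. by move=> bt; apply: le_trans (dn01 a x bt); rewrite lerDl dnorm_ge0. Qed.

Let psi1F i a t x : ball ts rho t -> `|psi1 i a t x| <= F x.
Proof.
move=> bt; apply: le_trans (dn01 a x bt).
apply: (le_trans (dnorm_derive_le (@ebasis R r) 0 (psi a ^~ x) t i)).
by rewrite lerDr dnorm_ge0.
Qed.

Let psi2G i j a t x : ball ts rho t -> `|psi2 i j a t x| <= G x.
Proof.
move=> bt; apply: le_trans (dn23 a x bt).
apply: (le_trans (dnorm_derive_le (@ebasis R r) 0 _ t i)).
apply: (le_trans (dnorm_derive_le (@ebasis R r) 1 _ t j)).
by rewrite lerDl dnorm_ge0.
Qed.

Let psi3G i j k a t x : ball ts rho t ->
  `|'D_(e k) ('D_(e i) ('D_(e j) (psi a ^~ x))) t| <= G x.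
Proof.
move=> bt; apply: le_trans (dn23 a x bt).
apply: (le_trans (dnorm_derive_le (@ebasis R r) 0 _ t k)).
apply: (le_trans (dnorm_derive_le (@ebasis R r) 1 _ t i)).
apply: (le_trans (dnorm_derive_le (@ebasis R r) 2 _ t j)).
by rewrite lerDr dnorm_ge0.
Qed.

Let dpsi a x t : ball ts rho t -> differentiable (psi a ^~ x) t.
Proof. by have [h _] := ndpsi a x; exact: h. Qed.

Let dpsi1 i a x t : ball ts rho t -> differentiable ('D_(e i) (psi a ^~ x)) t.
Proof. by have [_ /(_ i)[h _]] := ndpsi a x; exact: h. Qed.

Let dpsi2 i j a x t : ball ts rho t ->
  differentiable ('D_(e i) ('D_(e j) (psi a ^~ x))) t.
Proof. by have [_ /(_ j)[_ /(_ i)[h _]]] := ndpsi a x; exact: h. Qed.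

Let near_ball t : ball ts rho t -> \forall q \near t, ball ts rho q.
Proof.
move=> bt; apply: (open_nbhs_nbhs (A := ball ts rho)); split => //.
exact: ball_open.
Qed.

Let psi2C i j a x : psi2 i j a ts x = psi2 j i a ts x.
Proof.
apply: schwarz; [|exact: dpsi1|exact: dpsi1].
by apply: filterS (near_ball B0) => q; exact: dpsi.
Qed.

Let taylor_psi a dl x : `|dl| < rho ->
  `|psi a (ts + dl) x - psi a ts x| <= r%:R * `|dl| * F x /\
  `|psi a (ts + dl) x - psi a ts x - \sum_i dl 0 i * psi1 i a ts x| <=
    (r%:R * `|dl|) ^+ 2 * G x.
Proof.
move=> dr; split; first rewrite -mulrA.
  apply: (taylor0 (f := psi a ^~ x) dr) => t; first exact: dpsi.
  by move=> i bt; exact: psi1F.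
rewrite exprMn -mulrA; apply: (taylor1 (f := psi a ^~ x) dr) => t; first exact: dpsi.
  by move=> i; exact: dpsi1.
by move=> i j bt; exact: psi2G.
Qed.

Let taylor_psi1 j a dl x : `|dl| < rho ->
  `|psi1 j a (ts + dl) x - psi1 j a ts x| <= r%:R * `|dl| * G x /\
  `|psi1 j a (ts + dl) x - psi1 j a ts x - \sum_i dl 0 i * psi2 i j a ts x| <=
    (r%:R * `|dl|) ^+ 2 * G x.
Proof.
move=> dr; split; first rewrite -mulrA.
  apply: (taylor0 (f := psi1 j a ^~ x) dr) => t; first exact: dpsi1.
  by move=> i bt; exact: psi2G.
rewrite exprMn -mulrA; apply: (taylor1 (f := psi1 j a ^~ x) dr) => t; first exact: dpsi1.
  by move=> i; exact: dpsi2.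
by move=> i k bt; exact: psi3G.
Qed.

Lemma is_derive_skernel t u z : ball ts rho t ->
  is_derive t u (skernel ^~ z) (\sum_j u 0 j * skernel1 j t z).
Proof.
move=> bt.
have dp a x : is_derive t u (psi a ^~ x) (\sum_j u 0 j * psi1 j a t x).
  split; first by apply: diff_derivable; exact: dpsi.
  by rewrite derive_row//; exact: dpsi.
have -> : \sum_j u 0 j * skernel1 j t z = \sum_a \sum_b KK a b z *
    (psi a t z.1 * (\sum_j u 0 j * psi1 j b t z.2) +
     psi b t z.2 * (\sum_j u 0 j * psi1 j a t z.1)).
  rewrite /skernel1; under eq_bigr do rewrite mulr_sumr.
  rewrite exchange_big/=; apply: eq_bigr => a _.
  under eq_bigr do rewrite mulr_sumr; rewrite exchange_big/=; apply: eq_bigr => b _.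
  rewrite !mulr_sumr -big_split mulr_sumr/=; apply: eq_bigr => j _; ring.
apply: is_derive_bigsum => a _; apply: is_derive_bigsum => b _.
apply: is_derive_scale; exact: is_derive_prod.
Qed.

Let sum_KK_le (f : A -> A -> R) M z : (forall a b, `|f a b| <= M) ->
  `|\sum_a \sum_b KK a b z * f a b| <= #|A|%:R ^+ 2 * (C * M).
Proof.
move=> fM; apply: (le_trans (ler_norm_sum _ _ _)).
rewrite (@le_trans _ _ (\sum_(a in A) \sum_(b in A) C * M))//.
  apply: ler_sum => a _; apply: (le_trans (ler_norm_sum _ _ _)).
  by apply: ler_sum => b _; rewrite normrM ler_pM.
by rewrite !sumr_const -mulrnA -[leLHS]mulr_natl natrM expr2.
Qed.

(** In the application a is a first derivative [psi1], with x1 = G and x2 = F, and b is a feature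
    [psi], with y1 = F and y2 = G. The increment of b is bounded through first derivatives, that is
    by F, so the cross term is of type G F; a product G G never occurs. *)
Let product_expansion (a a0 a1 b b0 b1 k x1 x2 y1 y2 : R) : 0 <= k ->
  `|a - a0| <= k * x1 -> `|a - a0 - a1| <= k ^+ 2 * x1 -> `|a0| <= x2 ->
  `|b - b0| <= k * y1 -> `|b - b0 - b1| <= k ^+ 2 * y2 -> `|b0| <= y1 ->
  `|a * b - a0 * b0 - (a1 * b0 + a0 * b1)| <= k ^+ 2 * (2 * (x1 * y1) + x2 * y2).
Proof.
move=> k0 h1 h2 h3 h4 h5 h6.
rewrite (_ : _ - _ - _ = (a - a0 - a1) * b0 + a0 * (b - b0 - b1) + (a - a0) * (b - b0)); last by ring.
have := ler_normD ((a - a0 - a1) * b0 + a0 * (b - b0 - b1)) ((a - a0) * (b - b0)).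
have := ler_normD ((a - a0 - a1) * b0) (a0 * (b - b0 - b1)).
rewrite !normrM.
have l1 : `|a - a0 - a1| * `|b0| <= k ^+ 2 * x1 * y1 by rewrite ler_pM.
have l2 : `|a0| * `|b - b0 - b1| <= x2 * (k ^+ 2 * y2) by rewrite ler_pM.
have l3 : `|a - a0| * `|b - b0| <= k * x1 * (k * y1) by rewrite ler_pM.
move=> l4 l5; apply: (le_trans l5); apply: (le_trans (lerD l4 (lexx _))).
apply: (le_trans (lerD (lerD l1 l2) l3)).
by rewrite le_eqVlt; apply/orP; left; apply/eqP; ring.
Qed.

Let sum_bilinear (d0 p q p' q' : 'I_r -> R) (k b1 a1 b2 a2 : R) :
  \sum_i d0 i * (k * (p i * b1 + a1 * q i + (q' i * b2 + a2 * p' i))) =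
  k * ((\sum_i d0 i * p i) * b1 + a1 * (\sum_i d0 i * q i) +
       ((\sum_i d0 i * p' i) * a2 + b2 * \sum_i d0 i * q' i)).
Proof.
rewrite !mulr_suml !mulr_sumr -!big_split/= mulr_sumr; apply: eq_bigr => i _; ring.
Qed.

Let regroup (k p q p' q' p0 q0 p0' q0' u v : R) :
  k * (p * q + p' * q') - k * (p0 * q0 + p0' * q0') - k * (u + v) =
  k * ((p * q - p0 * q0 - u) + (q' * p' - q0' * p0' - v)).
Proof. by ring. Qed.

Lemma skernel1_expansion j dl z : `|dl| < rho ->
  `|skernel1 j (ts + dl) z - skernel1 j ts z - \sum_i dl 0 i * skernel2 i j z| <=
  `|dl| ^+ 2 * skernelL z.
Proof.
move=> dr; case: z => x y.
have -> : skernel1 j (ts + dl) (x, y) - skernel1 j ts (x, y) -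
    \sum_i dl 0 i * skernel2 i j (x, y) =
  \sum_a \sum_b KK a b (x, y) *
   ((psi1 j a (ts + dl) x * psi b (ts + dl) y - psi1 j a ts x * psi b ts y -
     ((\sum_i dl 0 i * psi2 i j a ts x) * psi b ts y +
      psi1 j a ts x * (\sum_i dl 0 i * psi1 i b ts y))) +
    (psi1 j b (ts + dl) y * psi a (ts + dl) x - psi1 j b ts y * psi a ts x -
     ((\sum_i dl 0 i * psi2 i j b ts y) * psi a ts x +
      psi1 j b ts y * (\sum_i dl 0 i * psi1 i a ts x)))).
  have -> : \sum_i dl 0 i * skernel2 i j (x, y) = \sum_a \sum_b KK a b (x, y) *
     (((\sum_i dl 0 i * psi2 i j a ts x) * psi b ts y +
      psi1 j a ts x * (\sum_i dl 0 i * psi1 i b ts y)) +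
      ((\sum_i dl 0 i * psi2 i j b ts y) * psi a ts x +
      psi1 j b ts y * (\sum_i dl 0 i * psi1 i a ts x))).
    rewrite /skernel2; under eq_bigr do rewrite mulr_sumr.
    rewrite exchange_big/=; apply: eq_bigr => a _.
    under eq_bigr do rewrite mulr_sumr; rewrite exchange_big/=; apply: eq_bigr => b _.
    by rewrite -sum_bilinear.
  rewrite -sumrB -sumrB; apply: eq_bigr => a _.
  by rewrite -sumrB -sumrB; apply: eq_bigr => b _; exact: regroup.
have -> : `|dl| ^+ 2 * skernelL (x, y) = #|A|%:R ^+ 2 * (C *
  ((r%:R * `|dl|) ^+ 2 * (2 * (G x * F y) + F x * G y) +
   (r%:R * `|dl|) ^+ 2 * (2 * (G y * F x) + F y * G x))).
  by rewrite /skernelL/=; ring.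
apply: sum_KK_le => a b; apply: (le_trans (ler_normD _ _)).
have k0 : 0 <= r%:R * `|dl| by rewrite mulr_ge0.
by apply: lerD; apply: product_expansion k0 (taylor_psi1 _ _ _ dr).1 (taylor_psi1 _ _ _ dr).2
  _ (taylor_psi _ _ dr).1 (taylor_psi _ _ dr).2 _; rewrite ?psi1F ?psiF.
Qed.

(** Mean value theorem for the remainder [f] along the segment: its derivative is the remainder of
    the first derivatives at s dl, contracted with dl. This gains the third power of |dl|. *)
Lemma skernel_expansion dl z : `|dl| < rho ->
  `|skernel (ts + dl) z - skernel ts z - \sum_j dl 0 j * skernel1 j ts z -
    2^-1 * (\sum_j dl 0 j * \sum_i dl 0 i * skernel2 i j z)| <=
  r%:R * (`|dl| ^+ 3 * skernelL z).
Proof.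
move=> dr.
pose b := \sum_j dl 0 j * skernel1 j ts z.
pose q := \sum_j dl 0 j * \sum_i dl 0 i * skernel2 i j z.
pose f s := skernel (ts + s *: dl) z - s * b - 2^-1 * s ^+ 2 * q.
pose df s := \sum_j dl 0 j * skernel1 j (ts + s *: dl) z - b - s * q.
have D (s : R) : 0 <= s <= 1 -> is_derive s 1 f (df s).
  move=> s01; have bs : ball ts rho (ts + s *: dl) by exact: ball_line.
  have [ds Ds] := is_derive_skernel dl z bs.
  have h1 := is_derive_line ds; rewrite Ds in h1.
  have h2 : is_derive s 1 (fun s : R => - (s * b)) (- b).
    have := is_derive_scale (- b) (is_derive_id s (1 : R)).
    rewrite mulr1 (_ : (fun t : R => - b * t) = (fun s => - (s * b)))//.
    by apply/funext => t; rewrite mulNr mulrC.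
  have h3 : is_derive s 1 (fun s : R => - (2^-1 * s ^+ 2 * q)) (- (s * q)).
    have := is_derive_scale (- (2^-1 * q)) (is_derive_prod (is_derive_id s (1 : R)) (is_derive_id s (1 : R))).
    rewrite (_ : (fun t : R => _) = (fun s => - (2^-1 * s ^+ 2 * q))); last first.
      by apply/funext => t; ring.
    by rewrite (_ : - _ * _ = - (s * q))//; field.
  exact: is_derive_add (is_derive_add h1 h2) h3.
have [||s] := MVT (@ltr01 R) (f := f) (df := df).
- by move=> s; rewrite in_itv/= => /andP[s0 s1]; apply: D; rewrite !ltW.
- apply: derivable_within_continuous => s; rewrite in_itv/= => s01.
  by have [] := D s s01.
rewrite in_itv/= => /andP[s0 s1]; rewrite subr0 mulr1.
rewrite {1 2}/f scale1r scale0r addr0 mul1r expr1n mulr1 mul0r expr0n/= mulr0 mul0r !subr0 => E.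
rewrite -/b -/q (_ : _ - _ - _ - _ = df s); last by rewrite -E; ring.
have sd : `|s *: dl| <= `|dl| by rewrite normrZ (ger0_norm (ltW s0)) ler_piMl// ltW.
have -> : df s = \sum_j dl 0 j * (skernel1 j (ts + s *: dl) z - skernel1 j ts z -
    \sum_i (s *: dl) 0 i * skernel2 i j z).
  rewrite /df /b /q mulr_sumr -sumrB -sumrB; apply: eq_bigr => j _.
  rewrite mulrBr mulrBr; congr (_ - _); rewrite mulrCA; congr (_ * _).
  by rewrite mulr_sumr; apply: eq_bigr => i _; rewrite mxE mulrA.
have L0 : 0 <= skernelL z.
  by rewrite /skernelL !mulr_ge0 ?exprn_ge0// addr_ge0// mulr_ge0.
rewrite exprS -[`|dl| * _ * _]mulrA; apply: sum_coord_le => j.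
apply: (le_trans (skernel1_expansion _ _ (le_lt_trans sd dr))).
by rewrite ler_wpM2r// ler_sqr ?nnegrE.
Qed.

Let measurable_derivative i a t : ball ts rho t -> measurable_fun setT (psi1 i a t).
Proof.
move=> bt.
(* Measurability in x is known only for parameters in the ball; the default value 0 is used for at
   most finitely many n. *)
pose f n x := if `[< ball ts rho (t + n.+1%:R^-1 *: e i) >]
  then n.+1%:R * (psi a (t + n.+1%:R^-1 *: e i) x - psi a t x) else 0.
apply: (@measurable_fun_cvg _ _ _ _ f).
  move=> n; rewrite /f; case: asboolP => // bn.
  by apply: measurable_funM => //; apply: measurable_funB; exact: mpsi.
move=> x _.
have ht : t + n.+1%:R^-1 *: e i @[n --> \oo] --> t.
  exact: cvg_shrink.
have hn : \forall n \near \oo, n.+1%:R * (psi a (t + n.+1%:R^-1 *: e i) x - psi a t x) = f n x.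
  have hb : \forall n \near \oo, ball ts rho (t + n.+1%:R^-1 *: e i) by exact: ht _ (near_ball bt).
  by apply: filterS hb => n bn; rewrite /f asboolT.
apply: cvg_trans (near_eq_cvg hn) _.
by have H := cvg_firstdiff (diff_derivable (v := e i) (dpsi a x bt)); exact: H.
Qed.

Let cvg_psi2 i j a x (n : nat) := if `[< ball ts rho (ts + n.+1%:R^-1 *: e i) >]
  then n.+1%:R * (psi1 j a (ts + n.+1%:R^-1 *: e i) x - psi1 j a ts x) else 0.

Let measurable_derivative2 i j a : measurable_fun setT (psi2 i j a ts).
Proof.
apply: (@measurable_fun_cvg _ _ _ _ (fun n x => cvg_psi2 i j a x n)).
  move=> n; rewrite /cvg_psi2; case: asboolP => // bn.
  by apply: measurable_funM => //; apply: measurable_funB; exact: measurable_derivative.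
move=> x _.
have ht : ts + n.+1%:R^-1 *: e i @[n --> \oo] --> ts by exact: cvg_shrink.
have hn : \forall n \near \oo, n.+1%:R * (psi1 j a (ts + n.+1%:R^-1 *: e i) x - psi1 j a ts x) =
    cvg_psi2 i j a x n.
  have hb : \forall n \near \oo, ball ts rho (ts + n.+1%:R^-1 *: e i) by exact: ht _ (near_ball B0).
  by apply: filterS hb => n bn; rewrite /cvg_psi2 asboolT.
apply: cvg_trans (near_eq_cvg hn) _.
by have H := cvg_firstdiff (diff_derivable (v := e i) (dpsi1 j a x B0)); exact: H.
Qed.

Let m1 (f : S -> R) : measurable_fun setT f -> measurable_fun setT (fun z : S * S => f z.1).
Proof. by move=> mf; exact: measurableT_comp. Qed.

Let m2 (f : S -> R) : measurable_fun setT f -> measurable_fun setT (fun z : S * S => f z.2).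
Proof. by move=> mf; exact: measurableT_comp. Qed.

Lemma measurable_skernel t : ball ts rho t -> measurable_fun setT (skernel t).
Proof.
move=> bt; apply: measurable_sum => a; apply: measurable_sum => b.
apply: measurable_funM => //; apply: measurable_funM; [apply: m1|apply: m2]; exact: mpsi.
Qed.

Lemma measurable_skernel1 j t : ball ts rho t -> measurable_fun setT (skernel1 j t).
Proof.
move=> bt; apply: measurable_sum => a; apply: measurable_sum => b.
apply: measurable_funM => //; apply: measurable_funD; apply: measurable_funM;
  by [apply: m1; exact: mpsi|apply: m2; exact: mpsi|
      apply: m1; exact: measurable_derivative|apply: m2; exact: measurable_derivative].
Qed.

Let mprod (f g : S -> R) : measurable_fun setT f -> measurable_fun setT g ->
  measurable_fun setT (fun z : S * S => f z.1 * g z.2).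
Proof. by move=> mf mg; apply: measurable_funM; [exact: m1|exact: m2]. Qed.

Lemma measurable_skernel2 i j : measurable_fun setT (skernel2 i j).
Proof.
apply: measurable_sum => a; apply: measurable_sum => b.
apply: measurable_funM => //; apply: measurable_funD; apply: measurable_funD.
- exact: (mprod (measurable_derivative2 i j a) (mpsi b B0)).
- exact: (mprod (measurable_derivative j a B0) (measurable_derivative i b B0)).
- exact: (mprod (measurable_derivative i a B0) (measurable_derivative j b B0)).
- exact: (mprod (mpsi a B0) (measurable_derivative2 i j b)).
Qed.

Let lF : L1 Q F. Proof. exact: L1_sq. Qed.

Lemma L1_skernelL : L1 (Q \x Q)%E skernelL.
Proof. by do 3 apply: L1Z; apply: L1D; exact: L1_prodM. Qed.

Lemma skernelL_ge0 z : 0 <= skernelL z.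
Proof. by rewrite /skernelL !mulr_ge0 ?exprn_ge0// addr_ge0// mulr_ge0. Qed.

Lemma skernel_le t z : ball ts rho t ->
  `|skernel t z| <= #|A|%:R ^+ 2 * (C * (F z.1 * F z.2)).
Proof.
by move=> bt; apply: sum_KK_le => a b; rewrite normrM ler_pM// psiF.
Qed.

Lemma L1_skernel t : ball ts rho t -> L1 (Q \x Q)%E (skernel t).
Proof.
move=> bt; apply: (L1_le (measurable_skernel bt) (fun z => skernel_le z bt)).
by do 2 apply: L1Z; exact: L1_prodM.
Qed.

Lemma skernel1_le j t z : ball ts rho t ->
  `|skernel1 j t z| <= #|A|%:R ^+ 2 * (C * (2 * (F z.1 * F z.2))).
Proof.
move=> bt; apply: sum_KK_le => a b; apply: (le_trans (ler_normD _ _)).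
by rewrite !normrM mulr2n mulrDl mul1r; apply: lerD; rewrite ler_pM ?psiF ?psi1F.
Qed.

Lemma L1_skernel2 i j : L1 (Q \x Q)%E (skernel2 i j).
Proof.
apply: (@L1_le _ _ _ _ _ (fun z => #|A|%:R ^+ 2 * (C * (2 * (F z.1 * F z.2) +
    (G z.1 * F z.2 + F z.1 * G z.2))))).
- exact: measurable_skernel2.
- move=> z; apply: sum_KK_le => a b; apply: (le_trans (ler_normD _ _)).
  have l1 := ler_normD (psi2 i j a ts z.1 * psi b ts z.2) (psi1 j a ts z.1 * psi1 i b ts z.2).
  have l2 := ler_normD (psi1 i a ts z.1 * psi1 j b ts z.2) (psi a ts z.1 * psi2 i j b ts z.2).
  apply: (le_trans (lerD l1 l2)); rewrite !normrM.
  have p1 : `|psi2 i j a ts z.1| * `|psi b ts z.2| <= G z.1 * F z.2 by rewrite ler_pM ?psi2G ?psiF.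
  have p2 : `|psi1 j a ts z.1| * `|psi1 i b ts z.2| <= F z.1 * F z.2 by rewrite ler_pM ?psi1F.
  have p3 : `|psi1 i a ts z.1| * `|psi1 j b ts z.2| <= F z.1 * F z.2 by rewrite ler_pM ?psi1F.
  have p4 : `|psi a ts z.1| * `|psi2 i j b ts z.2| <= F z.1 * G z.2 by rewrite ler_pM ?psi2G ?psiF.
  apply: (le_trans (lerD (lerD p1 p2) (lerD p3 p4))).
  by rewrite le_eqVlt; apply/orP; left; apply/eqP; ring.
- do 2 apply: L1Z; apply: L1D; first by apply: L1Z; exact: L1_prodM.
  by apply: L1D; exact: L1_prodM.
Qed.

Let sum_KKC (f : A -> A -> S -> S -> R) x y : (forall a b, f a b x y = f b a y x) ->
  \sum_a \sum_b KK a b (x, y) * f a b x y = \sum_a \sum_b KK a b (y, x) * f a b y x.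
Proof.
move=> fC; rewrite exchange_big/=; apply: eq_bigr => a _; apply: eq_bigr => b _.
by rewrite KKC fC.
Qed.

Lemma skernel1C j t x y : skernel1 j t (x, y) = skernel1 j t (y, x).
Proof.
apply: (sum_KKC (f := fun a b x y => psi1 j a t x * psi b t y + psi a t x * psi1 j b t y)).
by move=> a b; rewrite addrC; congr (_ + _); rewrite mulrC.
Qed.

Lemma skernel2C i j x y : skernel2 i j (x, y) = skernel2 i j (y, x).
Proof.
apply: (sum_KKC (f := fun a b x y =>
  psi2 i j a ts x * psi b ts y + psi1 j a ts x * psi1 i b ts y +
     (psi1 i a ts x * psi1 j b ts y + psi a ts x * psi2 i j b ts y))).
move=> a b; rewrite addrC; congr (_ + _); rewrite addrC; congr (_ + _); by rewrite mulrC.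
Qed.

Lemma skernel2_sym i j z : skernel2 i j z = skernel2 j i z.
Proof.
apply: eq_bigr => a _; apply: eq_bigr => b _.
rewrite (psi2C i j a) (psi2C i j b); congr (_ * _).
move: (psi2 _ _ _ _ _) (psi2 _ _ _ _ _) => u v; ring.
Qed.

End SmoothKernel.

(** * Estimators minimising a smooth U-statistic *)

Section KernelMinimization.
Context d d' (T : measurableType d) (S : measurableType d') (R : realType).
Context (Pr : probability T R) (Q : probability S R).
Variable X : nat -> {RV Pr >-> S}.
Hypothesis iidX : iid Q X.
Variables (r : nat) (ts : 'rV[R]_r) (rho c : R).
Variables (k : 'rV[R]_r -> S * S -> R) (k1 : 'I_r -> 'rV[R]_r -> S * S -> R).
Variables (k2 : 'I_r -> 'I_r -> S * S -> R) (L : S * S -> R) (G : S -> R).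
Hypothesis rho0 : 0 < rho.
Hypothesis lk : forall t, ball ts rho t -> L1 (Q \x Q)%E (k t).
Hypothesis mk1 : forall j, measurable_fun setT (k1 j ts).
Hypothesis mG : measurable_fun setT G.
Hypothesis G2 : L1 Q (fun x => G x ^+ 2).
Hypothesis k1G : forall j x y, `|k1 j ts (x, y)| <= G x * G y.
Hypothesis k1C : forall j x y, k1 j ts (x, y) = k1 j ts (y, x).
Hypothesis lk2 : forall i j, L1 (Q \x Q)%E (k2 i j).
Hypothesis k2C : forall i j x y, k2 i j (x, y) = k2 i j (y, x).
Hypothesis k2_sym : forall i j z, k2 i j z = k2 j i z.
Hypothesis lL : L1 (Q \x Q)%E L.
Hypothesis L0 : forall z, 0 <= L z.
Hypothesis is_derive_k : forall t u z, ball ts rho t ->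
  is_derive t u (k ^~ z) (\sum_j u 0 j * k1 j t z).
Hypothesis k1_expansion : forall j dl z, `|dl| < rho ->
  `|k1 j (ts + dl) z - k1 j ts z - \sum_i dl 0 i * k2 i j z| <= `|dl| ^+ 2 * L z.
Hypothesis k_expansion : forall dl z, `|dl| < rho ->
  `|k (ts + dl) z - k ts z - \sum_j dl 0 j * k1 j ts z -
    2^-1 * (\sum_j dl 0 j * \sum_i dl 0 i * k2 i j z)| <= c * (`|dl| ^+ 3 * L z).
Variables (Phi : 'rV[R]_r -> R) (g : 'M[R]_r) (that : nat -> {RV Pr >-> 'rV[R]_r}).
Hypothesis PhiE : forall t, ball ts rho t -> Phi t = \int[(Q \x Q)%E]_z k t z.
Hypothesis dPhi : \forall t \near ts, differentiable Phi t.
Hypothesis ddPhi : forall j, differentiable ('D_(ebasis R j) Phi) ts.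
Hypothesis minPhi : \forall t \near ts, Phi ts <= Phi t.
Hypothesis hessian : forall i j, 'D_(ebasis R i) ('D_(ebasis R j) Phi) ts = 2 * g i j.
Hypothesis gu : g \in unitmx.
Hypothesis consistent : op1 Pr (fun n w => `|that n w - ts|).
Hypothesis argm : whp Pr (fun n => [set w |
  \forall t \near that n w, usum X (k (that n w)) n w <= usum X (k t) n w]).

Let B0 : ball ts rho ts. Proof. exact: ballxx. Qed.

Let L1_k1 j : L1 (Q \x Q)%E (k1 j ts).
Proof. exact: (L1_dominated (mk1 j) mG G2 (k1G j)). Qed.

Let b : 'rV[R]_r := \row_j \int[(Q \x Q)%E]_z k1 j ts z.
Let M : 'M[R]_r := \matrix_(i, j) \int[(Q \x Q)%E]_z k2 i j z.

(** The pointwise expansion is integrated term by term, its remainder being integrable; this stands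
    in for differentiation under the integral sign. *)
Let expansion dl : `|dl| < rho ->
  `|Phi (ts + dl) - Phi ts - dotr dl b - 2^-1 * quad M dl dl| <=
  (c * \int[(Q \x Q)%E]_z L z) * `|dl| ^+ 3.
Proof.
move=> dr.
have bd : ball ts rho (ts + dl).
  by rewrite -ball_normE /ball_/= opprD addNKr normrN.
have l1 : L1 (Q \x Q)%E (fun z => \sum_j dl 0 j * k1 j ts z).
  by apply: L1_sum => j _; apply: L1Z; exact: L1_k1.
have l2 j : L1 (Q \x Q)%E (fun z => \sum_i dl 0 i * k2 i j z).
  by apply: L1_sum => i _; apply: L1Z; exact: lk2.
have l3 : L1 (Q \x Q)%E (fun z => \sum_j dl 0 j * \sum_i dl 0 i * k2 i j z).
  by apply: L1_sum => j _; apply: L1Z; exact: l2.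
have l0 : L1 (Q \x Q)%E (fun z => k (ts + dl) z - k ts z).
  by apply: L1B; exact: lk.
have -> : Phi (ts + dl) - Phi ts - dotr dl b - 2^-1 * quad M dl dl =
    \int[(Q \x Q)%E]_z (k (ts + dl) z - k ts z - \sum_j dl 0 j * k1 j ts z -
    2^-1 * (\sum_j dl 0 j * \sum_i dl 0 i * k2 i j z)).
  rewrite EB; [|exact: L1B|exact: L1Z].
  rewrite EB// EB; [|exact: lk|exact: lk].
  rewrite EZ// E_sum => [|j _]; last by apply: L1Z; exact: L1_k1.
  rewrite E_sum => [|j _]; last by apply: L1Z; exact: l2.
  rewrite !PhiE//; congr (_ - _ - _ * _).
    by rewrite dotrE; apply: eq_bigr => j _; rewrite mxE EZ//; exact: L1_k1.
  rewrite /quad mxE; apply: eq_bigr => j _; rewrite !mxE EZ// mulrC; congr (_ * _).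
  rewrite E_sum => [|i _]; last by apply: L1Z; exact: lk2.
  by apply: eq_bigr => i _; rewrite mxE EZ//; exact: lk2.
rewrite mulrAC -EZ//; apply: E_norm_le.
- by apply: L1B; [exact: L1B|exact: L1Z].
- exact: L1Z.
- by move=> z; rewrite -mulrA; exact: k_expansion.
Qed.

(** The integral is the j-th linear coefficient of the expansion, hence a partial derivative of
    [Phi], which is 0 at a local minimum. *)
Let E_k1 j : \int[(Q \x Q)%E]_z k1 j ts z = 0.
Proof.
have dts : derivable Phi ts (ebasis R j) by apply: diff_derivable; exact: nbhs_singleton dPhi.
have := cvg_firstdiff dts; rewrite (local_min_derive0 dts minPhi).
move=> /(cvg_unique (@norm_hausdorff _ _)) /(_ (cvg_expansion_first (u := ebasis R j) rho0 expansion)) E.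
by move: E; rewrite /dotr -rowE !mxE.
Qed.

(** The second differences of [Phi] have two limits: the Hessian, and the symmetric part of the
    quadratic coefficient, which is the coefficient itself by [k2_sym]. *)
Let E_k2 i j : \int[(Q \x Q)%E]_z k2 i j z = 2 * g i j.
Proof.
rewrite -hessian; have := cvg_secdiff (u := ebasis R j) (v := ebasis R i) dPhi (ddPhi j).
move=> /(cvg_unique (@norm_hausdorff _ _)) /(_ (cvg_expansion_second (u := ebasis R j) (v := ebasis R i) rho0 expansion)) ->.
rewrite !quad_delta !mxE.
have -> : k2 i j = k2 j i by apply/funext => z; exact: k2_sym.
by lra.
Qed.

Theorem kernel_minimization : exists nu : probability 'rV[R]_r R,
  is_normal 0 (invmx g *m
    (\matrix_(i, j) \int[Q]_x (marginal Q (k1 i ts) x * marginal Q (k1 j ts) x))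
    *m invmx g) nu /\
  cvg_in_distribution Pr (fun n w => Num.sqrt n%:R *: (that n w - ts)) nu.
Proof.
apply: (m_estimation iidX (h := fun j => k1 j ts) (H := k2) (L := L) (G := G)) => //.
- apply/matrixP => i j; rewrite mxE.
  have := E_k2 i j; have := E_k2 j i.
  have -> : k2 i j = k2 j i by apply/funext => z; exact: k2_sym.
  by move=> -> E; lra.
have rho20 : 0 < rho / 2 by rewrite divr_gt0.
apply: whp_sub (whpI argm (consistent rho20)); apply: nearW => n w [hmin hrho] j /=.
rewrite /= normr_id in hrho.
set dl := that n w - ts in hrho *.
have dr : `|dl| < rho by apply: (le_lt_trans hrho); lra.
have thatE : that n w = ts + dl by rewrite /dl addrC subrK.
have bt : ball ts rho (that n w) by rewrite thatE -ball_normE /ball_/= opprD addNKr normrN.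
have D : is_derive (that n w) (ebasis R j) (fun t => usum X (k t) n w)
    (usum X (k1 j (that n w)) n w).
  rewrite /usum; apply: is_derive_bigsum => o _; apply: is_derive_bigsum => l _.
  have := is_derive_k (ebasis R j) (X o w, X l w) bt.
  rewrite (bigD1 j)//= mxE !eqxx mul1r big1 ?addr0// => i /negbTE ij.
  by rewrite mxE ij andbF mul0r.
have D0 : usum X (k1 j (that n w)) n w = 0.
  by have [dU DU] := D; rewrite -DU; exact: local_min_derive0 dU hmin.
(* Subtracting the gradient at the estimator, which is 0, turns the linearised gradient into minus
   the sum of the expansion errors of [k1] over all pairs. *)
rewrite -[X in `|X|]subr0 -[X in `|_ - X|]D0.
have -> : usum X (k1 j ts) n w + \sum_i dl 0 i * usum X (k2 i j) n w -
    usum X (k1 j (that n w)) n w = - \sum_(p : 'I_n * 'I_n | p.2 != p.1)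
    (k1 j (ts + dl) (X p.1 w, X p.2 w) - k1 j ts (X p.1 w, X p.2 w) -
     \sum_i dl 0 i * k2 i j (X p.1 w, X p.2 w)).
  have -> : \sum_i dl 0 i * usum X (k2 i j) n w = \sum_(p : 'I_n * 'I_n | p.2 != p.1)
      \sum_i dl 0 i * k2 i j (X p.1 w, X p.2 w).
    by rewrite exchange_big/=; apply: eq_bigr => i _; rewrite usum_pairE mulr_sumr.
  by rewrite thatE !usum_pairE sumrB sumrB; ring.
rewrite normrN (le_trans (ler_norm_sum _ _ _))// usum_pairE mulr_sumr.
by apply: ler_sum => p _; exact: k1_expansion.
Qed.

End KernelMinimization.

(** * Positive definite kernels *)

Section PositiveDefinite.
Context d (S : measurableType d) (R : realType) (P : probability S R).
Implicit Types (k : S * S -> R) (s : seq (R * S)).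

Definition gram k s : R := \sum_(p <- s) \sum_(q <- s) p.1 * q.1 * k (p.2, q.2).

Definition pos_def k := (forall x y, k (x, y) = k (y, x)) /\ forall s, 0 <= gram k s.

Lemma pos_def_restrict k (A : set S) : pos_def k ->
  pos_def (fun z => \1_A z.1 * \1_A z.2 * k z).
Proof.
move=> [kC k0]; split=> [x y|s]; first by rewrite /= kC [X in X * _]mulrC.
have := k0 [seq (p.1 * \1_A p.2, p.2) | p <- s].
rewrite /gram big_map; congr (_ <= _); apply: eq_bigr => p _.
by rewrite big_map; apply: eq_bigr => q _ /=; ring.
Qed.

Lemma gram_cons k x s : (forall x y, k (x, y) = k (y, x)) ->
  gram k ((1, x) :: s) = k (x, x) + 2 * (\sum_(q <- s) q.1 * k (q.2, x)) + gram k s.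
Proof.
move=> kC; rewrite /gram big_cons big_cons/= !mul1r.
rewrite [X in _ + X](_ : _ = \sum_(p <- s) (p.1 * k (p.2, x) +
  \sum_(q <- s) p.1 * q.1 * k (p.2, q.2))); last first.
  by apply: eq_bigr => p _; rewrite big_cons mulr1.
rewrite big_split/= (eq_bigr (fun q => q.1 * k (q.2, x))) => [|q _]; last first.
  by rewrite mul1r kC.
ring.
Qed.

Lemma exists_le_expectation (f : S -> R) : L1 P f -> exists x, f x <= \int[P]_x f x + 1.
Proof.
move=> lf; apply: contrapT => /forallNP h.
suff : \int[P]_x f x + 1 <= \int[P]_x f x by rewrite gerDl ler10.
rewrite -[leLHS](E_cst P); apply: E_le => //; first exact: L1_cst.
by move=> x; apply: ltW; rewrite ltNge; apply/negP; exact: h.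
Qed.

Section Bounded.
Variables (k : S * S -> R) (B : R).
Hypothesis mk : measurable_fun setT k.
Hypothesis kpd : pos_def k.
Hypothesis kB : forall x, k (x, x) <= B.

Let kC x y : k (x, y) = k (y, x). Proof. by have [kC _] := kpd; exact: kC. Qed.

(** Gram sums of two points with weights (1, 1) and (1, - 1): off-diagonal values are controlled by
    the diagonal. *)
Let k_le z : `|k z| <= B.
Proof.
case: z => x y.
have := kpd.2 [:: (1, x); (1, y)]; have := kpd.2 [:: (1, x); (-1, y)].
rewrite /gram !big_cons !big_nil /= (kC y x) !mul1r !mulr1 !addr0 mulrNN mulr1 mul1r.
by have := kB x; have := kB y; rewrite ler_norml => *; apply/andP; split; lra.
Qed.

Let lk : L1 (P \x P)%E k. Proof. exact: (@L1_bounded _ _ _ _ _ B). Qed.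

Let ls x : L1 P (fun y => k (x, y)).
Proof.
apply: (@L1_bounded _ _ _ _ _ B) => //.
by apply: (measurableT_comp mk); exact: measurable_pair1.
Qed.

Let kbar x := \int[P]_y k (x, y).
Let I := \int[(P \x P)%E]_z k z.

Let lkbar : L1 P kbar. Proof. exact: (E_fubini lk ls).1. Qed.

Let Ekbar : \int[P]_x kbar x = I. Proof. by rewrite /I (E_fubini lk ls).2. Qed.

(* The points are drawn one after the other by the method of conditional expectations. *)
Let exists_sample n m : exists s, [/\ size s = n, forall q, List.In q s -> q.1 = 1 &
  gram k s + 2 * m%:R * (\sum_(q <- s) kbar q.2) + m%:R * (m%:R - 1) * I <=
  (n + m)%:R * ((n + m)%:R - 1) * I + n%:R * (B + 1)].
Proof.
elim: n m => [|n IH] m.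
  by exists [::]; split => //; rewrite /gram !big_nil add0n !mulr0 mul0r !add0r addr0.
have [s [sn s1 hs]] := IH m.+1.
have l1 q : L1 P (fun x => q.1 * k (q.2, x)) by apply: L1Z; exact: ls.
have lf : L1 P (fun x => 2 * (\sum_(q <- s) q.1 * k (q.2, x)) + 2 * m%:R * kbar x).
  by apply: L1D; apply: L1Z => //; apply: L1_sum.
(* The left-hand side of the bound is the mean Gram sum, without the new diagonal terms, when m more
   independent points follow s. The new point loses at most 1 against the mean and adds a diagonal
   term of at most B, which accounts for B + 1 per point. *)
have [x] := exists_le_expectation lf.
rewrite ED; [|by apply: L1Z; exact: L1_sum|exact: L1Z].
rewrite EZ; last exact: L1_sum.
rewrite EZ// E_sum// Ekbar => hx.
have sE : \sum_(q <- s) \int[P]_x (q.1 * k (q.2, x)) = \sum_(q <- s) kbar q.2.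
  elim: s s1 {hs hx lf sn} => [|q s IHs] s1; first by rewrite !big_nil.
  rewrite !big_cons IHs => [|q' q's]; last by apply: s1; right.
  by congr (_ + _); rewrite EZ// (s1 q) ?mul1r//; left.
rewrite sE in hx.
exists ((1, x) :: s); split; first by rewrite /= sn.
  by move=> q /= [<-//|]; exact: s1.
rewrite gram_cons//= big_cons/=.
have := kB x; move: hx hs; rewrite addSnnS -![m.+1%:R]natr1 -[n.+1%:R]natr1.
by lra.
Qed.

Lemma bounded_pos_def_expectation_ge0 : 0 <= I.
Proof.
rewrite leNgt; apply/negP => I0.
have B10 : 0 <= B + 1 by have := k_le (point, point); have := normr_ge0 (k (point, point)); lra.
(* Then (n - 1) (- I) > B + 1, and the bound n (n - 1) I + n (B + 1) of the Gram sum is negative. *)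
pose n := (Num.truncn ((B + 1) / - I)).+2.
have [s [_ _]] := exists_sample n 0.
rewrite mulr0 mul0r mul0r !addr0 addn0 mul0r addr0 => hs.
have := le_trans (kpd.2 s) hs.
rewrite -mulrA -mulrDr pmulr_rge0 ?ltr0n//.
have : (B + 1) / - I < (Num.truncn ((B + 1) / - I)).+1%:R by exact: truncnS_gt.
rewrite ltr_pdivrMr ?oppr_gt0// /n -[_.+2%:R]natr1 addrK.
by move=> h1 h2; lra.
Qed.

End Bounded.

(** Restricting both variables to the points with k(x, x) <= M keeps the kernel positive definite
    and bounds its diagonal. Then M tends to infinity by dominated convergence with majorant |k|. *)
Lemma pos_def_expectation_ge0 k : L1 (P \x P)%E k -> pos_def k ->
  0 <= \int[(P \x P)%E]_z k z.
Proof.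
move=> lk kpd; have mk := L1_measurable lk.
pose A (M : nat) := [set x | k (x, x) <= M%:R].
have mdiag : measurable_fun setT (fun x => k (x, x)).
  by apply: (measurableT_comp mk); apply: measurable_fun_pair.
have mA M : measurable (A M).
  have := measurable_preimage mdiag (measurable_itv `]-oo, M%:R]).
  by congr measurable; apply/seteqP; split=> u; rewrite /= in_itv.
pose kM M z := \1_(A M) z.1 * \1_(A M) z.2 * k z.
have mkM M : measurable_fun setT (kM M).
  by apply: measurable_funM => //; apply: measurable_funM;
    apply: measurableT_comp => //; exact: measurable_indic.
have ind01 (B : set S) x : 0 <= (\1_B x : R) <= 1.
  by rewrite indicE; case: (_ \in _); rewrite lexx ler01.
have cv : \int[(P \x P)%E]_z kM M z @[M --> \oo] --> \int[(P \x P)%E]_z k z.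
  apply: (@E_dominated_cvg _ _ _ _ _ _ (fun z => `|k z|)) => //.
  - exact: L1_norm.
  - move=> [x y]; apply: cvg_near_cst; near=> M; rewrite /kM !indicE !mem_set ?mul1r//=.
      by apply: ltW; near: M; exact: nbhs_infty_gtr.
    by apply: ltW; near: M; exact: nbhs_infty_gtr.
  - move=> M z; rewrite /kM normrM ler_piMl//.
    have /andP[a0 a1] := ind01 (A M) z.1; have /andP[b0 b1] := ind01 (A M) z.2.
    by rewrite ger0_norm ?mulr_ge0// mulr_ile1.
apply: (cvgr_to_ge cv); apply: nearW => M.
apply: (@bounded_pos_def_expectation_ge0 _ M%:R) => //.
  exact: pos_def_restrict.
move=> x; rewrite /kM/= indicE; have [xA|xA] := pselect (A M x).
  by rewrite mem_set// !mul1r.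
by rewrite memNset// !mul0r.
Unshelve. all: by end_near. Qed.

End PositiveDefinite.

Section ComponentDerivatives.
Context (R : realType) (V : normedModType R) (I : finType) (e : I -> V).
Variable A : set V.
Hypothesis oA : open A.

Let near_A t : A t -> \forall s \near t, A s.
Proof. by move=> At; apply: open_nbhs_nbhs. Qed.

Lemma derive_ext (f g : V -> R) t v : (forall s, A s -> f s = g s) -> A t ->
  'D_v f t = 'D_v g t.
Proof.
by move=> fg At; apply: near_eq_derive; apply: filterS (near_A At) => s; exact: fg.
Qed.

Lemma ndiff_ext k (f g : V -> R) : (forall t, A t -> f t = g t) ->
  ndiff e k A f -> ndiff e k A g.
Proof.
elim: k f g => [//|k IH] f g fg [df ddf]; split.
  move=> t At; apply: differentiable_ext (df t At).
  by apply: filterS (near_A At) => s; exact: fg.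
by move=> i; apply: IH (ddf i) => t At; exact: derive_ext.
Qed.

Lemma dnorm_ext k (f g : V -> R) t : (forall s, A s -> f s = g s) -> A t ->
  dnorm e k f t = dnorm e k g t.
Proof.
elim: k f g => [|k IH] f g fg At /=; first by rewrite fg.
by apply: eq_bigr => i _; apply: IH => // s As; exact: derive_ext.
Qed.

Section Coordinates.
Variables (m n : nat) (a : 'I_m) (b : 'I_n).
Implicit Type f : V -> 'M[R]_(m, n).

Lemma differentiable_entry f t : differentiable f t ->
  differentiable (fun s => f s a b) t.
Proof.
move=> df; apply: (@differentiable_comp _ _ _ _ f (fun M : 'M[R]_(m, n) => M a b)) => //.
exact: differentiable_coord.
Qed.

Lemma derive_entry f t v : differentiable f t ->
  'D_v (fun s => f s a b) t = ('D_v f t) a b.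
Proof. by move=> df; rewrite derive_mx ?mxE//; exact: diff_derivable. Qed.

Lemma ndiff_entry k f : ndiff e k A f -> ndiff e k A (fun t => f t a b).
Proof.
elim: k f => [//|k IH] f [df ddf]; split.
  by move=> t At; apply: differentiable_entry; exact: df.
move=> i; apply: ndiff_ext (IH _ (ddf i)) => t At.
by rewrite derive_entry//; exact: df.
Qed.

Lemma dnorm_entry_le k f t : ndiff e k A f -> A t ->
  dnorm e k (fun s => f s a b) t <= dnorm e k f t.
Proof.
elim: k f => [|k IH] f /=; first by move=> _ _; exact: norm_coord_le.
move=> [df ddf] At; apply: ler_sum => i _.
rewrite (@dnorm_ext _ _ (fun s => ('D_(e i) f s) a b))//; first exact: IH.
by move=> s As; rewrite derive_entry//; exact: df.
Qed.

End Coordinates.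

Lemma ndiffD k (f g : V -> R) : ndiff e k A f -> ndiff e k A g ->
  ndiff e k A (fun t => f t + g t).
Proof.
elim: k f g => [//|k IH] f g [df ddf] [dg ddg]; split.
  by move=> t At; apply: differentiableD; [exact: df|exact: dg].
move=> i; apply: ndiff_ext (IH _ _ (ddf i) (ddg i)) => t At.
by rewrite -[RHS]/('D_(e i) (f + g) t) deriveD//; apply: diff_derivable; [exact: df|exact: dg].
Qed.

Lemma dnormD_le k (f g : V -> R) t : ndiff e k A f -> ndiff e k A g -> A t ->
  dnorm e k (fun s => f s + g s) t <= dnorm e k f t + dnorm e k g t.
Proof.
elim: k f g => [|k IH] f g /=; first by move=> _ _ _; exact: ler_normD.
move=> [df ddf] [dg ddg] At; rewrite -big_split/=; apply: ler_sum => i _.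
rewrite (@dnorm_ext _ _ (fun s => 'D_(e i) f s + 'D_(e i) g s))//; first exact: IH.
move=> s As; rewrite -[LHS]/('D_(e i) (f + g) s) deriveD//; apply: diff_derivable;
  [exact: df|exact: dg].
Qed.

Lemma ndiff_cst k (c : R) : ndiff e k A (fun=> c).
Proof.
elim: k c => [//|k IH] c; split; first by move=> t _; exact: differentiable_cst.
move=> i; apply: ndiff_ext (IH 0) => t _.
by rewrite -[RHS]/('D_(e i) (cst c) t) derive_cst.
Qed.

Lemma dnorm_cst0 k t : dnorm e k (fun=> 0 : R) t = 0.
Proof.
elim: k => [|k IH] /=; first by rewrite normr0.
rewrite big1// => i _; rewrite -[RHS]IH; congr dnorm; apply/funext => s.
by rewrite -[LHS]/('D_(e i) (cst 0) s) derive_cst.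
Qed.

Lemma ndiff_sum k n (f : 'I_n -> V -> R) : (forall j, ndiff e k A (f j)) ->
  ndiff e k A (fun t => \sum_j f j t).
Proof.
move=> nf; elim: (index_enum _) => [|j s IH].
  by under eq_fun do rewrite big_nil; exact: ndiff_cst.
by under eq_fun do rewrite big_cons; exact: ndiffD.
Qed.

Lemma dnorm_sum_le k n (f : 'I_n -> V -> R) t : (forall j, ndiff e k A (f j)) -> A t ->
  dnorm e k (fun s => \sum_j f j s) t <= \sum_j dnorm e k (f j) t.
Proof.
move=> nf At.
suff : ndiff e k A (fun s => \sum_j f j s) /\
  dnorm e k (fun s => \sum_j f j s) t <= \sum_j dnorm e k (f j) t by case.
elim: (index_enum _) => [|j s [IH1 IH2]].
  under eq_fun do rewrite big_nil; split; first exact: ndiff_cst.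
  by rewrite big_nil dnorm_cst0.
have E : (fun t => \sum_(i <- j :: s) f i t) = (fun t => f j t + \sum_(i <- s) f i t).
  by apply/funext => u; rewrite big_cons.
rewrite E; split; first exact: ndiffD.
by rewrite big_cons; apply: (le_trans (dnormD_le (nf j) IH1 At)); rewrite lerD2l.
Qed.

End ComponentDerivatives.

Lemma ndiffS (R : realType) (V W : normedModType R) (I : finType) (e : I -> V)
    k (A B : set V) (f : V -> W) : A `<=` B -> ndiff e k B f -> ndiff e k A f.
Proof.
move=> AB; elim: k f => [//|k IH] f [df ddf]; split; last by move=> i; exact: IH (ddf i).
by move=> t At; apply: df; exact: AB.
Qed.

Lemma indic1 (R : realType) (T : Type) (D : set T) z : D z -> \1_D z = 1 :> R.
Proof. by move=> Dz; rewrite indicE mem_set. Qed.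

Lemma indic0 (R : realType) (T : Type) (D : set T) z : ~ D z -> \1_D z = 0 :> R.
Proof. by move=> Dz; rewrite indicE memNset. Qed.

Section MeasurableLimits.
Context (R : realType).

(** The indicator of D at the shifted point keeps the quotient measurable even when that point
    leaves D; at a point of D it is eventually 1. *)
Lemma measurable_difference_limit d (S : measurableType d) (D : set S)
    (tau : nat -> S -> S) (f g : S -> R) :
  (forall n, measurable_fun setT (tau n)) ->
  measurable D -> measurable_fun setT (fun z => \1_D z * f z) ->
  (forall z, D z -> \forall n \near \oo, D (tau n z)) ->
  (forall z, D z -> n.+1%:R * (f (tau n z) - f z) @[n --> \oo] --> g z) ->
  measurable_fun setT (fun z => \1_D z * g z).
Proof.
move=> mtau mD mf Dtau fg.
apply: (@measurable_fun_cvg _ _ _ _ (fun n z => \1_D z *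
  (n.+1%:R * (\1_D (tau n z) * f (tau n z) - \1_D z * f z)))).
  move=> n; apply: measurable_funM; first exact: measurable_indic.
  apply: measurable_funM => //; apply: measurable_funB => //.
  exact: (measurableT_comp mf (mtau n)).
move=> z _; have [Dz|Dz] := pselect (D z); last first.
  by rewrite (indic0 R Dz) [0 * g z]mul0r; under eq_fun do rewrite mul0r; exact: cvg_cst.
rewrite (indic1 R Dz) [1 * g z]mul1r; under eq_fun do rewrite !mul1r.
have h : \forall n \near \oo, n.+1%:R * (f (tau n z) - f z) =
    n.+1%:R * (\1_D (tau n z) * f (tau n z) - f z).
  by apply: filterS (Dtau z Dz) => n Dn; rewrite (indic1 R Dn) mul1r.
by apply: cvg_trans (near_eq_cvg h) _; exact: fg.
Qed.

Lemma measurable_indicM d (S : measurableType d) (D : set S) (f : S -> R) :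
  measurable D -> measurable_fun D f -> measurable_fun setT (fun z => \1_D z * f z).
Proof.
move=> mD /(measurable_restrictT _ mD).1; congr measurable_fun.
apply/funext => z; rewrite patchE indicE; case: ifPn => _; by rewrite ?mul1r ?mul0r.
Qed.

Lemma measurable_shift n (c : 'rV[R]_n) : measurable_fun setT (fun x : 'rV[R]_n => x + c).
Proof.
apply: measurable_to_rV => i; under eq_fun do rewrite mxE.
by apply: measurable_funD => //; exact: measurable_coord.
Qed.

End MeasurableLimits.

(** * Derivatives of a reproducing kernel as limits of Gram matrices *)

Section ReproducingKernel.
Context (R : realType) (d : nat).
Variables (X : set 'rV[R]_d) (K : 'rV[R]_d -> 'rV[R]_d -> 'M[R]_d) (B : R).
Hypothesis oX : open X.
Hypothesis rK : reproducing_kernel X K.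
Hypothesis dK : ndiff (@prod_basis R d d) 2 (X `*` X) (fun z => K z.1 z.2).
Hypothesis KB : forall k x y, (k <= 2)%N -> X x -> X y ->
  dnorm (@prod_basis R d d) k (fun z => K z.1 z.2) (x, y) <= B.

Let idx : finType := (option 'I_d * 'I_d)%type.
Let XX := X `*` X.

Definition kentry a b (z : 'rV[R]_d * 'rV[R]_d) : R := K z.1 z.2 a b.

Definition kderiv (o o' : option 'I_d) a b : 'rV[R]_d * 'rV[R]_d -> R :=
  let f := if o is Some j then 'D_(@prod_basis R d d (inl j)) (kentry a b) else kentry a b in
  if o' is Some i then 'D_(@prod_basis R d d (inr i)) f else f.

(* All the derivatives of K of order at most one in each variable, extended by
   0 outside of X * X. *)
Definition kjet (al be : idx) z : R := \1_XX z * kderiv al.1 be.1 al.2 be.2 z.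

Let oXX : open XX.
Proof.
rewrite openE => -[x y] [/= Xx Yy]; exists (X, X) => //; split;
  exact: open_nbhs_nbhs.
Qed.

Let ndK a b : ndiff (@prod_basis R d d) 2 XX (kentry a b).
Proof. exact: (ndiff_entry oXX a b dK). Qed.

Let diffK a b z : XX z -> differentiable (kentry a b) z.
Proof. by have [h _] := ndK a b; exact: h. Qed.

Let diffDK c a b z : XX z -> differentiable ('D_(@prod_basis R d d c) (kentry a b)) z.
Proof. by have [_ /(_ c)[h _]] := ndK a b; exact: h. Qed.

Lemma kjet_le al be z : `|kjet al be z| <= `|B|.
Proof.
rewrite /kjet; have [Xz|Xz] := pselect (XX z); last first.
  by rewrite (indic0 R Xz) mul0r normr0.
rewrite (indic1 R Xz) mul1r; case: z Xz => x y [Xx Xy].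
have h k : (k <= 2)%N -> dnorm (@prod_basis R d d) k (kentry al.2 be.2) (x, y) <= `|B|.
  move=> k2; apply: le_trans (ler_norm _); apply: le_trans (KB k2 Xx Xy).
  apply: (dnorm_entry_le oXX) => //.
  by move: k2; case: k => [|[|[|]]]// _; have [h0 h1] := dK; split => // i; have [] := h1 i.
case: al be h => [[j|] a] [[i|] b] h; rewrite /kderiv/=.
- apply: le_trans (h 2%N isT).
  apply: (le_trans (dnorm_derive_le (@prod_basis R d d) 0 _ _ (inr i))).
  exact: (dnorm_derive_le (@prod_basis R d d) 1 _ _ (inl j)).
- apply: le_trans (h 1%N isT); exact: (dnorm_derive_le (@prod_basis R d d) 0 _ _ (inl j)).
- apply: le_trans (h 1%N isT); exact: (dnorm_derive_le (@prod_basis R d d) 0 _ _ (inr i)).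
- exact: (h 0%N isT).
Qed.

Let measurable_XX : measurable XX.
Proof. by apply: measurableX; exact: open_measurable_rV. Qed.

Let near_shift_XX z u : XX z -> \forall n \near \oo, XX (z + n.+1%:R^-1 *: u).
Proof. by move=> Xz; apply: (@cvg_shrink _ _ z u); exact: open_nbhs_nbhs. Qed.

Let measurable_D u (f : 'rV[R]_d * 'rV[R]_d -> R) :
  (forall z, XX z -> derivable f z u) ->
  measurable_fun setT (fun z => \1_XX z * f z) ->
  measurable_fun setT (fun z => \1_XX z * 'D_u f z).
Proof.
move=> df mf.
apply: (@measurable_difference_limit _ _ _ _ 
  (fun n (z : 'rV[R]_d * 'rV[R]_d) => z + n.+1%:R^-1 *: u) f ('D_u f)) => //.
- move=> n; apply: measurable_fun_pair.
    exact: (measurableT_comp (measurable_shift (n.+1%:R^-1 *: u.1)) measurable_fst).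
  exact: (measurableT_comp (measurable_shift (n.+1%:R^-1 *: u.2)) measurable_snd).
- by move=> z; exact: near_shift_XX.
- by move=> z Xz; apply: cvg_firstdiff; exact: df.
Qed.

Lemma measurable_kjet al be : measurable_fun setT (kjet al be).
Proof.
case: al be => [j' a] [i' b]; rewrite /kjet/=.
have m0 : measurable_fun setT (fun z => \1_XX z * kentry a b z).
  apply: measurable_indicM => //; apply: measurable_fun_continuous_in2 => // z Xz Yz.
  by apply: differentiable_continuous; exact: diffK.
have m1 c : measurable_fun setT (fun z => \1_XX z * 'D_(@prod_basis R d d c) (kentry a b) z).
  by apply: measurable_D => // z Xz; apply: diff_derivable; exact: diffK.
case: j' => [j|]; case: i' => [i|] //.
- apply: (@measurable_D (@prod_basis R d d (inr i)) ('D_(@prod_basis R d d (inl j)) (kentry a b))) => //.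
  by move=> z Xz; apply: diff_derivable; exact: diffDK.
- exact: m1.
- exact: m1.
Qed.

(* kjet is the limit of the Gram matrices of the elements Del n x al of H, which
   are representers of K and their difference quotients. *)
Lemma kjet_gram : exists (H : lmodType R) (ip : H -> H -> R)
    (Del : nat -> 'rV[R]_d -> idx -> H),
  [/\ forall g h, ip g h = ip h g,
      forall a f g h, ip (a *: f + g) h = a * ip f h + ip g h,
      forall h, 0 <= ip h h &
      forall x y al be, ip (Del n x al) (Del n y be) @[n --> \oo] --> kjet al be (x, y)].
Proof.
have [H [ip [ev [[ipC ipD ip2] [_ _ rep]]]]] := rK.
pose ea (a : 'I_d) : 'cV[R]_d := delta_mx a 0.
(* The representers K(., x) e_a. Outside X the reproducing property is silent and 0 is chosen. *)
have [kap kapE] : exists kap : 'rV[R]_d -> 'I_d -> H, forall x y a b, X x -> X y ->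
    ip (kap x a) (kap y b) = K x y a b.
  have [kap0 kap0P] : exists kap : 'rV[R]_d * 'I_d -> H, forall p, X p.1 ->
      (forall x, X x -> ev (kap p) x = K x p.1 *m ea p.2) /\
      (forall h, ip h (kap p) = ((ev h p.1)^T *m ea p.2) 0 0).
    have : forall p : 'rV[R]_d * 'I_d, exists k : H, X p.1 ->
        (forall x, X x -> ev k x = K x p.1 *m ea p.2) /\
        (forall h, ip h k = ((ev h p.1)^T *m ea p.2) 0 0).
      move=> p; have [Xp|Xp] := pselect (X p.1); last by exists 0.
      by have [k kP] := rep p.1 (ea p.2) Xp; exists k.
    by move=> /choice[kap kapP]; exists kap.
  exists (fun x a => kap0 (x, a)) => x y a b Xx Xy.
  rewrite ipC (kap0P (x, a) Xx).2 (kap0P (y, b) Xy).1//= trmx_mul -mulmxA.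
  by rewrite -colE trmx_delta -rowE !mxE.
pose Del n x (al : idx) : H := if al.1 is Some j
  then n.+1%:R *: (kap (x + n.+1%:R^-1 *: ebasis R j) al.2 - kap x al.2) else kap x al.2.
(* The indicator makes the inner products vanish off X * X, where [kjet] is 0 by definition. *)
exists H, ip, (fun n x al => \1_X x *: Del n x al).
have ip0 h : ip 0 h = 0.
  by have := ipD 1 0 0 h; rewrite scaler0 addr0 mul1r; lra.
have ipZ a f h : ip (a *: f) h = a * ip f h by rewrite -[a *: f]addr0 ipD ip0 addr0.
have ipDl f g h : ip (f + g) h = ip f h + ip g h by rewrite -[f]scale1r ipD mul1r scale1r.
have ipB f g h : ip (f - g) h = ip f h - ip g h by rewrite ipDl -scaleN1r ipZ mulN1r.
have ipZr a f h : ip f (a *: h) = a * ip f h by rewrite ipC ipZ ipC.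
have ipBr f g h : ip f (g - h) = ip f g - ip f h by rewrite ipC ipB ![ip _ f]ipC.
split => //; first by move=> h; rewrite ip2 sqr_ge0.
move=> x y al be; have [XXz|XXz] := pselect (XX (x, y)); last first.
  rewrite /kjet (indic0 R XXz) mul0r.
  have E n : ip (\1_X x *: Del n x al) (\1_X y *: Del n y be) = 0.
    have [Xx|Xx] := pselect (X x); last by rewrite (indic0 R Xx) scale0r ip0.
    have Xy : ~ X y by move=> Xy; exact: XXz.
    by rewrite (indic0 R Xy) scale0r ipC ip0.
  by under eq_fun do rewrite E; exact: cvg_cst.
have [Xx Xy] := XXz.
rewrite (indic1 R Xx) (indic1 R Xy); under eq_fun do rewrite !scale1r.
rewrite /kjet (indic1 R XXz) mul1r.
have hx j : \forall n \near \oo, X (x + n.+1%:R^-1 *: ebasis R j).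
  by apply: (@cvg_shrink _ _ x (ebasis R j)); exact: open_nbhs_nbhs.
have hy i : \forall n \near \oo, X (y + n.+1%:R^-1 *: ebasis R i).
  by apply: (@cvg_shrink _ _ y (ebasis R i)); exact: open_nbhs_nbhs.
case: al be => [[j|] a] [[i|] b]; rewrite /kderiv /Del/=.
(* The inner product of the difference quotients at x and at y is the mixed second difference of K,
   whose limit is the mixed derivative. One quotient or none gives the remaining cases. *)
- have dn : \forall q \near (x, y), differentiable (kentry a b) q.
    by apply: filterS (open_nbhs_nbhs (conj oXX XXz)) => q; exact: diffK.
  have := cvg_secdiff (v := @prod_basis R d d (inr i)) dn (diffDK (inl j) a b XXz).
  apply: cvg_trans; apply: near_eq_cvg.
  apply: filterS2 (hx j) (hy i) => n Xn Yn.
  rewrite ipZ ipZr ipB !ipBr !kapE// /secdiff /kentry/= !scaler0 !addr0.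
  by rewrite expr2; ring.
- have := cvg_firstdiff (diff_derivable (v := @prod_basis R d d (inl j)) (diffK a b XXz)).
  apply: cvg_trans; apply: near_eq_cvg.
  apply: filterS (hx j) => n Xn.
  by rewrite ipZ ipB !kapE// /kentry/= !scaler0 !addr0.
- have := cvg_firstdiff (diff_derivable (v := @prod_basis R d d (inr i)) (diffK a b XXz)).
  apply: cvg_trans; apply: near_eq_cvg.
  apply: filterS (hy i) => n Yn.
  by rewrite ipZr ipBr !kapE// /kentry/= !scaler0 !addr0.
- by under eq_fun do rewrite kapE//; exact: cvg_cst.
Qed.

(** Inherited from the symmetry of the inner product, which exchanges the points together with the
    derivatives acting on them. *)
Lemma kjetC al be x y : kjet al be (x, y) = kjet be al (y, x).
Proof.
have [H [ip [Del [ipC _ _ cvg_ip]]]] := kjet_gram.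
have := cvg_ip x y al be; under eq_fun do rewrite ipC.
by move=> /(cvg_unique (@norm_hausdorff _ _)) /(_ (cvg_ip y x be al)).
Qed.

Definition jet_kernel (psi : idx -> 'rV[R]_d -> R) (z : 'rV[R]_d * 'rV[R]_d) : R :=
  \sum_al \sum_be kjet al be z * (psi al z.1 * psi be z.2).

(** The Gram sum is the limit of the inner products of a vector of H with itself, namely the
    weighted sum of the vectors [Phi n x]. *)
Lemma pos_def_jet_kernel psi : pos_def (jet_kernel psi).
Proof.
have [H [ip [Del [ipC ipD ip0 cvg_ip]]]] := kjet_gram.
split=> [x y|s].
  rewrite /jet_kernel exchange_big/=; apply: eq_bigr => al _; apply: eq_bigr => be _.
  by rewrite kjetC; congr (_ * _); rewrite mulrC.
have ip00 h : ip 0 h = 0.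
  by have := ipD 1 0 0 h; rewrite scaler0 addr0 mul1r; lra.
have ips (I : Type) (r : seq I) (c : I -> R) v h :
    ip (\sum_(p <- r) c p *: v p) h = \sum_(p <- r) c p * ip (v p) h.
  elim: r => [|p r IH]; first by rewrite !big_nil.
  by rewrite !big_cons ipD IH.
pose Phi n x : H := \sum_al psi al x *: Del n x al.
have ipPhi n x y : ip (Phi n x) (Phi n y) =
    \sum_al \sum_be ip (Del n x al) (Del n y be) * (psi al x * psi be y).
  rewrite ips; apply: eq_bigr => al _; rewrite ipC ips mulr_sumr.
  by apply: eq_bigr => be _; rewrite ipC; ring.
have cv : \sum_(p <- s) \sum_(q <- s) p.1 * q.1 * ip (Phi n p.2) (Phi n q.2) @[n --> \oo] -->
    gram (jet_kernel psi) s.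
  apply: cvg_sum_seq => p; apply: cvg_sum_seq => q; apply: cvgMr.
  under eq_fun do rewrite ipPhi.
  by apply: cvg_sum_seq => al; apply: cvg_sum_seq => be; apply: cvgMl; exact: cvg_ip.
apply: (cvgr_to_ge cv); apply: nearW => n.
have := ip0 (\sum_(p <- s) p.1 *: Phi n p.2); rewrite ips.
congr (_ <= _); apply: eq_bigr => p _; rewrite ipC ips mulr_sumr.
by apply: eq_bigr => q _; rewrite ipC mulrA.
Qed.

End ReproducingKernel.

(** * The Stein kernel *)

Lemma big_option (R : realType) (I : finType) (F : option I -> R) :
  \sum_o F o = F None + \sum_i F (Some i).
Proof.
rewrite (bigD1 None)//=; congr (_ + _).
rewrite (reindex_omap Some id) => [|[i|]]//.
by apply: eq_bigl => i /=; rewrite eqxx.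
Qed.

Section PartialDerivatives.
Context (R : realType) (V W : normedModType R).
Variables (f : V * W -> R) (x : V) (y : W).

Lemma is_derive_fst u : derivable f (x, y) (u, 0) ->
  is_derive x u (fun z => f (z, y)) ('D_(u, 0) f (x, y)).
Proof.
move=> df; have E : (fun h : R => h^-1 *: (((fun z => f (z, y)) \o shift x) (h *: u) - f (x, y)))
    = (fun h => h^-1 *: ((f \o shift (x, y)) (h *: (u, 0)) - f (x, y))).
  apply/funext => h /=; rewrite (_ : h *: (u, 0) + (x, y) = (h *: u + x, y))//.
  by rewrite -[LHS]/(h *: u + x, h *: 0 + y) scaler0 add0r.
by split; rewrite /derivable /derive E.
Qed.

Lemma is_derive_snd u : derivable f (x, y) (0, u) ->
  is_derive y u (fun z => f (x, z)) ('D_(0, u) f (x, y)).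
Proof.
move=> df; have E : (fun h : R => h^-1 *: (((fun z => f (x, z)) \o shift y) (h *: u) - f (x, y)))
    = (fun h => h^-1 *: ((f \o shift (x, y)) (h *: (0, u)) - f (x, y))).
  apply/funext => h /=; rewrite (_ : h *: (0, u) + (x, y) = (x, h *: u + y))//.
  by rewrite -[LHS]/(h *: 0 + x, h *: u + y) scaler0 add0r.
by split; rewrite /derivable /derive E.
Qed.

End PartialDerivatives.

Section SteinKernel.
Context (R : realType) (d : nat).
Variable X : set 'rV[R]_d.
Hypothesis oX : open X.

Lemma differentiable_ln (q : 'rV[R]_d -> R) x : 0 < q x -> differentiable q x ->
  differentiable (fun z => ln (q z)) x /\
  forall u, 'D_u (fun z => ln (q z)) x = (q x)^-1 * 'D_u q x.
Proof.
move=> qx dq; have := is_derive1_ln qx => dl.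
have dln : differentiable (@ln R) (q x) by apply/derivable1_diffP.
have dc : differentiable (@ln R \o q) x by exact: differentiable_comp.
split => // u; rewrite -[LHS]/('D_u (@ln R \o q) x) deriveE// diff_comp//= diff1E//.
rewrite derive1E; have [_ ->] := dl.
by rewrite -[LHS]/('d q x u * (q x)^-1) mulrC deriveE.
Qed.

(* The vector fields which the Stein kernel pairs with the derivatives of K:
   q^-1 div (q m) in the index None and the rows of m in the indices Some j. *)
Definition stein_feature (q : 'rV[R]_d -> R) (m : 'rV[R]_d -> 'M[R]_d)
    (al : option 'I_d * 'I_d) (x : 'rV[R]_d) : R :=
  if al.1 is Some j then m x j al.2
  else diff_score q m x al.2 0 + \sum_j ('D_(ebasis R j) m x) j al.2.

Section Formula.
Variables (K : 'rV[R]_d -> 'rV[R]_d -> 'M[R]_d).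
Variables (q : 'rV[R]_d -> R) (m : 'rV[R]_d -> 'M[R]_d).
Hypothesis dK : ndiff (@prod_basis R d d) 2 (X `*` X) (fun z => K z.1 z.2).
Hypothesis q0 : forall x, X x -> 0 < q x.
Hypothesis dq : forall x, X x -> differentiable q x.
Hypothesis dm : forall x, X x -> differentiable m x.

Let e i := ebasis R i : 'rV[R]_d.
Let U j a x := q x * ('D_(e j) m x) j a + m x j a * 'D_(e j) q x.

Let oXX : open (X `*` X).
Proof.
rewrite openE => -[x y] [/= Xx Yy]; exists (X, X) => //; split;
  exact: open_nbhs_nbhs.
Qed.

Let is_derive_qm j a x : X x -> is_derive x (e j) (fun z => q z * m z j a) (U j a x).
Proof.
move=> Xx; apply: is_derive_prod.
  by apply: DeriveDef => //; apply: diff_derivable; exact: dq.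
apply: DeriveDef; last by rewrite derive_entry//; exact: dm.
by apply: diff_derivable; apply: differentiable_entry; exact: dm.
Qed.

(** Since q times the gradient of ln q is the gradient of q, the factor q can be pulled out of the
    divergence of q m. *)
Let sum_U a x : X x -> \sum_j U j a x = q x * stein_feature q m (None, a) x.
Proof.
move=> Xx; rewrite /stein_feature /diff_score/= mulrDr big_split/= -mulr_sumr addrC.
congr (_ + _); rewrite !mxE mulr_sumr; apply: eq_bigr => j _.
rewrite [(m x)^T _ _]mxE [grad _ _ _ _]mxE (differentiable_ln (q0 Xx) (dq Xx)).2.
by have qx := q0 Xx; field; rewrite gt_eqF.
Qed.

Let ndK a b : ndiff (@prod_basis R d d) 2 (X `*` X) (kentry K a b).
Proof. exact: (ndiff_entry oXX a b dK). Qed.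

Let Kx j a b x y : X x -> X y -> is_derive x (e j) (fun z => K z y a b)
  (kderiv K (Some j) None a b (x, y)).
Proof.
move=> Xx Xy; apply: (@is_derive_fst _ _ _ (kentry K a b)).
by apply: diff_derivable; have [h _] := ndK a b; exact: h.
Qed.

Let Ky i a b x y : X x -> X y -> is_derive y (e i) (fun z => K x z a b)
  (kderiv K None (Some i) a b (x, y)).
Proof.
move=> Xx Xy; apply: (@is_derive_snd _ _ _ (kentry K a b)).
by apply: diff_derivable; have [h _] := ndK a b; exact: h.
Qed.

Let Kxy i j a b x y : X x -> X y -> is_derive y (e i)
  (fun z => kderiv K (Some j) None a b (x, z))
  (kderiv K (Some j) (Some i) a b (x, y)).
Proof.
move=> Xx Xy; apply: (@is_derive_snd _ _ _ (kderiv K (Some j) None a b)).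
by apply: diff_derivable; have [_ /(_ (inl j))[h _]] := ndK a b; exact: h.
Qed.

Let inner x y i : X x -> X y ->
  div_mx (fun x' => (q x' * q y) *: (m x' *m K x' y *m (m y)^T)) x i 0 =
  \sum_j \sum_b \sum_a (q y * m y i b) *
    ((q x * m x j a) * kderiv K (Some j) None a b (x, y) + K x y a b * U j a x).
Proof.
move=> Xx Xy; rewrite mxE; apply: eq_bigr => j _.
rewrite (_ : (fun z => _) = (fun z => \sum_b \sum_a (q y * m y i b) *
    ((q z * m z j a) * K z y a b))); last first.
  apply/funext => z; rewrite !mxE mulr_sumr; apply: eq_bigr => b _.
  rewrite !mxE mulr_suml mulr_sumr; apply: eq_bigr => a _; ring.
have [_ ->//] : is_derive x (e j) (fun z => \sum_b \sum_a (q y * m y i b) *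
    ((q z * m z j a) * K z y a b)) (\sum_b \sum_a (q y * m y i b) *
    ((q x * m x j a) * kderiv K (Some j) None a b (x, y) + K x y a b * U j a x)).
apply: is_derive_bigsum => b _; apply: is_derive_bigsum => a _; apply: is_derive_scale.
by apply: is_derive_prod; [exact: is_derive_qm|exact: Kx].
Qed.

Let outer x y i : X x -> X y ->
  'D_(e i) (fun y' => div_mx (fun x' => (q x' * q y') *: (m x' *m K x' y' *m (m y')^T)) x i 0) y =
  \sum_j \sum_b \sum_a ((q y * m y i b) *
      ((q x * m x j a) * kderiv K (Some j) (Some i) a b (x, y) +
       U j a x * kderiv K None (Some i) a b (x, y)) +
    ((q x * m x j a) * kderiv K (Some j) None a b (x, y) + U j a x * K x y a b) * U i b y).
Proof.
move=> Xx Xy; rewrite (derive_ext oX (g := fun y' => \sum_j \sum_b \sum_a (q y' * m y' i b) *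
    ((q x * m x j a) * kderiv K (Some j) None a b (x, y') + U j a x * K x y' a b)))//; last first.
  move=> z Xz; rewrite inner//; apply: eq_bigr => j _; apply: eq_bigr => b _.
  by apply: eq_bigr => a _; rewrite [U j a x * _]mulrC.
apply: derive_val.
apply: is_derive_bigsum => j _; apply: is_derive_bigsum => b _; apply: is_derive_bigsum => a _.
apply: is_derive_prod; first exact: is_derive_qm.
by apply: is_derive_add; apply: is_derive_scale; [exact: Kxy|exact: Ky].
Qed.

Let sum_expand4 (v A B C D u : 'I_d -> 'I_d -> R) :
  \sum_i \sum_j (v i j * (A i j + B i j) + (C i j + D i j) * u i j) =
  \sum_i \sum_j v i j * A i j + \sum_i \sum_j v i j * B i j +
  (\sum_i \sum_j C i j * u i j + \sum_i \sum_j D i j * u i j).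
Proof.
rewrite -!big_split; apply: eq_bigr => i _; rewrite -!big_split; apply: eq_bigr => j _ /=; ring.
Qed.

Let sumD (A B : 'I_d -> R) : \sum_i (A i + B i) = \sum_i A i + \sum_i B i.
Proof. exact: big_split. Qed.

(** In each variable the product rule lets the derivative fall either on q m, and the sum over its
    index is then q times the feature of index [None], or on K, which pairs the index [Some] with an
    entry of m. The four combinations are the four blocks of the double sum. *)
Lemma stein_kernelE x y : X x -> X y -> stein_kernel q m K x y =
  \sum_al \sum_be kderiv K al.1 be.1 al.2 be.2 (x, y) *
    (stein_feature q m al x * stein_feature q m be y).
Proof.
move=> Xx Xy; rewrite /stein_kernel /div_vec (eq_bigr _ (fun i _ => outer i Xx Xy)).
have qx := q0 Xx; have qy := q0 Xy.
have phiS j a z : stein_feature q m (Some j, a) z = m z j a by [].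
move: (stein_feature q m) phiS sum_U => phi phiS sU.
have -> : \sum_i \sum_j \sum_b \sum_a ((q y * m y i b) *
      ((q x * m x j a) * kderiv K (Some j) (Some i) a b (x, y) +
       U j a x * kderiv K None (Some i) a b (x, y)) +
    ((q x * m x j a) * kderiv K (Some j) None a b (x, y) + U j a x * K x y a b) * U i b y) =
  \sum_a \sum_b \sum_i \sum_j ((q y * m y i b) *
      ((q x * m x j a) * kderiv K (Some j) (Some i) a b (x, y) +
       U j a x * kderiv K None (Some i) a b (x, y)) +
    ((q x * m x j a) * kderiv K (Some j) None a b (x, y) + U j a x * K x y a b) * U i b y).
  under eq_bigr do rewrite exchange_big/=.
  rewrite exchange_big/=; under eq_bigr => b _.
    under eq_bigr do rewrite exchange_big/=.
    rewrite exchange_big/=; over.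
  by rewrite exchange_big.
have -> : \sum_al \sum_be kderiv K al.1 be.1 al.2 be.2 (x, y) * (phi al x * phi be y) =
  \sum_a \sum_b \sum_o \sum_o' kderiv K o o' a b (x, y) * (phi (o, a) x * phi (o', b) y).
  transitivity (\sum_al \sum_be kderiv K al.1 be.1 al.2 be.2 (x, y) *
      (phi (al.1, al.2) x * phi (be.1, be.2) y)).
    by apply: eq_bigr => -[p a] _; apply: eq_bigr => -[p' b] _.
  rewrite -(pair_bigA _ (fun o a => \sum_be kderiv K o be.1 a be.2 (x, y) *
      (phi (o, a) x * phi (be.1, be.2) y)))/=.
  rewrite exchange_big/=; apply: eq_bigr => a _.
  rewrite [RHS]exchange_big/=; apply: eq_bigr => o _.
  rewrite -(pair_bigA _ (fun o' b => kderiv K o o' a b (x, y) * (phi (o, a) x * phi (o', b) y)))/=.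
  by rewrite exchange_big.
rewrite mulr_sumr; apply: eq_bigr => a _; rewrite mulr_sumr; apply: eq_bigr => b _.
rewrite !big_option (eq_bigr _ (fun j _ => big_option _)).
rewrite [X in _ * X]sum_expand4 !mulrDr [X in _ = _ + X]sumD.
have -> : (q x * q y)^-1 * \sum_i \sum_j q y * m y i b * (q x * m x j a * kderiv K (Some j) (Some i) a b (x, y)) =
   \sum_j \sum_i kderiv K (Some j) (Some i) a b (x, y) * (phi (Some j, a) x * phi (Some i, b) y).
  rewrite exchange_big/= mulr_sumr; apply: eq_bigr => j _; rewrite mulr_sumr; apply: eq_bigr => i _.
  by rewrite !phiS; field; rewrite !gt_eqF.
have -> : (q x * q y)^-1 * \sum_i \sum_j q y * m y i b * (U j a x * kderiv K None (Some i) a b (x, y)) =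
   \sum_i kderiv K None (Some i) a b (x, y) * (phi (None, a) x * phi (Some i, b) y).
  rewrite mulr_sumr; apply: eq_bigr => i _; rewrite -mulr_sumr -mulr_suml sU// phiS.
  by field; rewrite !gt_eqF.
have -> : (q x * q y)^-1 * \sum_i \sum_j q x * m x j a * kderiv K (Some j) None a b (x, y) * U i b y =
   \sum_j kderiv K (Some j) None a b (x, y) * (phi (Some j, a) x * phi (None, b) y).
  rewrite exchange_big/= mulr_sumr; apply: eq_bigr => j _; rewrite -mulr_sumr sU// phiS.
  by field; rewrite !gt_eqF.
have -> : (q x * q y)^-1 * \sum_i \sum_j U j a x * K x y a b * U i b y =
   kderiv K None None a b (x, y) * (phi (None, a) x * phi (None, b) y).
  under eq_bigr do rewrite -!mulr_suml sU//.
  rewrite -mulr_sumr sU// -[K x y a b]/(kderiv K None None a b (x, y)).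
  by field; rewrite !gt_eqF.
by ring.
Qed.

End Formula.

Section Measurability.
Variables (q : 'rV[R]_d -> R) (m : 'rV[R]_d -> 'M[R]_d).
Hypothesis q0 : forall x, X x -> 0 < q x.
Hypothesis dq : forall x, X x -> differentiable q x.
Hypothesis dm : forall x, X x -> differentiable m x.

Let mX : measurable X. Proof. exact: open_measurable_rV. Qed.

Let measurable_diff (f : 'rV[R]_d -> R) : (forall x, X x -> differentiable f x) ->
  measurable_fun setT (fun x => \1_X x * f x).
Proof.
move=> df; apply: measurable_indicM => //; apply: measurable_fun_continuous_in => // x Xx.
by apply: differentiable_continuous; exact: df.
Qed.

Let measurable_diffD (f : 'rV[R]_d -> R) u : (forall x, X x -> differentiable f x) ->
  measurable_fun setT (fun x => \1_X x * 'D_u f x).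
Proof.
move=> df; apply: (@measurable_difference_limit _ _ _ X
  (fun n (x : 'rV[R]_d) => x + n.+1%:R^-1 *: u) f ('D_u f)) => //.
- by move=> n; exact: measurable_shift.
- exact: measurable_diff.
- by move=> z Xz; apply: (@cvg_shrink _ _ z u); exact: open_nbhs_nbhs.
- by move=> z Xz; apply: cvg_firstdiff; apply: diff_derivable; exact: df.
Qed.

Lemma measurable_stein_feature al :
  measurable_fun setT (fun x => \1_X x * stein_feature q m al x).
Proof.
have dme j a x : X x -> differentiable (fun z => m z j a) x.
  by move=> Xx; apply: differentiable_entry; exact: dm.
case: al => [[j|] a]; rewrite /stein_feature/=; first exact: (measurable_diff (dme j a)).
rewrite (_ : (fun x => _) = (fun x =>
  \sum_i ((\1_X x * m x i a) * (\1_X x * 'D_(ebasis R i) (fun z => ln (q z)) x)) +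
  \sum_j (\1_X x * 'D_(ebasis R j) (fun z => m z j a) x))).
  apply: measurable_funD; apply: measurable_sum => i.
    apply: measurable_funM; first exact: (measurable_diff (dme i a)).
    by apply: measurable_diffD => x Xx; exact: (differentiable_ln (q0 Xx) (dq Xx)).1.
  exact: (measurable_diffD _ (dme i a)).
apply/funext => x; have [Xx|Xx] := pselect (X x); last first.
  rewrite (indic0 R Xx) mul0r !big1 ?addr0// => i _; by rewrite !mul0r.
rewrite (indic1 R Xx) mul1r /diff_score !mxE; congr (_ + _); apply: eq_bigr => j _.
  by rewrite !mxE !mul1r.
by rewrite mul1r derive_entry//; exact: dm.
Qed.

End Measurability.

End SteinKernel.

(** * Integrals of functions modified on a null set *)

Section LowerIntegral.
Context d (T : measurableType d) (R : realType) (mu : {measure set T -> \bar R}).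
Import HBNNSimple.

(** A simple function below f, cut to 0 on N, is below g and has the same integral. The supremum
    over simple functions gives the inequality. *)
Let ge0_integral_le_off_null (N : set T) (f g : T -> \bar R) :
  measurable N -> mu N = 0%E -> (forall x, (0 <= f x)%E) -> (forall x, (0 <= g x)%E) ->
  (forall x, ~ N x -> f x = g x) -> (\int[mu]_x f x <= \int[mu]_x g x)%E.
Proof.
move=> mN N0 f0 g0 fg; rewrite !ge0_integralTE//.
apply: ge_ereal_sup => _ [h /= hf <-].
have mNC := measurableC mN; pose h' := proj_nnsfun h mNC.
have h'E x : h' x = h x * \1_(~` N) x by [].
apply: ereal_sup_ubound; exists h' => /=.
  move=> x; rewrite -[h x * _]/(h x * \1_(~` N) x); have [Nx|Nx] := pselect (N x).
    by rewrite indic0 ?mulr0//=; exact: g0.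
  by rewrite indic1// mulr1 -fg.
rewrite -!integralT_nnsfun; apply: ae_eq_integral => //.
- exact/measurable_EFinP.
- exact/measurable_EFinP.
- exists N; split => // x /= hx; apply: contrapT => Nx; apply: hx => _.
  by rewrite -[(h x * _)%R]/(h x * \1_(~` N) x)%R indic1// mulr1.
Qed.

(* No measurability of f or g is needed, integrals being lower integrals. *)
Lemma integral_eq_off_null (N : set T) (f g : T -> \bar R) :
  measurable N -> mu N = 0%E -> (forall x, ~ N x -> f x = g x) ->
  (\int[mu]_x f x = \int[mu]_x g x)%E.
Proof.
move=> mN N0 fg; rewrite integralE [in RHS]integralE; congr (_ - _)%E.
  by apply/eqP; rewrite eq_le !(ge0_integral_le_off_null mN N0)// => x Nx;
    rewrite !funeposE fg.
by apply/eqP; rewrite eq_le !(ge0_integral_le_off_null mN N0)// => x Nx;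
  rewrite !funenegE fg.
Qed.

(** The difference of the integrals of the positive and negative parts is finite only if both are,
    since every difference involving an infinity is infinite by convention. *)
Lemma L1_fin_num (f : T -> R) : measurable_fun setT f ->
  (\int[mu]_x (f x)%:E)%E \is a fin_num -> L1 mu f.
Proof.
move=> mf; have mF : measurable_fun setT (EFin \o f) by exact/measurable_EFinP.
rewrite integralE -[X in (X - _)%E]/(\int[mu]_x (EFin \o f)^\+ x)%E
  -[X in (_ - X)%E]/(\int[mu]_x (EFin \o f)^\- x)%E => h.
apply/integrableP; split=> //.
rewrite -[fun x => _]/(abse \o (EFin \o f)) fune_abse.
rewrite ge0_integralD//; [|exact: measurable_funepos|exact: measurable_funeneg].
have : (0 <= \int[mu]_x (EFin \o f)^\+ x)%E by exact: integral_ge0.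
have : (0 <= \int[mu]_x (EFin \o f)^\- x)%E by exact: integral_ge0.
move: (integral _ _ _) (integral _ _ _) h => a b.
by case: a b => [a| |] [b| |] //=; rewrite ltry.
Qed.

End LowerIntegral.

Section NearPairs.
Context (R : realType) (V W : normedModType R) (x : V) (y : W) (A : set (V * W)).

Lemma near_pair_l : (\forall z \near (x, y), A z) -> \forall s \near x, A (s, y).
Proof.
have h : (fun s : V => (s, y)) @ x --> (x, y) by apply: cvg_pair; [exact: cvg_id|exact: cvg_cst].
by move=> nA; exact: h nA.
Qed.

Lemma near_pair_r : (\forall z \near (x, y), A z) -> \forall s \near y, A (x, s).
Proof.
have h : (fun s : W => (x, s)) @ y --> (x, y) by apply: cvg_pair; [exact: cvg_cst|exact: cvg_id].
by move=> nA; exact: h nA.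
Qed.

Lemma near_snd (B : set W) : (\forall s \near y, B s) -> \forall z \near (x, y), B z.2.
Proof. by move=> nB; exact: (@cvg_snd _ _ (nbhs x) (nbhs y)) nB. Qed.

End NearPairs.

(** * Second derivatives of a nonnegative function vanishing on the diagonal *)

Section DiscrepancyCalculus.
Context (R : realType) (V : normedModType R).
Variables (F : V * V -> R) (ts : V).
Hypothesis dF : \forall z \near (ts, ts), differentiable F z.
Hypothesis F0 : \forall z \near (ts, ts), 0 <= F z.
Hypothesis Fdiag : \forall t \near ts, F (t, t) = 0.

Let cvg_diag : (fun a : V => (a, a)) @ ts --> (ts, ts).
Proof. by apply: cvg_pair; exact: cvg_id. Qed.

Let near_r : \forall t \near ts, differentiable F (ts, t). Proof. exact: near_pair_r dF. Qed.

Let near_l : \forall t \near ts, differentiable F (t, ts). Proof. exact: near_pair_l dF. Qed.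

Let near_diag : \forall t \near ts, differentiable F (t, t). Proof. exact: cvg_diag dF. Qed.

Let near_diag0 : \forall t \near ts, \forall z \near (t, t), 0 <= F z.
Proof. exact: cvg_diag (nbhs_interior F0). Qed.

Lemma derivative_diag v : \forall a \near ts, 'D_(0, v) F (a, a) = 0.
Proof.
apply: filterS3 near_diag near_diag0 Fdiag => a /= da Fa0 Faa.
have D := is_derive_snd (diff_derivable (v := (0, v)) da).
rewrite -(derive_val (is_derive := D)).
apply: (@local_min_derive0 _ _ (fun z => F (a, z)) a v); first by have [] := D.
rewrite Faa.
have ca : (fun z : V => (a, z)) @ a --> (a, a).
  by apply: cvg_pair; [exact: cvg_cst|exact: cvg_id].
by have := ca _ Fa0.
Qed.

Lemma differentiable_second : \forall t \near ts, differentiable (fun s => F (ts, s)) t.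
Proof.
apply: filterS near_r => t /= dt.
by apply: (differentiable_comp (f := fun s => (ts, s))).
Qed.

Lemma derive_second v : \forall t \near ts,
  'D_(0, v) F (ts, t) = 'D_v (fun s => F (ts, s)) t.
Proof.
apply: filterS near_r => t /= dt.
by rewrite (derive_val (is_derive := is_derive_snd (diff_derivable (v := (0, v)) dt))).
Qed.

Section SecondDerivatives.
Variable v : V.
Hypothesis ddF : differentiable ('D_(0, v) F) (ts, ts).

Lemma differentiable_derive_second : differentiable ('D_v (fun s => F (ts, s))) ts.
Proof.
apply: (@differentiable_ext _ _ (fun t => 'D_(0, v) F (ts, t))).
  exact: derive_second.
by apply: (differentiable_comp (f := fun s => (ts, s)) (g := 'D_(0, v) F)).
Qed.

(* Differentiating D_(0, v) F (a, a) = 0 along the diagonal. *)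
Lemma hessian_second u : 'D_u ('D_v (fun s => F (ts, s))) ts =
  - 'D_u (fun a => 'D_v (fun s => F (a, s)) ts) ts.
Proof.
pose h := 'D_(0, v) F.
have -> : 'D_u ('D_v (fun s => F (ts, s))) ts = 'D_(0, u) h (ts, ts).
  rewrite -(near_eq_derive _ (derive_second v)).
  exact: (derive_val (is_derive := is_derive_snd (diff_derivable (v := (0, u)) ddF))).
have -> : 'D_u (fun a => 'D_v (fun s => F (a, s)) ts) ts = 'D_(u, 0) h (ts, ts).
  transitivity ('D_u (fun a => h (a, ts)) ts).
    apply: near_eq_derive; apply: filterS near_l => t /= dt.
    exact: (derive_val (is_derive := is_derive_snd (diff_derivable (v := (0, v)) dt))).
  exact: (derive_val (is_derive := is_derive_fst (diff_derivable (v := (u, 0)) ddF))).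
have dd : differentiable (fun a : V => (a, a)) ts by exact: differentiable_pair.
have dc : differentiable (h \o fun a : V => (a, a)) ts by exact: differentiable_comp.
have : 'D_u (h \o fun a : V => (a, a)) ts = 0.
  by rewrite (near_eq_derive _ (derivative_diag v)) derive_cst.
rewrite deriveE// diff_comp//= diff_pair// diff_val (_ : (u, u) = (u, 0) + (0, u)).
  by rewrite linearD/= -!deriveE// => /eqP; rewrite addrC addr_eq0 => /eqP.
by rewrite -[RHS]/(u + 0, 0 + u) addr0 add0r.
Qed.

End SecondDerivatives.

End DiscrepancyCalculus.

Section DiscrepancyKernel.
Context (R : realType) (d : nat).
Variables (X : set 'rV[R]_d) (K : 'rV[R]_d -> 'rV[R]_d -> 'M[R]_d) (B : R).
Hypothesis oX : open X.
Hypothesis rK : reproducing_kernel X K.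
Hypothesis dK : ndiff (@prod_basis R d d) 2 (X `*` X) (fun z => K z.1 z.2).
Variables (q : 'rV[R]_d -> R) (m : 'rV[R]_d -> 'M[R]_d).
Hypothesis q0 : forall x, X x -> 0 < q x.
Hypothesis dq : forall x, X x -> differentiable q x.
Hypothesis dm : forall x, X x -> differentiable m x.
Variable P : probability 'rV[R]_d R.

Let h := jet_kernel X K (stein_feature q m).

Lemma stein_kernel_jetE x y : X x -> X y -> stein_kernel q m K x y = h (x, y).
Proof.
move=> Xx Xy; rewrite (stein_kernelE oX dK q0 dq dm)//.
apply: eq_bigr => al _; apply: eq_bigr => be _.
by rewrite /kjet (@indic1 _ _ (X `*` X)) ?mul1r//; split.
Qed.

Lemma measurable_jet_kernel : measurable_fun setT h.
Proof.
rewrite (_ : h = (fun z => \sum_al \sum_be kjet X K al be z *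
    ((\1_X z.1 * stein_feature q m al z.1) * (\1_X z.2 * stein_feature q m be z.2)))).
  apply: measurable_sum => al; apply: measurable_sum => be.
  apply: measurable_funM; first exact: measurable_kjet.
  apply: measurable_funM.
    by apply: (measurableT_comp (measurable_stein_feature oX q0 dq dm al)).
  by apply: (measurableT_comp (measurable_stein_feature oX q0 dq dm be)).
apply/funext => z; apply: eq_bigr => al _; apply: eq_bigr => be _.
have [[Xx Xy]|Xz] := pselect ((X `*` X) z); last by rewrite /kjet indic0// !mul0r.
by rewrite !(indic1 _ Xx) !(indic1 _ Xy) !mul1r.
Qed.

(** The jets of K being 0 outside X * X, the integral over that set becomes one over the whole
    space, of a kernel that is measurable and positive definite everywhere. *)
Lemma dksd2E : dksd2 X (stein_kernel q m K) P = (\int[(P \x P)%E]_z (h z)%:E)%E.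
Proof.
rewrite /dksd2 integral_mkcond; apply: eq_integral => -[x y] _.
rewrite patchE; case: ifPn => [|] /=; first by rewrite inE => -[Xx Xy]; rewrite stein_kernel_jetE.
rewrite notin_setE => Xz; rewrite /h /jet_kernel big1// => al _.
by apply: big1 => be _; rewrite /kjet (indic0 R Xz) !mul0r.
Qed.

Lemma L1_jet_kernel : dksd2 X (stein_kernel q m K) P \is a fin_num -> L1 (P \x P)%E h.
Proof. by rewrite dksd2E; apply: L1_fin_num; exact: measurable_jet_kernel. Qed.

Lemma dksd2_ge0 : dksd2 X (stein_kernel q m K) P \is a fin_num ->
  0 <= fine (dksd2 X (stein_kernel q m K) P).
Proof.
move=> fn; rewrite dksd2E -[fine _]/(\int[(P \x P)%E]_z h z).
by apply: pos_def_expectation_ge0; [exact: L1_jet_kernel|exact: pos_def_jet_kernel].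
Qed.

End DiscrepancyKernel.

Section FeatureRegularity.
Context (R : realType) (d r : nat).
Variables (A : set 'rV[R]_r) (x : 'rV[R]_d).
Variables (p : 'rV[R]_r -> 'rV[R]_d -> R) (m : 'rV[R]_r -> 'rV[R]_d -> 'M[R]_d).
Hypothesis oA : open A.

Let s t := diff_score (p t) (m t) x.
Let mt t := m t x.
Let dm j t := 'D_(ebasis R j) (m t) x.
Let e := @ebasis R r.

Hypothesis nds : ndiff e 3 A s.
Hypothesis ndm : ndiff e 3 A mt.
Hypothesis nddm : forall j, ndiff e 3 A (dm j).

Lemma ndiff_stein_feature al : ndiff e 3 A (fun t => stein_feature (p t) (m t) al x).
Proof.
case: al => -[j|] a; first exact: (ndiff_entry oA j a ndm).
apply: (ndiffD oA); first exact: (ndiff_entry oA a 0 nds).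
by apply: (ndiff_sum oA) => j; exact: (ndiff_entry oA j a (nddm j)).
Qed.

Lemma dnorm_stein_feature_le al k t : ndiff e k A s -> ndiff e k A mt ->
  (forall j, ndiff e k A (dm j)) -> A t ->
  dnorm e k (fun t => stein_feature (p t) (m t) al x) t <=
  dnorm e k s t + (dnorm e k mt t + \sum_j dnorm e k (dm j) t).
Proof.
move=> hs hm hdm At; case: al => -[j|] a /=.
  apply: (le_trans (dnorm_entry_le oA j a hm At)).
  rewrite addrCA lerDl addr_ge0 ?dnorm_ge0// sumr_ge0// => i _; exact: dnorm_ge0.
have h1 : ndiff e k A (fun t => s t a 0) by exact: (ndiff_entry oA).
have h2 i : ndiff e k A (fun t => dm i t i a) by exact: (ndiff_entry oA).
apply: (le_trans (dnormD_le oA h1 (ndiff_sum oA h2) At)).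
apply: lerD; first exact: (dnorm_entry_le oA).
apply: (@le_trans _ _ (\sum_j dnorm e k (dm j) t)); last by rewrite lerDr dnorm_ge0.
apply: (le_trans (dnorm_sum_le oA h2 At)); apply: ler_sum => i _.
exact: (dnorm_entry_le oA).
Qed.

End FeatureRegularity.

Section SmoothKernelMinimization.
Context d d' (T : measurableType d) (S : measurableType d') (R : realType).
Context (Pr : probability T R) (Q : probability S R).
Variable X : nat -> {RV Pr >-> S}.
Hypothesis iidX : iid Q X.
Variables (r : nat) (A : finType) (ts : 'rV[R]_r) (rho : R).
Variables (psi : A -> 'rV[R]_r -> S -> R) (KK : A -> A -> S * S -> R).
Variables (F G : S -> R) (C : R).
Hypothesis rho0 : 0 < rho.
Hypothesis KKb : forall a b z, `|KK a b z| <= C.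
Hypothesis mKK : forall a b, measurable_fun setT (KK a b).
Hypothesis KKC : forall a b x y, KK a b (x, y) = KK b a (y, x).
Hypothesis mpsi : forall a t, ball ts rho t -> measurable_fun setT (psi a t).
Hypothesis ndpsi : forall a x, ndiff (@ebasis R r) 3 (ball ts rho) (psi a ^~ x).
Hypothesis dn01 : forall a x t, ball ts rho t ->
  dnorm (@ebasis R r) 0 (psi a ^~ x) t + dnorm (@ebasis R r) 1 (psi a ^~ x) t <= F x.
Hypothesis dn23 : forall a x t, ball ts rho t ->
  dnorm (@ebasis R r) 2 (psi a ^~ x) t + dnorm (@ebasis R r) 3 (psi a ^~ x) t <= G x.
Hypothesis mF : measurable_fun setT F.
Hypothesis F2 : L1 Q (fun x => F x ^+ 2).
Hypothesis lG : L1 Q G.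
Hypothesis F0 : forall x, 0 <= F x.
Hypothesis G0 : forall x, 0 <= G x.
Hypothesis C0 : 0 <= C.
Variables (Phi : 'rV[R]_r -> R) (g : 'M[R]_r) (that : nat -> {RV Pr >-> 'rV[R]_r}).

Let k := skernel psi KK.
Let k1 := skernel1 psi KK.

Hypothesis PhiE : forall t, ball ts rho t -> Phi t = \int[(Q \x Q)%E]_z k t z.
Hypothesis dPhi : \forall t \near ts, differentiable Phi t.
Hypothesis ddPhi : forall j, differentiable ('D_(ebasis R j) Phi) ts.
Hypothesis minPhi : \forall t \near ts, Phi ts <= Phi t.
Hypothesis hessian : forall i j, 'D_(ebasis R i) ('D_(ebasis R j) Phi) ts = 2 * g i j.
Hypothesis gu : g \in unitmx.
Hypothesis consistent : op1 Pr (fun n w => `|that n w - ts|).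
Hypothesis argm : whp Pr (fun n => [set w |
  \forall t \near that n w, usum X (k (that n w)) n w <= usum X (k t) n w]).

Theorem smooth_kernel_minimization : exists nu : probability 'rV[R]_r R,
  is_normal 0 (invmx g *m
    (\matrix_(i, j) \int[Q]_x (marginal Q (k1 i ts) x * marginal Q (k1 j ts) x))
    *m invmx g) nu /\
  cvg_in_distribution Pr (fun n w => Num.sqrt n%:R *: (that n w - ts)) nu.
Proof.
have B0 : ball ts rho ts by exact: ballxx.
(* The constant of [skernel1_le]. Its square root is put into each factor, since the Hoeffding
   decomposition wants a majorant of the form G(x) G(y). *)
pose M : R := #|A|%:R ^+ 2 * (C * 2).
have M0 : 0 <= M by rewrite !mulr_ge0 ?sqr_ge0.
have sM : Num.sqrt M * Num.sqrt M = M by rewrite -expr2 sqr_sqrtr.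
have lk t : ball ts rho t -> L1 (Q \x Q)%E (k t).
  exact: (L1_skernel KKb mKK mpsi dn01 mF F2).
have mk1 j : measurable_fun setT (k1 j ts).
  exact: (measurable_skernel1 mKK mpsi ndpsi).
have mG' : measurable_fun setT (fun x => Num.sqrt M * F x) by exact: measurable_funM.
have G2 : L1 Q (fun x => (Num.sqrt M * F x) ^+ 2).
  rewrite (_ : (fun x => (Num.sqrt M * F x) ^+ 2) = (fun x => M * F x ^+ 2)).
    exact: L1Z.
  by apply/funext => x; rewrite exprMn expr2 sM.
have k1G j x y : `|k1 j ts (x, y)| <= Num.sqrt M * F x * (Num.sqrt M * F y).
  apply: (le_trans (skernel1_le KKb dn01 j (x, y) B0)).
  by rewrite [leRHS]mulrACA sM /M !mulrA.
exact: (kernel_minimization iidX rho0 lk mk1 mG' G2 k1G (skernel1C psi KKC ^~ ts)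
  (L1_skernel2 rho0 KKb mKK mpsi ndpsi dn01 dn23 mF F2 lG) (skernel2C ts psi KKC)
  (skernel2_sym KK rho0 ndpsi) (L1_skernelL r A C mF F2 lG) (skernelL_ge0 r A F0 G0 C0)
  (fun t u z => is_derive_skernel KK ndpsi (t := t) u z)
  (fun j dl z => skernel1_expansion rho0 KKb ndpsi dn01 dn23 j (dl := dl) z)
  (fun dl z => skernel_expansion rho0 KKb ndpsi dn01 dn23 F0 G0 C0 (dl := dl) z)
  PhiE dPhi ddPhi minPhi hessian gu consistent argm).
Qed.

End SmoothKernelMinimization.

(** * Minimum Stein discrepancy estimators *)

Lemma cvg_in_probability_op1 (R : realType) (dT : measure_display) (T : measurableType dT)
    (Pr : probability T R) (r : nat) (Y : nat -> {RV Pr >-> 'rV[R]_r}) (l : 'rV[R]_r) :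
  cvg_in_probability Pr (fun n => Y n : T -> 'rV[R]_r) l ->
  op1 Pr (fun n w => `|Y n w - l|).
Proof.
move=> cY eps eps0 q q0.
have mA n : measurable [set w | eps <= `|Y n w - l|].
  have mY : measurable_fun setT (fun w => Y n w - l).
    by apply: (measurableT_comp (measurable_shift (- l))); exact: measurable_funP.
  exact: (measurable_preimage mY (measurable_norm_ge eps)).
have := cY _ eps0 => /fine_cvgP[_ /cvgr_lt/(_ _ q0)].
apply: filterS => n h; exists [set w | eps <= `|Y n w - l|]; first split => //.
  by move=> w /=; rewrite normr_id => /negP; rewrite -ltNge => /ltW.
rewrite -[leLHS]fineK ?fin_num_measure// lee_fin; exact: ltW.
Qed.

Section MinimumStein.
Context (R : realType) (d r : nat).
Variables (X : set 'rV[R]_d) (Theta : set 'rV[R]_r).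
Variable P : 'rV[R]_r -> probability 'rV[R]_d R.
Variables (p : 'rV[R]_r -> 'rV[R]_d -> R) (m : 'rV[R]_r -> 'rV[R]_d -> 'M[R]_d).
Variables (K : 'rV[R]_d -> 'rV[R]_d -> 'M[R]_d) (ts : 'rV[R]_r).
Context (dT : measure_display) (T : measurableType dT) (Pr : probability T R).
Variables (Xs : nat -> {RV Pr >-> 'rV[R]_d}) (that : nat -> {RV Pr >-> 'rV[R]_r}).

Let Q := P ts.
Let k0 t := stein_kernel (p t) (m t) K.
Let DKSD2 a t := dksd2 X (k0 t) (P a).
Let g := info_tensor (fun a t => fine (DKSD2 a t)) ts.
Let e i := ebasis R i : 'rV[R]_r.

Hypothesis oX : open X.
Hypothesis oTheta : open Theta.
Hypothesis p0 : forall t, Theta t -> forall x, X x -> 0 < p t x.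
Hypothesis dp : forall t, Theta t -> forall x, X x -> differentiable (p t) x.
Hypothesis dm : forall t, Theta t -> forall x, X x -> differentiable (m t) x.
Hypothesis rK : reproducing_kernel X K.
Hypothesis dK : ndiff (@prod_basis R d d) 2 (X `*` X) (fun z => K z.1 z.2).
Variable B : R.
Hypothesis KB : forall k x y, (k <= 2)%N -> X x -> X y ->
  dnorm (@prod_basis R d d) k (fun z => K z.1 z.2) (x, y) <= B.

Section Discrepancy.
Hypothesis argmin_ts : argmin Theta (fun t => DKSD2 ts t) = [set ts].
Hypothesis DKSD2_diag : \forall t \near ts, DKSD2 t t = 0%E.
Variable U : set ('rV[R]_r * 'rV[R]_r).
Hypothesis nU : nbhs (ts, ts) U.
Hypothesis finU : forall z, U z -> DKSD2 z.1 z.2 \is a fin_num.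
Hypothesis dU : cndiff (@prod_basis R r r) 2 U (fun z => fine (DKSD2 z.1 z.2)).

Let F z := fine (DKSD2 z.1 z.2).

Let Theta_ts : Theta ts.
Proof.
have : argmin Theta (fun t => DKSD2 ts t) ts by rewrite argmin_ts.
by case.
Qed.

Let near_Theta : \forall t \near ts, Theta t.
Proof. exact: open_nbhs_nbhs. Qed.

Let dF : \forall z \near (ts, ts), differentiable F z.
Proof. by apply: filterS nU => z; have [h _] := dU; exact: h. Qed.

Let ddF j : differentiable ('D_(0, e j) F) (ts, ts).
Proof.
have [_ /(_ (inr j))[h _]] := dU; apply: h; exact: nbhs_singleton nU.
Qed.

Let F0 : \forall z \near (ts, ts), 0 <= F z.
Proof.
apply: filterS2 nU (near_snd ts near_Theta) => z Uz Tz.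
by apply: (dksd2_ge0 oX rK dK (p0 Tz) (dp Tz) (dm Tz)); exact: finU.
Qed.

Let Fdiag : \forall t \near ts, F (t, t) = 0.
Proof. by apply: filterS DKSD2_diag => t; rewrite /F/= => ->. Qed.

Lemma differentiable_dksd2 : \forall t \near ts, differentiable (fun s => fine (DKSD2 ts s)) t.
Proof. exact: (differentiable_second dF). Qed.

Lemma differentiable_derive_dksd2 j :
  differentiable ('D_(e j) (fun s => fine (DKSD2 ts s))) ts.
Proof. exact: (differentiable_derive_second dF (ddF j)). Qed.

Lemma hessian_dksd2 i j : 'D_(e i) ('D_(e j) (fun s => fine (DKSD2 ts s))) ts = 2 * g i j.
Proof.
rewrite [LHS](hessian_second dF F0 Fdiag (ddF j)) mxE.
by rewrite mulrA mulrN mulfV// mulN1r.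
Qed.

Lemma min_dksd2 : \forall t \near ts, fine (DKSD2 ts ts) <= fine (DKSD2 ts t).
Proof.
apply: filterS2 (near_pair_r nU) near_Theta => t Ut Tt.
apply: fine_le; [exact: (finU (nbhs_singleton nU))|exact: (finU Ut)|].
have [_ h] : argmin Theta (fun t => DKSD2 ts t) ts by rewrite argmin_ts.
exact: h.
Qed.

End Discrepancy.

(** * Restriction to the points where the regularity hypotheses hold *)

Section GoodPoints.
Variables (X0 : set 'rV[R]_d) (rho : R) (F G : 'rV[R]_d -> R).
Hypothesis mX0 : measurable X0.
Hypothesis X0X : X0 `<=` X.
Hypothesis QX0 : Q (~` X0) = 0%E.
Hypothesis rho0 : 0 < rho.
Hypothesis ball_Theta : ball ts rho `<=` Theta.

Let idx : finType := (option 'I_d * 'I_d)%type.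
Let feature (al : idx) t x := stein_feature (p t) (m t) al x.

Hypothesis nd : forall al x, X0 x -> ndiff (@ebasis R r) 3 (ball ts rho) (feature al ^~ x).
Hypothesis dn01 : forall al x t, X0 x -> ball ts rho t ->
  dnorm (@ebasis R r) 0 (feature al ^~ x) t + dnorm (@ebasis R r) 1 (feature al ^~ x) t <= F x.
Hypothesis dn23 : forall al x t, X0 x -> ball ts rho t ->
  dnorm (@ebasis R r) 2 (feature al ^~ x) t + dnorm (@ebasis R r) 3 (feature al ^~ x) t <= G x.

(** Set to 0 outside X0, the features are smooth and bounded by the majorants at every x, while the
    kernel is unchanged for almost every pair of observations. *)
Let psi al t x := \1_X0 x * feature al t x.
Let oB : open (ball ts rho).
Proof. exact: ball_open. Qed.

Let psi1 al x t : X0 x -> psi al t x = feature al t x.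
Proof. by move=> X0x; rewrite /psi (indic1 R X0x) mul1r. Qed.

Let psi0 al x t : ~ X0 x -> psi al t x = 0.
Proof. by move=> X0x; rewrite /psi (indic0 R X0x) mul0r. Qed.

Lemma measurable_patched al t : ball ts rho t -> measurable_fun setT (psi al t).
Proof.
move=> Bt; have Tt := ball_Theta Bt.
rewrite (_ : psi al t = (fun x => \1_X0 x * (\1_X x * feature al t x))).
  apply: measurable_funM; first exact: measurable_indic.
  exact: (measurable_stein_feature oX (p0 Tt) (dp Tt) (dm Tt)).
apply/funext => x; have [X0x|X0x] := pselect (X0 x); last by rewrite psi0// indic0// mul0r.
by rewrite psi1// (indic1 R X0x) (indic1 R (X0X X0x)) !mul1r.
Qed.

Lemma ndiff_patched al x : ndiff (@ebasis R r) 3 (ball ts rho) (psi al ^~ x).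
Proof.
have [X0x|X0x] := pselect (X0 x).
  by apply: (ndiff_ext oB _ (nd al X0x)) => t _; rewrite psi1.
by apply: (ndiff_ext oB _ (ndiff_cst _ oB _ 0)) => t _; rewrite psi0.
Qed.

Lemma dnorm_patched al x k t : ball ts rho t ->
  dnorm (@ebasis R r) k (psi al ^~ x) t = \1_X0 x * dnorm (@ebasis R r) k (feature al ^~ x) t.
Proof.
move=> Bt; have [X0x|X0x] := pselect (X0 x).
  by rewrite (indic1 R X0x) mul1r; apply: (dnorm_ext _ oB _ _ Bt) => s _; rewrite psi1.
rewrite (indic0 R X0x) mul0r -(dnorm_cst0 (@ebasis R r) k t).
by apply: (dnorm_ext _ oB _ _ Bt) => s _; rewrite psi0.
Qed.

Let KK := kjet X K.

Lemma patched_kernelE t x y : ball ts rho t -> X0 x -> X0 y ->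
  skernel psi KK t (x, y) = k0 t x y.
Proof.
move=> Bt X0x X0y; have Tt := ball_Theta Bt.
rewrite [RHS](stein_kernel_jetE oX dK (p0 Tt) (dp Tt) (dm Tt) (X0X X0x) (X0X X0y)).
by apply: eq_bigr => al _; apply: eq_bigr => be _; rewrite /= !psi1.
Qed.

Let QX0_1 : Q X0 = 1%E.
Proof.
rewrite -[X0]setCK probability_setC; last exact: measurableC.
by rewrite QX0 sube0.
Qed.

Let QQX0 : (Q \x Q)%E (~` (X0 `*` X0)) = 0%E.
Proof.
rewrite probability_setC; last exact: measurableX.
rewrite -[X in (1 - X)%E]/((Q \x Q)%E (X0 `*` X0)).
have -> : (Q \x Q)%E (X0 `*` X0) = (Q X0 * Q X0)%E by exact: product_measure1E.
by rewrite QX0_1 mule1 subee.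
Qed.

(** The two kernels agree on X0 * X0, whose complement is null for Q \x Q. *)
Lemma dksd2_patched t : ball ts rho t ->
  fine (DKSD2 ts t) = \int[(Q \x Q)%E]_z skernel psi KK t z.
Proof.
move=> Bt; have Tt := ball_Theta Bt.
rewrite /DKSD2 (dksd2E oX dK (p0 Tt) (dp Tt) (dm Tt)); congr fine.
apply: (integral_eq_off_null (N := ~` (X0 `*` X0))).
- by apply: measurableC; exact: measurableX.
- exact: QQX0.
move=> [x y] /contrapT[/= X0x X0y]; congr EFin.
by rewrite [RHS]patched_kernelE// [RHS](stein_kernel_jetE oX dK (p0 Tt) (dp Tt) (dm Tt) (X0X X0x) (X0X X0y)).
Qed.

Let Rintegral_good (f h : 'rV[R]_d -> R) : (forall x, X0 x -> f x = h x) ->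
  \int[Q]_(x in X) f x = \int[Q]_x h x.
Proof.
move=> fh; congr fine; rewrite integral_mkcond.
apply: (integral_eq_off_null (N := ~` X0)); [exact: measurableC|exact: QX0|].
move=> x /contrapT X0x; rewrite patchE ifT ?fh//.
by rewrite inE; exact: X0X.
Qed.

Let skernel1_derive i x y : X0 x -> X0 y ->
  'D_(e i) (fun s => k0 s x y) ts = skernel1 psi KK i ts (x, y).
Proof.
move=> X0x X0y.
rewrite (derive_ext oB (g := skernel psi KK ^~ (x, y))); last exact: ballxx.
  have B0 : ball ts rho ts by exact: ballxx.
  rewrite (derive_val (is_derive := is_derive_skernel KK ndiff_patched (e i) (x, y) B0)).
  rewrite (bigD1 i)//= big1 => [|j ji]; last by rewrite mxE (negbTE ji) andbF mul0r.
  by rewrite mxE !eqxx mul1r addr0.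
by move=> s Bs; rewrite patched_kernelE.
Qed.

(** For x and y in X0 both kernels agree for all parameters in the ball, hence so do their
    derivatives at ts; the other points form a null set in each of the three integrals. *)
Lemma sigma_dksdE : sigma_dksd X k0 Q ts = \matrix_(i, j)
  \int[Q]_x (marginal Q (skernel1 psi KK i ts) x * marginal Q (skernel1 psi KK j ts) x).
Proof.
apply/matrixP => i j; rewrite !mxE; apply: Rintegral_good => x X0x.
congr (_ * _); rewrite /marginal; apply: Rintegral_good => y X0y;
  exact: skernel1_derive.
Qed.

Hypothesis iidX : iid Q Xs.

Lemma usum_patched n w t : (2 <= n)%N -> (forall i, X0 (Xs i w)) -> ball ts rho t ->
  usum Xs (skernel psi KK t) n w =
  (n * n.-1)%:R * dksd2_ustat (k0 t) n (fun i => Xs i w).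
Proof.
move=> n2 X0w Bt; rewrite /dksd2_ustat mulrA mulfV ?mul1r; last first.
  by rewrite pnatr_eq0 muln_eq0; lia.
by apply: eq_bigr => i _; apply: eq_bigr => j _; rewrite patched_kernelE.
Qed.

Lemma ae_good_sample : {ae Pr, forall w, forall i, X0 (Xs i w)}.
Proof.
apply: ae_foralln => i; exists (Xs i @^-1` (~` X0)); split => //.
- by rewrite -[X in measurable X]setTI; apply: measurable_funP => //; exact: measurableC.
- by rewrite -QX0; apply: iidX.1; exact: measurableC.
Qed.

Lemma argmin_patched :
  (forall n, (2 <= n)%N -> {ae Pr, forall w,
     argmin Theta (fun t => dksd2_ustat (k0 t) n (fun i => Xs i w)) (that n w)}) ->
  op1 Pr (fun n w => `|that n w - ts|) ->
  whp Pr (fun n => [set w | \forall t \near that n w,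
    usum Xs (skernel psi KK (that n w)) n w <= usum Xs (skernel psi KK t) n w]).
Proof.
move=> argm cons.
have ae2 : whp Pr (fun n => [set w | (forall i, X0 (Xs i w)) /\
    argmin Theta (fun t => dksd2_ustat (k0 t) n (fun i => Xs i w)) (that n w)]).
  apply: whp_ae; exists 2%N => // n /= n2.
  by apply: filterS2 ae_good_sample (argm n n2) => w h1 h2; split.
have rho2 : 0 < rho / 2 by rewrite divr_gt0.
apply: whp_sub (whpI ae2 (cons _ rho2)); exists 2%N => // n /= n2 w [[X0w [_ am]] /= cw].
have Bw : ball ts rho (that n w).
  rewrite -ball_normE /= distrC; apply: le_lt_trans (ler_norm _) _.
  by apply: le_lt_trans cw _; rewrite ltr_pdivrMr// ltr_pMr// ltr1n.
have nB : \forall t \near that n w, ball ts rho t by apply: open_nbhs_nbhs; split.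
apply: filterS nB => t Bt; rewrite (usum_patched n2 X0w Bw) (usum_patched n2 X0w Bt).
exact: (ler_wpM2l (ler0n _ _) (am _ (ball_Theta Bt))).
Qed.

Section AsymptoticNormality.
Hypothesis F0 : forall x, X0 x -> 0 <= F x.
Hypothesis G0 : forall x, X0 x -> 0 <= G x.
Hypothesis mF : measurable_fun setT (fun x => \1_X0 x * F x).
Hypothesis F2 : L1 Q (fun x => (\1_X0 x * F x) ^+ 2).
Hypothesis lG : L1 Q (fun x => \1_X0 x * G x).
Hypothesis argmin_ts : argmin Theta (fun t => DKSD2 ts t) = [set ts].
Hypothesis DKSD2_diag : \forall t \near ts, DKSD2 t t = 0%E.
Variable U : set ('rV[R]_r * 'rV[R]_r).
Hypothesis nU : nbhs (ts, ts) U.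
Hypothesis finU : forall z, U z -> DKSD2 z.1 z.2 \is a fin_num.
Hypothesis dU : cndiff (@prod_basis R r r) 2 U (fun z => fine (DKSD2 z.1 z.2)).
Hypothesis argm : forall n, (2 <= n)%N -> {ae Pr, forall w,
  argmin Theta (fun t => dksd2_ustat (k0 t) n (fun i => Xs i w)) (that n w)}.
Hypothesis consistent : op1 Pr (fun n w => `|that n w - ts|).
Hypothesis gu : g \in unitmx.

Theorem minimum_stein_normality : exists nu : probability 'rV[R]_r R,
  is_normal 0 (invmx g *m sigma_dksd X k0 Q ts *m invmx g) nu /\
  cvg_in_distribution Pr (fun n w => Num.sqrt n%:R *: (that n w - ts)) nu.
Proof.
rewrite sigma_dksdE.
have dn01' al x t : ball ts rho t ->
    dnorm (@ebasis R r) 0 (psi al ^~ x) t + dnorm (@ebasis R r) 1 (psi al ^~ x) t <=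
    \1_X0 x * F x.
  move=> Bt; rewrite !dnorm_patched// -mulrDr; have [X0x|X0x] := pselect (X0 x).
    by rewrite (indic1 R X0x) !mul1r; exact: dn01.
  by rewrite (indic0 R X0x) !mul0r.
have dn23' al x t : ball ts rho t ->
    dnorm (@ebasis R r) 2 (psi al ^~ x) t + dnorm (@ebasis R r) 3 (psi al ^~ x) t <=
    \1_X0 x * G x.
  move=> Bt; rewrite !dnorm_patched// -mulrDr; have [X0x|X0x] := pselect (X0 x).
    by rewrite (indic1 R X0x) !mul1r; exact: dn23.
  by rewrite (indic0 R X0x) !mul0r.
have F0' x : 0 <= \1_X0 x * F x.
  have [X0x|X0x] := pselect (X0 x); last by rewrite (indic0 R X0x) mul0r.
  by rewrite (indic1 R X0x) mul1r F0.
have G0' x : 0 <= \1_X0 x * G x.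
  have [X0x|X0x] := pselect (X0 x); last by rewrite (indic0 R X0x) mul0r.
  by rewrite (indic1 R X0x) mul1r G0.
exact: (smooth_kernel_minimization iidX rho0 (kjet_le oX dK KB) (measurable_kjet oX dK)
  (kjetC oX rK dK) measurable_patched ndiff_patched dn01' dn23' mF F2 lG F0' G0'
  (normr_ge0 B) dksd2_patched (differentiable_dksd2 nU dU)
  (differentiable_derive_dksd2 nU dU) (min_dksd2 argmin_ts nU finU)
  (hessian_dksd2 argmin_ts DKSD2_diag nU finU dU) gu consistent
  (argmin_patched argm consistent)).
Qed.

End AsymptoticNormality.

End GoodPoints.

End MinimumStein.

Lemma ndiff_leq (R : realType) (V W : normedModType R) (I : finType) (e : I -> V)
    k l (A : set V) (f : V -> W) : (k <= l)%N -> ndiff e l A f -> ndiff e k A f.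
Proof.
elim: k l f => [|k IH] [|l] f //= kl [df ddf]; split=> // i; exact: IH (ddf i).
Qed.

Lemma probability_good_points (R : realType) d (S : measurableType d) (Q : probability S R)
    (X : set S) (H : S -> Prop) : measurable X -> Q X = 1%E ->
  {ae Q, forall x, X x -> H x} ->
  exists X0, [/\ measurable X0, X0 `<=` X, Q (~` X0) = 0%E & forall x, X0 x -> H x].
Proof.
move=> mX QX [N0 [mN0 QN0 sN0]]; exists (X `\` N0).
have mX0 : measurable (X `\` N0) by exact: measurableD.
split=> [//|x []//||x [Xx N0x]].
- apply/eqP; rewrite eq_le measure_ge0 andbT.
  have -> : ~` (X `\` N0) = ~` X `|` N0 by rewrite setCD.
  apply: (le_trans (measureU2 _ (measurableC mX) mN0)).
  have QXC : Q (~` X) = 0%E by rewrite probability_setC// QX subee.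
  by rewrite -[leLHS]/(Q (~` X) + Q N0)%E QXC QN0 adde0.
- by apply: contrapT => Hx; apply: N0x; apply: sN0 => /= /(_ Xx).
Qed.

Section RestrictedIntegrability.
Context (R : realType) (d : nat) (Q : probability 'rV[R]_d R) (X : set 'rV[R]_d).
Hypothesis oX : open X.

Lemma measurable_indic_within (X0 : set 'rV[R]_d) (f : 'rV[R]_d -> R) :
  measurable X0 -> X0 `<=` X -> {within X, continuous f} ->
  measurable_fun setT (fun x => \1_X0 x * f x).
Proof.
move=> mX0 X0X cf; apply: measurable_indicM => //.
apply: (measurable_funS (open_measurable_rV oX) X0X).
apply: measurable_fun_continuous_in => // x Xx.
by move: cf; rewrite continuous_open_subspace// => /(_ x); apply; rewrite inE.
Qed.

Lemma L1_indic (f : 'rV[R]_d -> R) :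
  Q.-integrable X (EFin \o f) -> L1 Q (fun x => \1_X x * f x).
Proof.
move=> /(integrable_mkcond _ (open_measurable_rV oX)); congr integrable.
apply/funext => x; rewrite patchE; have [Xx|Xx] := pselect (X x).
  by rewrite mem_set// /= (indic1 R Xx) mul1r.
by rewrite memNset// /= (indic0 R Xx) mul0r.
Qed.

End RestrictedIntegrability.

Theorem theorem4 (R : realType) (d r : nat)
    (X : set 'rV[R]_d) (Theta : set 'rV[R]_r)
    (P : 'rV[R]_r -> probability 'rV[R]_d R)
    (p : 'rV[R]_r -> 'rV[R]_d -> R)
    (m : 'rV[R]_r -> 'rV[R]_d -> 'M[R]_d)
    (K : 'rV[R]_d -> 'rV[R]_d -> 'M[R]_d)
    (ts : 'rV[R]_r)
    (dT : measure_display) (T : measurableType dT) (Pr : probability T R)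
    (Xs : nat -> {RV Pr >-> 'rV[R]_d})
    (that : nat -> {RV Pr >-> 'rV[R]_r})
    (N : set 'rV[R]_r)
    (f1 f2 g1 g2 : 'rV[R]_d -> R) :
  let Q := P ts in
  let k0 := fun t => stein_kernel (p t) (m t) K in
  let DKSD2 := fun a t => dksd2 X (k0 t) (P a) in
  let DKSD2_hat := fun n x t => dksd2_ustat (k0 t) n x in
  let s := fun x t => diff_score (p t) (m t) x in
  let mt := fun x t => m t x in
  let dm := fun j x t => 'D_(ebasis R j) (m t) x in
  let nablaV := @dnorm R 'rV[R]_r 'cV[R]_d 'I_r (@ebasis R r) in
  let nablaM := @dnorm R 'rV[R]_r 'M[R]_d 'I_r (@ebasis R r) in
  let g := info_tensor (fun a t => fine (DKSD2 a t)) ts in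
  let Sigma := sigma_dksd X k0 Q ts in
  (* the model *)
  open X -> open Theta ->
  (forall t, Theta t -> has_pos_density X (P t) (p t)) ->
  (forall t, Theta t -> forall x, X x ->
     differentiable (p t) x /\ differentiable (m t) x) ->
  (* the kernel *)
  reproducing_kernel X K ->
  ndiff (@prod_basis R d d) 2 (X `*` X) (fun z => K z.1 z.2) ->
  (exists B : R, forall k x y, (k <= 2)%N -> X x -> X y ->
     dnorm (@prod_basis R d d) k (fun z => K z.1 z.2) (x, y) <= B) ->
  (* the true parameter *)
  argmin Theta (fun t => DKSD2 ts t) = [set ts] ->
  (* DKSD_{K,m}(P_a || P_t)^2 vanishes for a = t, and is finite and twice
     continuously differentiable in (a, t), for a, t near theta_* *)
  (\forall t \near ts, DKSD2 t t = 0%E) ->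
  (exists U : set ('rV[R]_r * 'rV[R]_r),
     [/\ nbhs (ts, ts) U,
         (forall z, U z -> DKSD2 z.1 z.2 \is a fin_num) &
         cndiff (@prod_basis R r r) 2 U (fun z => fine (DKSD2 z.1 z.2))]) ->
  (* the sample and the estimator *)
  iid Q Xs ->
  (forall n, (2 <= n)%N -> {ae Pr, forall w,
     argmin Theta (DKSD2_hat n (fun i => Xs i w)) (that n w)}) ->
  cvg_in_probability Pr (fun n => that n : T -> 'rV[R]_r) ts ->
  (* the compact neighbourhood of theta_* *)
  compact N -> nbhs ts N -> N `<=` Theta ->
  (forall n, (2 <= n)%N -> {ae Pr, forall w,
     cndiff (@ebasis R r) 2 N (DKSD2_hat n (fun i => Xs i w))}) ->
  {ae Q, forall x, X x ->
     [/\ ndiff (@ebasis R r) 3 N (s x),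
         ndiff (@ebasis R r) 3 N (mt x) &
         forall j, ndiff (@ebasis R r) 3 N (dm j x)]} ->
  {ae Q, forall x, X x -> forall t, N t ->
     [/\ nablaV 0%N (s x) t + nablaV 1%N (s x) t <= f1 x,
         nablaM 0%N (mt x) t + \sum_j nablaM 0%N (dm j x) t
           + nablaM 1%N (mt x) t + \sum_j nablaM 1%N (dm j x) t <= f2 x,
         nablaV 2%N (s x) t + nablaV 3%N (s x) t <= g1 x &
         nablaM 2%N (mt x) t + \sum_j nablaM 2%N (dm j x) t
           + nablaM 3%N (mt x) t + \sum_j nablaM 3%N (dm j x) t <= g2 x]} ->
  {within X, continuous f1} -> {within X, continuous f2} ->
  {within X, continuous g1} -> {within X, continuous g2} ->
  Q.-integrable X (fun x => (f1 x ^+ 2)%:E) ->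
  Q.-integrable X (fun x => (f2 x ^+ 2)%:E) ->
  Q.-integrable X (fun x => (g1 x)%:E) ->
  Q.-integrable X (fun x => (g2 x)%:E) ->
  g \in unitmx ->
  exists nu : probability 'rV[R]_r R,
    is_normal 0 (invmx g *m Sigma *m invmx g) nu /\
    cvg_in_distribution Pr
      (fun n w => Num.sqrt n%:R *: (that n w - ts)) nu.
Proof.
move=> Q k0 DKSD2 DKSD2_hat s mt dm nablaV nablaM g Sigma oX oTheta dens dpm rK dK [B KB].
move=> argmin_ts diag [U [nU finU dU]] iidX argm cons _ nN NTheta _ ae_nd ae_bd.
move=> cf1 cf2 cg1 cg2 if1 if2 ig1 ig2 gu.
have Theta_ts : Theta ts.
  by have [] : argmin Theta (fun t => DKSD2 ts t) ts by rewrite argmin_ts.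
have mX : measurable X by exact: open_measurable_rV.
(* The density formula integrates over A and X together, so A = X and the whole space have the same
   mass. *)
have QX : Q X = 1%E.
  have [_ _ PE] := dens ts Theta_ts.
  by rewrite /Q PE// setIid -[X in integral _ X]setTI -PE// probability_setT.
have /(probability_good_points mX QX)[X0 [mX0 X0X QX0 good]] : {ae Q, forall x, X x ->
    [/\ ndiff (@ebasis R r) 3 N (s x), ndiff (@ebasis R r) 3 N (mt x) &
       forall j, ndiff (@ebasis R r) 3 N (dm j x)] /\
    forall t, N t ->
     [/\ nablaV 0%N (s x) t + nablaV 1%N (s x) t <= f1 x,
         nablaM 0%N (mt x) t + \sum_j nablaM 0%N (dm j x) t
           + nablaM 1%N (mt x) t + \sum_j nablaM 1%N (dm j x) t <= f2 x,
         nablaV 2%N (s x) t + nablaV 3%N (s x) t <= g1 x &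
         nablaM 2%N (mt x) t + \sum_j nablaM 2%N (dm j x) t
           + nablaM 3%N (mt x) t + \sum_j nablaM 3%N (dm j x) t <= g2 x]}.
  by apply: filterS2 ae_nd ae_bd => x h1 h2 Xx; split; [exact: h1|exact: h2].
have [rho rho0 BN] : exists2 rho : R, 0 < rho & ball ts rho `<=` N.
  by have /nbhs_ballP[rho rho0 BN] := nN; exists rho.
have oB : open (ball ts rho) by exact: ball_open.
have B0 : ball ts rho ts by exact: ballxx.
(* A feature is an entry of m, or the score plus derivatives of m in x; hence f1 + f2 and g1 + g2 as
   majorants. *)
have feature_le al x k t : X0 x -> (k <= 3)%N -> ball ts rho t ->
    dnorm (@ebasis R r) k (fun t => stein_feature (p t) (m t) al x) t <=
    nablaV k (s x) t + (nablaM k (mt x) t + \sum_j nablaM k (dm j x) t).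
  move=> X0x k3 Bt; have [[nds ndm nddm] _] := good x X0x.
  exact: (dnorm_stein_feature_le oB al (ndiff_leq k3 (ndiffS BN nds))
    (ndiff_leq k3 (ndiffS BN ndm)) (fun j => ndiff_leq k3 (ndiffS BN (nddm j))) Bt).
(* The majorants dominate sums of norms at the parameter ts, so they are nonnegative on X0. *)
have bounds x : X0 x -> 0 <= f1 x + f2 x /\ 0 <= g1 x + g2 x.
  move=> X0x; have [_ /(_ ts (BN _ B0))[]] := good x X0x.
  have V k := dnorm_ge0 (@ebasis R r) k (s x) ts.
  have M k := dnorm_ge0 (@ebasis R r) k (mt x) ts.
  have D k : 0 <= \sum_j nablaM k (dm j x) ts.
    by apply: sumr_ge0 => j _; exact: dnorm_ge0.
  move: (V 0%N) (V 1%N) (V 2%N) (V 3%N) (M 0%N) (M 1%N) (M 2%N) (M 3%N)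
    (D 0%N) (D 1%N) (D 2%N) (D 3%N); rewrite -!/(nablaV _ _ _) -!/(nablaM _ _ _).
  move: (nablaV 0%N _ _) (nablaV 1%N _ _) (nablaV 2%N _ _) (nablaV 3%N _ _).
  move: (nablaM 0%N (mt x) ts) (nablaM 1%N (mt x) ts) (nablaM 2%N (mt x) ts) (nablaM 3%N (mt x) ts).
  move: (\sum_j nablaM 0%N _ _) (\sum_j nablaM 1%N _ _) (\sum_j nablaM 2%N _ _) (\sum_j nablaM 3%N _ _).
  by move=> *; split; lra.
have mi (f : 'rV[R]_d -> R) : {within X, continuous f} -> measurable_fun setT (fun x => \1_X0 x * f x).
  exact: measurable_indic_within.
have mF : measurable_fun setT (fun x => \1_X0 x * (f1 x + f2 x)).
  rewrite (_ : (fun x => _) = (fun x => \1_X0 x * f1 x + \1_X0 x * f2 x)).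
    by apply: measurable_funD; exact: mi.
  by apply/funext => x; rewrite mulrDr.
have mG : measurable_fun setT (fun x => \1_X0 x * (g1 x + g2 x)).
  rewrite (_ : (fun x => _) = (fun x => \1_X0 x * g1 x + \1_X0 x * g2 x)).
    by apply: measurable_funD; exact: mi.
  by apply/funext => x; rewrite mulrDr.
have F2 : L1 Q (fun x => (\1_X0 x * (f1 x + f2 x)) ^+ 2).
  apply: (L1_le _ _ (L1Z 2 (L1D (L1_indic oX if1) (L1_indic oX if2)))).
    exact: measurable_funX.
  move=> x; rewrite ger0_norm ?sqr_ge0//; have [X0x|X0x] := pselect (X0 x).
    rewrite (indic1 R X0x) (indic1 R (X0X _ X0x)) !mul1r.
    by have := sqr_ge0 (f1 x - f2 x); nra.
  rewrite (indic0 R X0x) mul0r expr0n/= mulr_ge0// addr_ge0// mulr_ge0// ?sqr_ge0//.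
have lG : L1 Q (fun x => \1_X0 x * (g1 x + g2 x)).
  apply: (L1_le mG _ (L1D (L1_norm (L1_indic oX ig1)) (L1_norm (L1_indic oX ig2)))).
  move=> x; have [X0x|X0x] := pselect (X0 x).
    by rewrite (indic1 R X0x) (indic1 R (X0X _ X0x)) !mul1r ler_normD.
  by rewrite (indic0 R X0x) mul0r normr0 addr_ge0.
have p0 t : Theta t -> forall x, X x -> 0 < p t x by move=> /dens[].
have nd al x : X0 x -> ndiff (@ebasis R r) 3 (ball ts rho)
    (fun t => stein_feature (p t) (m t) al x).
  move=> X0x; have [[nds ndm nddm] _] := good x X0x.
  exact: (ndiff_stein_feature oB (ndiffS BN nds) (ndiffS BN ndm) (fun j => ndiffS BN (nddm j))).
have dn01 al x t : X0 x -> ball ts rho t ->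
    dnorm (@ebasis R r) 0 (fun t => stein_feature (p t) (m t) al x) t +
    dnorm (@ebasis R r) 1 (fun t => stein_feature (p t) (m t) al x) t <= f1 x + f2 x.
  move=> X0x Bt; have [_ /(_ t (BN _ Bt))[h1 h2 _ _]] := good x X0x.
  apply: (le_trans (lerD (feature_le al x 0%N t X0x isT Bt) (feature_le al x 1%N t X0x isT Bt))).
  by apply: (le_trans _ (lerD h1 h2)); rewrite le_eqVlt; apply/orP; left; apply/eqP; ring.
have dn23 al x t : X0 x -> ball ts rho t ->
    dnorm (@ebasis R r) 2 (fun t => stein_feature (p t) (m t) al x) t +
    dnorm (@ebasis R r) 3 (fun t => stein_feature (p t) (m t) al x) t <= g1 x + g2 x.
  move=> X0x Bt; have [_ /(_ t (BN _ Bt))[_ _ h1 h2]] := good x X0x.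
  apply: (le_trans (lerD (feature_le al x 2%N t X0x isT Bt) (feature_le al x 3%N t X0x isT Bt))).
  by apply: (le_trans _ (lerD h1 h2)); rewrite le_eqVlt; apply/orP; left; apply/eqP; ring.
exact: (@minimum_stein_normality R d r X Theta P p m K ts dT T Pr Xs that oX oTheta p0
  (fun t Tt x Xx => (dpm t Tt x Xx).1) (fun t Tt x Xx => (dpm t Tt x Xx).2)
  rK dK B KB X0 rho (fun x => f1 x + f2 x) (fun x => g1 x + g2 x) mX0 X0X QX0 rho0 (subset_trans BN NTheta) nd dn01 dn23 iidX
  (fun x X0x => (bounds x X0x).1) (fun x X0x => (bounds x X0x).2) mF F2 lG argmin_ts diag U
  nU finU dU argm (cvg_in_probability_op1 cons) gu).
Qed.
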